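(* Let $\Omega\subset\mathbb{R}^d$ be a nonempty open set. For $T\in\mathscr{E}'(V(\Omega))$ put $$C_T(z)=T_\xi\Big(\prod_{j=1}^d\frac{1}{1-\xi_jz_j}\Big),\quad z\in W(\operatorname{supp}T)=\{z\in\mathbb{C}^d: x_jz_j\ne1\text{ for all }x\in\operatorname{supp}T,\ j=1,\dots,d\}.$$ Then $C_T$ is holomorphic in a neighborhood of $0$ with Taylor expansion $C_T(z)=\sum_{\alpha\in\mathbb{N}_0^d}m_\alpha z^\alpha$ there, where $m_\alpha=T_\xi(\xi^\alpha)$, and $T\mapsto C_T$ establishes an algebra isomorphism of $M(\Omega)\cong(\mathscr{E}'(V(\Omega)),\star)$ onto an algebra of functions holomorphic around zero (namely $\{C_T:T\in\mathscr{E}'(V(\Omega))\}$) equipped with Hadamard multiplication, i.e. multiplication of the Taylor coefficients at $0$. Moreover $$C_T(z)=\frac{1}{z_1\cdots z_d}\,\mathcal{C}_T(1/z)$$ for all $z\in(\mathbb{C}\setminus\{0\})^d$ such that $1/z\in\mathscr{W}(\operatorname{supp}T)$.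
   Context: $xy=(x_1y_1,\dots,x_dy_d)$ and $1/z=(1/z_1,\dots,1/z_d)$. $V(\Omega)=\{\eta\in\mathbb{R}^d:\eta\Omega\subset\Omega\}$. $\mathscr{E}'(V(\Omega))$ is the set of distributions on $\mathbb{R}^d$ with compact support contained in $V(\Omega)$, with multiplication $(T\star S)f=T_x(S_yf(xy))$, $f\in C^\infty(\mathbb{R}^d)$. $M(\Omega)$ is the algebra of Hadamard operators, i.e. of continuous linear operators on $C^\infty(\Omega)$ admitting all monomials as eigenvectors; it is identified with $(\mathscr{E}'(V(\Omega)),\star)$ by $T\mapsto M_T$, $(M_Tf)(x)=T_yf(xy)$. For $B\subset\mathbb{R}^d$, $\mathscr{W}(B)=\{z\in\mathbb{C}^d:\xi_j\ne z_j\text{ for all }\xi\in B\text{ and }j=1,\dots,d\}$, and for $z\in\mathscr{W}(\operatorname{supp}T)$, $\mathcal{C}_T(z)=T_\xi\big(\prod_{j=1}^d\frac{1}{z_j-\xi_j}\big)$. Hadamard multiplication of $\sum_\alpha a_\alpha z^\alpha$ and $\sum_\alpha b_\alpha z^\alpha$ is $\sum_\alpha a_\alpha b_\alpha z^\alpha$. *)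

(* Defs.v *)
From HB Require Import structures.
From mathcomp Require Import all_boot all_order all_algebra.
From mathcomp Require Import complex.
From mathcomp Require Import all_classical all_reals all_analysis.
From mathcomp.analysis.showcase Require summability.

Set Implicit Arguments.
Unset Strict Implicit.
Unset Printing Implicit Defensive.
Import Order.TTheory GRing.Theory Num.Theory.
Import numFieldNormedType.Exports.
Local Open Scope classical_set_scope.
Local Open Scope complex_scope.
Local Open Scope ring_scope.

(* R[i], a normed field in the library, gets its topology and becomes a normed
   space over itself. *)
HB.instance Definition _ (R : rcfType) := NormedModule.copy R[i] R[i]^o.

Section SmoothFunctions.
Context {R : realType} {d : nat}.
Local Notation C := R[i].
Local Notation V := 'rV[R]_d.
Implicit Types (Omega : set V) (f g : V -> C) (s : seq 'I_d) (x : V).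

Definition pderivable (j : 'I_d) f x : Prop :=
  derivable (fun y => complex.Re (f y)) x (delta_mx 0 j) /\
  derivable (fun y => complex.Im (f y)) x (delta_mx 0 j).

Definition pderiv (j : 'I_d) f : V -> C := fun x =>
  'D_(delta_mx 0 j) (fun y => complex.Re (f y)) x +i*
  'D_(delta_mx 0 j) (fun y => complex.Im (f y)) x.

(* Iterated partial derivatives, indexed by the list of directions; the order
   of the derivative is [size s]. *)
Definition pderivs s f : V -> C := foldr pderiv f s.

Definition regular f x : Prop :=
  {for x, continuous f} /\ forall j, pderivable j f x.

Definition smooth_on Omega f : Prop :=
  forall s x, Omega x -> \forall y \near x, regular (pderivs s f) y.

(* An element of C^oo(Omega) is represented by its extension by 0 outside
   Omega, so that Leibniz equality is equality of functions on Omega. *)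
Definition smoothp Omega : {pred V -> C} :=
  [pred f | `[< smooth_on Omega f /\ forall x, ~ Omega x -> f x = 0 >]].

Lemma ReD (z w : C) : complex.Re (z + w) = complex.Re z + complex.Re w.
Proof. by case: z w => [? ?] [? ?]. Qed.
Lemma ImD (z w : C) : complex.Im (z + w) = complex.Im z + complex.Im w.
Proof. by case: z w => [? ?] [? ?]. Qed.
Lemma ReZ (a z : C) : complex.Re (a *: z) =
  complex.Re a * complex.Re z - complex.Im a * complex.Im z.
Proof. by case: a z => [? ?] [? ?]. Qed.
Lemma ImZ (a z : C) : complex.Im (a *: z) =
  complex.Re a * complex.Im z + complex.Im a * complex.Re z.
Proof. by case: a z => [? ?] [? ?]. Qed.

Lemma is_derive_lin (a : C) f g x j :
  pderivable j f x -> pderivable j g x ->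
  is_derive x (delta_mx 0 j : V) (fun y => complex.Re (a *: f y + g y))
    (complex.Re (a *: pderiv j f x + pderiv j g x)) /\
  is_derive x (delta_mx 0 j : V) (fun y => complex.Im (a *: f y + g y))
    (complex.Im (a *: pderiv j f x + pderiv j g x)).
Proof.
move=> [/derivableP Rf /derivableP If] [/derivableP Rg /derivableP Ig].
split.
  rewrite [X in is_derive _ _ X _](_ : _ =
    complex.Re a *: (fun y => complex.Re (f y))
    - complex.Im a *: (fun y => complex.Im (f y))
    + (fun y => complex.Re (g y))); last by apply/funext => y; rewrite ReD ReZ.
  by rewrite ReD ReZ; apply: is_deriveD.
rewrite [X in is_derive _ _ X _](_ : _ =
  complex.Re a *: (fun y => complex.Im (f y))
  + complex.Im a *: (fun y => complex.Re (f y))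
  + (fun y => complex.Im (g y))); last by apply/funext => y; rewrite ImD ImZ.
rewrite ImD ImZ.
exact: (is_deriveD (is_deriveD (is_deriveZ _ If) (is_deriveZ _ Rf)) Ig).
Qed.

Lemma pderiv_lin (a : C) f g x j :
  pderivable j f x -> pderivable j g x ->
  pderiv j (a *: f + g) x = a *: pderiv j f x + pderiv j g x.
Proof.
move=> df dg; have [dR dI] := is_derive_lin a df dg.
rewrite /pderiv; transitivity (complex.Re (a *: pderiv j f x + pderiv j g x) +i*
  complex.Im (a *: pderiv j f x + pderiv j g x)); last by case: (_ + _ : C).
by congr (_ +i* _); [exact: (@derive_val _ _ _ _ _ _ _ dR)
                    |exact: (@derive_val _ _ _ _ _ _ _ dI)].
Qed.

Lemma near_pderiv j f g x :
  (\forall y \near x, f y = g y) -> pderiv j f x = pderiv j g x.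
Proof.
move=> fg; rewrite /pderiv.
by congr (_ +i* _); apply: near_eq_derive;
  near=> y; congr (_ _); near: y.
Unshelve. all: by end_near. Qed.


Lemma regular_lin (a : C) f g h x : regular f x -> regular g x ->
  (\forall y \near x, h y = (a *: f + g) y) ->
  regular h x /\ forall j, pderiv j h x = a *: pderiv j f x + pderiv j g x.
Proof.
move=> [cf df] [cg dg] hE; split; last first.
  by move=> j; rewrite (near_pderiv j hE); exact: pderiv_lin.
have hE' : {near x, a *: f + g =1 h} by apply: filterS hE => y ->.
split=> [|j].
  rewrite /prop_for /continuous_at (nbhs_singleton hE).
  apply: cvg_trans; first exact: near_eq_cvg hE'.
  apply: cvgD; last exact: cg.
  by apply: cvgZl_tmp; exact: cf.
have [dR dI] := is_derive_lin a (df j) (dg j).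
split.
  by apply: near_eq_derivable (@ex_derive _ _ _ _ _ _ _ dR);
    apply: filterS hE' => y <-.
by apply: near_eq_derivable (@ex_derive _ _ _ _ _ _ _ dI);
  apply: filterS hE' => y <-.
Qed.

Lemma pderivs_lin Omega (a : C) f g : smooth_on Omega f -> smooth_on Omega g ->
  forall s x, Omega x -> \forall y \near x,
    pderivs s (a *: f + g) y = (a *: pderivs s f + pderivs s g) y.
Proof.
move=> sf sg; elim=> [|j s IH] x Ox; first by near=> y.
apply: (filterS3 _ _ (sf s x Ox) (sg s x Ox) (nbhs_interior (IH x Ox))).
move=> y rf rg ly; exact: (regular_lin rf rg ly).2.
Unshelve. all: by end_near. Qed.

Lemma smooth_on_lin Omega (a : C) f g :
  smooth_on Omega f -> smooth_on Omega g -> smooth_on Omega (a *: f + g).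
Proof.
move=> sf sg s x Ox.
apply: (filterS3 _ _ (sf s x Ox) (sg s x Ox)
  (nbhs_interior (pderivs_lin a sf sg s Ox))).
move=> y rf rg ly; exact: (regular_lin rf rg ly).1.
Qed.

Lemma pderivs0 s : pderivs s (0 : V -> C) = 0.
Proof.
elim: s => //= j s ->; apply/funext => x.
by rewrite /pderiv /= !derive_cst.
Qed.

Lemma smooth_on0 Omega : smooth_on Omega (0 : V -> C).
Proof.
move=> s x _; rewrite pderivs0; near=> y; split.
  exact: (@cst_continuous V C 0 y).
by move=> j; split; exact: derivable_cst.
Unshelve. all: by end_near. Qed.

Lemma smoothp_submod Omega : submod_closed (smoothp Omega).
Proof.
split=> [|a f g].
  by apply/asboolT; split=> //; exact: smooth_on0.
move=> /asboolW[sf f0] /asboolW[sg g0]; apply/asboolT; split.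
  exact: smooth_on_lin.
by move=> x Ox; rewrite !fctE f0// g0// scaler0 addr0.
Qed.

HB.instance Definition _ Omega :=
  GRing.isSubmodClosed.Build C (V -> C) (smoothp Omega)
    (smoothp_submod Omega).

End SmoothFunctions.

Section Cinfty.
Context {R : realType} {d : nat}.
Local Notation C := R[i].
Local Notation V := 'rV[R]_d.
Variable Omega : set V.

Record Cinfty := MkCinfty {
  Cinfty_fun :> V -> C;
  Cinfty_subproof : Cinfty_fun \in smoothp Omega }.

HB.instance Definition _ := [isSub for Cinfty_fun].
HB.instance Definition _ := [Choice of Cinfty by <:].
HB.instance Definition _ := [SubChoice_isSubLmodule of Cinfty by <:].

(* The restriction of g to Omega as an element of C^oo(Omega); the default
   value 0 is only used if g is not smooth on Omega. *)
Definition toCinfty (g : V -> C) : Cinfty := insubd (0 : Cinfty) (g \_ Omega).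

(* The topology of uniform convergence on compact subsets of Omega of all
   derivatives; (K, k, e) below ranges over the basic neighbourhoods of f. *)
Definition Cinfty_close (K : set V) (k : nat) (e : R) (f g : Cinfty) : Prop :=
  forall s, (size s <= k)%N -> forall x, K x ->
    `|pderivs s g x - pderivs s f x| < e%:C.

Definition Cinfty_nbhs (f : Cinfty) (A : set Cinfty) : Prop :=
  exists K k e, [/\ compact K, K `<=` Omega, 0 < e &
    Cinfty_close K k e f `<=` A].

Lemma Cinfty_close_refl K k e f : 0 < e -> Cinfty_close K k e f f.
Proof. by move=> e0 s _ x _; rewrite subrr normr0 ltcR. Qed.

Lemma Cinfty_nbhs_filter f : ProperFilter (Cinfty_nbhs f).
Proof.
split; first by case=> K [k [e [_ _ e0 /(_ f (@Cinfty_close_refl K k e f e0))]]].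
split.
- by exists set0, 0%N, 1; split=> //; exact: compact0.
- move=> A B [K [k [e [cK KO e0 KA]]]] [L [l [r [cL LO r0 LB]]]].
  exists (K `|` L), (maxn k l), (Num.min e r); split.
  + exact: compactU.
  + by move=> x [/KO|/LO].
  + by rewrite lt_min e0.
  + move=> g fg; split; [apply: KA|apply: LB] => s sk x Kx.
      apply: lt_le_trans (fg s _ x _) _; first by rewrite leq_max sk.
        by left.
      by rewrite lecR ge_min lexx.
    apply: lt_le_trans (fg s _ x _) _; first by rewrite leq_max sk orbT.
      by right.
    by rewrite lecR ge_min lexx orbT.
- move=> A B AB [K [k [e [cK KO e0 KA]]]].
  by exists K, k, e; split=> // g /KA /AB.
Qed.

Lemma Cinfty_nbhs_singleton f A : Cinfty_nbhs f A -> A f.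
Proof. by case=> K [k [e [_ _ e0]]]; apply; exact: (@Cinfty_close_refl K k e f e0). Qed.

Lemma Cinfty_nbhs_nbhs f A : Cinfty_nbhs f A -> Cinfty_nbhs f (Cinfty_nbhs^~ A).
Proof.
move=> [K [k [e [cK KO e0 KA]]]].
have e20 : 0 < e / 2 by rewrite divr_gt0.
exists K, k, (e / 2); split=> // g fg.
exists K, k, (e / 2); split=> // h gh; apply: KA => s sk x Kx.
rewrite -(subrKA (pderivs s g x)) (le_lt_trans (ler_normD _ _))//.
by rewrite [e]splitr rmorphD ltrD// ?gh// fg.
Qed.

HB.instance Definition _ := hasNbhs.Build Cinfty Cinfty_nbhs.
HB.instance Definition _ := Nbhs_isNbhsTopological.Build Cinfty
  Cinfty_nbhs_filter Cinfty_nbhs_singleton Cinfty_nbhs_nbhs.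

End Cinfty.

Section Distributions.
Context {R : realType} {d : nat}.
Local Notation C := R[i].
Local Notation V := 'rV[R]_d.
Local Notation E := (Cinfty [set: V]).
Implicit Types (Omega A : set V) (T S : E -> C).

Definition hmul (x y : V) : V := \row_j (x 0 j * y 0 j).

Definition dilations Omega : set V :=
  [set eta | forall x, Omega x -> Omega (hmul eta x)].

Definition fsupp (f : V -> C) : set V := closure [set x | f x != 0].

Definition dsupp T : set V := [set x | forall W, nbhs x W ->
  exists phi : E, [/\ compact (fsupp phi), fsupp phi `<=` W & T phi != 0]].

(* Distributions with compact support are continuous linear forms on
   C^oo(R^d), which makes the third condition redundant. *)
Definition cdistr A : set (E -> C) := [set T | [/\ linear T, continuous T,
  compact (dsupp T) & dsupp T `<=` A]].

(* T(g) for a function g that is defined and smooth only near supp T: the value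
   of T at any element of C^oo(R^d) that coincides with g on a neighbourhood of
   supp T (0 if there is none). *)
Definition ev T (g : V -> C) : C :=
  T (xget 0 [set h : E | set_nbhs (dsupp T) [set x | h x = g x]]).

Definition star T S : E -> C :=
  fun f => ev T (fun x => ev S (fun y => f (hmul x y))).

Definition mono (alpha : {ffun 'I_d -> nat}) (z : 'rV[C]_d) : C :=
  \prod_j z 0 j ^+ alpha j.

Definition rmono (alpha : {ffun 'I_d -> nat}) (x : V) : C :=
  mono alpha (map_mx (real_complex R) x).

Definition Mop Omega T : Cinfty Omega -> Cinfty Omega :=
  fun f => toCinfty Omega (fun x => ev T (fun y => f (hmul x y))).

Definition hadamard_ops Omega : set (Cinfty Omega -> Cinfty Omega) :=
  [set M | [/\ linear M, continuous M & forall alpha, exists m : C,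
    M (toCinfty Omega (rmono alpha)) = m *: toCinfty Omega (rmono alpha)]].

Definition moment T (alpha : {ffun 'I_d -> nat}) : C := ev T (rmono alpha).

Definition cauchyW A : set 'rV[C]_d :=
  [set z | forall xi, A xi -> forall j, (xi 0 j)%:C != z 0 j].

Definition cauchy_transform T (z : 'rV[C]_d) : C :=
  ev T (fun xi => \prod_j (z 0 j - (xi 0 j)%:C)^-1).

Definition hadamardW A : set 'rV[C]_d :=
  [set z | forall x, A x -> forall j, (x 0 j)%:C * z 0 j != 1].

Definition hadamard_transform T (z : 'rV[C]_d) : C :=
  ev T (fun xi => \prod_j (1 - (xi 0 j)%:C * z 0 j)^-1).

End Distributions.
Arguments Mop {R d} Omega T f.
Arguments hadamard_ops {R d} Omega _.

Section HadamardMultiplication.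
Context {R : realType} {d : nat}.
Local Notation C := R[i].
Implicit Types (F G : 'rV[C]_d -> C) (a : {ffun 'I_d -> nat} -> C).

(* Partial sums of the multiple power series along the directed set of finite
   sets of multi-indices: convergence is unconditional. *)
Definition psums a (z : 'rV[C]_d) :=
  summability.partial_sum (fun alpha => a alpha * mono alpha z).

Definition taylor F : {ffun 'I_d -> nat} -> C :=
  xget (fun=> 0) [set a | \forall z \near (0 : 'rV[C]_d),
    psums a z @ summability.totally --> F z].

Definition hadamard_mul F G : 'rV[C]_d -> C := fun z =>
  lim (psums (fun alpha => taylor F alpha * taylor G alpha) z
         @ summability.totally).

Definition germ_eq F G : Prop := \forall z \near (0 : 'rV[C]_d), F z = G z.

(* The functions whose germ at 0 is the germ of some C_T. *)
Definition hadamard_germs (Omega : set 'rV[R]_d) : set ('rV[C]_d -> C) :=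
  [set F | exists2 T, cdistr (dilations Omega) T &
     germ_eq F (hadamard_transform T)].

End HadamardMultiplication.

(* Subalgebras of function spaces, up to an equivalence eqv such as equality of
   germs; eqv is Leibniz equality for algebras of operators or distributions. *)
Record is_algebra (K : fieldType) (V : lmodType K) (eqv : V -> V -> Prop)
    (A : set V) (mul : V -> V -> V) : Prop := IsAlgebra {
  alg_lin : forall a u v, A u -> A v -> A (a *: u + v);
  alg_mul : forall u v, A u -> A v -> A (mul u v);
  alg_eqv : forall u u' v v', A u -> A u' -> A v -> A v' ->
    eqv u u' -> eqv v v' -> eqv (mul u v) (mul u' v');
  alg_mulA : forall u v w, A u -> A v -> A w ->
    eqv (mul u (mul v w)) (mul (mul u v) w);
  alg_mull : forall a u v w, A u -> A v -> A w ->
    eqv (mul (a *: u + v) w) (a *: mul u w + mul v w);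
  alg_mulr : forall a u v w, A u -> A v -> A w ->
    eqv (mul w (a *: u + v)) (a *: mul w u + mul w v);
  alg_one : exists2 e, A e &
    forall u, A u -> eqv (mul e u) u /\ eqv (mul u e) u }.

Record algebra_iso (K : fieldType) (V W : lmodType K)
    (A : set V) (mulA : V -> V -> V)
    (eqB : W -> W -> Prop) (B : set W) (mulB : W -> W -> W)
    (Phi : V -> W) : Prop := AlgebraIso {
  iso_dom : is_algebra eq A mulA;
  iso_cod : is_algebra eqB B mulB;
  iso_maps : forall u, A u -> B (Phi u);
  iso_lin : forall a u v, A u -> A v ->
    eqB (Phi (a *: u + v)) (a *: Phi u + Phi v);
  iso_mul : forall u v, A u -> A v -> eqB (Phi (mulA u v)) (mulB (Phi u) (Phi v));
  iso_inj : forall u v, A u -> A v -> eqB (Phi u) (Phi v) -> u = v;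
  iso_surj : forall w, B w -> exists2 u, A u & eqB (Phi u) w }.

(* Main.v *)
Require Import Defs.
From HB Require Import structures.
From mathcomp Require Import all_boot all_order all_algebra.
From mathcomp Require Import complex.
From mathcomp Require Import all_classical all_reals all_analysis.
From mathcomp.analysis.showcase Require summability.
From mathcomp Require Import ring lra.

Set Implicit Arguments.
Unset Strict Implicit.
Unset Printing Implicit Defensive.
Import Order.TTheory GRing.Theory Num.Theory.
Import numFieldNormedType.Exports.
Local Open Scope classical_set_scope.
Local Open Scope complex_scope.
Local Open Scope ring_scope.

(** A continuous linear form T on C^oo(R^d) is determined by its moments
    T(x^al), since the polynomials are dense in C^oo(R^d) (form_vanish,
    form_ext). The density is obtained one coordinate at a time: Bernstein
    polynomials in the coordinate j commute with the derivatives in the other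
    coordinates, and derivatives along j are reached by integrating an
    approximation of the j-th partial derivative (approx_coord).

    Every algebraic claim thereby becomes a claim on moments. The form
    a T + S has the moments a m + m', the operator of T multiplies x^al by its
    moment (Mop_rmono), so T star S has the moments m m' (star_form), and the
    moments are the Taylor coefficients of the Hadamard transform
    (transform_expansion). Associativity, distributivity, units, injectivity
    and multiplicativity follow.

    What is left is of an analytic nature.

    - The values T(g) for g smooth near supp T: T vanishes on functions that
      vanish near supp T (support_vanish), so that cutting g off gives a well
      defined value, bounded by derivatives of g on a compact subset of any
      given neighbourhood of supp T (ev_bounded). Smoothness and continuity of
      M_T f come from differentiating T under a parameter
      (smooth_partial_form).
    - Every Hadamard operator L is some M_T (hadamard_representation). For a
      point x of Omega without zero coordinates, the form g |-> L(g(x^-1 .))(x)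
      has the eigenvalues of L as moments; it is therefore the same form T for
      all x. Each x confines supp T to x^-1 K, where K is a compact subset of
      Omega, and together these conditions say that supp T lies in the set of
      dilations of Omega. Applied to the composition of M_T and M_S, this also
      locates the support of T star S (star_cdistr).
    - Near 0, let T be bounded by the derivatives of order at most k on a
      compact set. Multiplied by 2^k this bound is submultiplicative, and
      1/(1 - u) is controlled as soon as the bound of u is at most 1/2
      (sub_bound_geom). This gives the convergence of the geometric series in
      each variable, uniformly enough to be integrated against T
      (transform_expansion), and a first order Taylor formula for the transform
      with quadratic remainder (transform_taylor).
    - A power series that converges unconditionally to 0 on a polydisc has zero
      coefficients (null_on_zero): averages over the multiplication of a
      variable by roots of unity whose order is a power of 2 extract the terms
      whose exponents are congruent to given ones modulo 2^n.

    The formula that relates the two transforms holds under the sign T, and the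
    nonzero scalar comes out of T even where no smooth extension is at hand
    (evZ). *)

Local Notation normc := ComplexField.Normc.normc.

(** * Modulus and real and imaginary parts *)

Section ComplexModulus.
Context {R : realType}.
Implicit Types z w : R[i].

Lemma normcE0 z : `|z| = (normc z)%:C.
Proof. by rewrite normc_def; case: z. Qed.

Lemma normc_ge0 z : 0 <= normc z.
Proof. by case: z => a b; exact: sqrtr_ge0. Qed.

Lemma normcM z w : normc (z * w) = normc z * normc w.
Proof. exact: ComplexField.Normc.normcM. Qed.

Lemma le_normcD z w : normc (z + w) <= normc z + normc w.
Proof. by rewrite -lecR rmorphD /= -!normcE0 ler_normD. Qed.

Lemma normcN z : normc (- z) = normc z.
Proof. by apply: complexI; rewrite -!normcE0 normrN. Qed.

Lemma normcB z w : normc (z - w) = normc (w - z).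
Proof. by rewrite -normcN opprB. Qed.

Lemma normcR (a : R) : normc a%:C = `|a|.
Proof. by rewrite /= expr0n addr0 sqrtr_sqr. Qed.

Lemma normc0 : normc (0 : R[i]) = 0.
Proof. by rewrite (normcR 0) normr0. Qed.

Lemma normc1 : normc (1 : R[i]) = 1.
Proof. by rewrite (normcR 1) normr1. Qed.

Lemma normcX z n : normc (z ^+ n) = normc z ^+ n.
Proof. by elim: n => [|n IH]; rewrite ?expr0 ?normc1// !exprS normcM IH. Qed.

Lemma normc_eq0 z : (normc z == 0) = (z == 0).
Proof. by rewrite -[RHS]normr_eq0 normcE0 -(inj_eq (@complexI R)). Qed.

Lemma normc_le0 z : normc z <= 0 -> z = 0.
Proof.
move=> h; apply/eqP; rewrite -normc_eq0.
by apply/eqP/le_anti; rewrite h normc_ge0.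
Qed.

Lemma normc_Re z : `|complex.Re z| <= normc z.
Proof. by rewrite -lecR -normcE0 normc_ge_Re. Qed.

Lemma normc_Im z : `|complex.Im z| <= normc z.
Proof.
rewrite -normrN -ReiNIm (le_trans (normc_Re _))// normcM.
by rewrite /= expr0n expr1n add0r sqrtr1 mulr1.
Qed.

Lemma normc_ReIm z : normc z <= `|complex.Re z| + `|complex.Im z|.
Proof.
rewrite {1}[z]complexE (le_trans (le_normcD _ _))// normcM !normcR.
by rewrite /= expr0n expr1n add0r sqrtr1 mul1r.
Qed.

Lemma ReB z w : complex.Re (z - w) = complex.Re z - complex.Re w.
Proof. by case: z w => [? ?] [? ?]. Qed.
Lemma ImB z w : complex.Im (z - w) = complex.Im z - complex.Im w.
Proof. by case: z w => [? ?] [? ?]. Qed.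
Lemma ReCM (a : R) z : complex.Re (a%:C * z) = a * complex.Re z.
Proof. by case: z => b c /=; rewrite mul0r subr0. Qed.
Lemma ImCM (a : R) z : complex.Im (a%:C * z) = a * complex.Im z.
Proof. by case: z => b c /=; rewrite mul0r addr0. Qed.

(** Convergence in R[i] tested with real radii: an element e > 0 of R[i] is real. *)
Lemma cvg_normcP (T : Type) (F : set_system T) (FF : Filter F) (f : T -> R[i]) l :
  (f @ F --> l) <-> (forall e : R, 0 < e -> \forall t \near F, normc (l - f t) < e).
Proof.
split=> [/cvgrPdist_lt h e e0|h].
  by have := h e%:C; rewrite ltcR => /(_ e0); apply: filterS => t; rewrite normcE0 ltcR.
apply/cvgrPdist_lt => e; rewrite ltcE /= => /andP[/eqP e_im e_re].
rewrite (_ : e = (complex.Re e)%:C); last by case: e e_im e_re => a b /= ->.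
by apply: filterS (h _ e_re) => t; rewrite normcE0 ltcR.
Qed.

Lemma cvg_normc_leP (T : Type) (F : set_system T) (FF : Filter F) (f : T -> R[i]) l :
  (f @ F --> l) <-> (forall e : R, 0 < e -> \forall t \near F, normc (l - f t) <= e).
Proof.
rewrite cvg_normcP; split=> h e e0; first by apply: filterS (h e e0) => t /ltW.
have e20 : 0 < e / 2 by rewrite divr_gt0.
by apply: filterS (h _ e20) => t /le_lt_trans; apply; lra.
Qed.

Lemma cvg_ReIm (T : Type) (F : set_system T) (FF : Filter F) (f : T -> R[i]) l :
  (f @ F --> l) <-> (complex.Re (f t) @[t --> F] --> complex.Re l) /\
                    (complex.Im (f t) @[t --> F] --> complex.Im l).
Proof.
rewrite cvg_normcP; split=> [h|[/cvgrPdist_lt h1 /cvgrPdist_lt h2] e e0].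
  split; apply/cvgrPdist_lt => e e0; apply: filterS (h e e0) => t.
    by apply: le_lt_trans; rewrite -ReB normc_Re.
  by apply: le_lt_trans; rewrite -ImB normc_Im.
have e20 : 0 < e / 2 by rewrite divr_gt0.
apply: filterS2 (h1 _ e20) (h2 _ e20) => t a b.
rewrite (le_lt_trans (normc_ReIm _))// ReB ImB [e]splitr.
by rewrite ltrD.
Qed.

End ComplexModulus.

(** * Partial derivatives *)

Section PartialDerivatives.
Context {R : realType} {d : nat}.
Local Notation C := R[i].
Local Notation V := 'rV[R]_d.
Local Notation e_ j := (delta_mx 0 j : V).
Implicit Types (f g : V -> C) (x : V) (j : 'I_d) (U : set V).

(** Difference quotient along the axis j; partial derivatives are handled as limits of this
    complex quotient rather than through their real and imaginary parts. *)
Definition dquo j f x (t : R) : C := (t^-1)%:C * (f (x + t *: e_ j) - f x).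

Definition is_pd j f x (l : C) : Prop := dquo j f x @ 0^' --> l.

Lemma is_pdP j f x l : is_pd j f x l <-> pderivable j f x /\ pderiv j f x = l.
Proof.
have ReE : (fun h : R => h^-1 *: (((fun y => complex.Re (f y)) \o shift x)
    (h *: e_ j) - complex.Re (f x))) = (fun t => complex.Re (dquo j f x t)).
  by apply/funext => t; rewrite /dquo ReCM ReB /= [_ *: _ + x]addrC.
have ImE : (fun h : R => h^-1 *: (((fun y => complex.Im (f y)) \o shift x)
    (h *: e_ j) - complex.Im (f x))) = (fun t => complex.Im (dquo j f x t)).
  by apply/funext => t; rewrite /dquo ImCM ImB /= [_ *: _ + x]addrC.
rewrite /is_pd cvg_ReIm /pderivable /pderiv /derivable /derive ReE ImE.
split=> [[h1 h2]|[[h1 h2] <-] //].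
split; first by split; [apply/cvg_ex; eexists; exact: h1|apply/cvg_ex; eexists; exact: h2].
by case: l h1 h2 => a b /= h1 h2; rewrite (cvg_lim _ h1)// (cvg_lim _ h2).
Qed.

Lemma pd_pderiv j f x : pderivable j f x -> is_pd j f x (pderiv j f x).
Proof. by move=> h; apply/is_pdP. Qed.

Lemma is_pdE j f x l : is_pd j f x l -> pderiv j f x = l.
Proof. by case/is_pdP. Qed.

Lemma is_pdW j f x l : is_pd j f x l -> pderivable j f x.
Proof. by case/is_pdP. Qed.

Lemma regular_pd f x j : regular f x -> is_pd j f x (pderiv j f x).
Proof. by case=> _ /(_ j)/pd_pderiv. Qed.

Lemma cvg_shift_axis x j : x + t *: e_ j @[t --> (0 : R)^'] --> x.
Proof.
rewrite -[X in _ --> X]addr0; apply: cvgD; first exact: cvg_cst.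
rewrite -[X in _ --> X](scale0r (e_ j)).
apply: cvgZr_tmp.
by apply: cvg_within_filter; exact: cvg_id.
Qed.

Lemma continuous_axis f x j : {for x, continuous f} ->
  f (x + t *: e_ j) @[t --> (0 : R)^'] --> f x.
Proof. by move=> cf; exact: (cvg_comp _ _ (@cvg_shift_axis x j) cf). Qed.

Lemma is_pd_cst j c x : is_pd j (fun=> c) x 0.
Proof.
rewrite /is_pd (_ : dquo _ _ _ = fun=> 0); first exact: cvg_cst.
by apply/funext => t; rewrite /dquo subrr mulr0.
Qed.

Lemma is_pdD j f g x l m : is_pd j f x l -> is_pd j g x m ->
  is_pd j (f + g) x (l + m).
Proof.
move=> h1 h2; rewrite /is_pd (_ : dquo _ _ _ = fun t => dquo j f x t + dquo j g x t).
  by apply: cvgD; [exact: h1|exact: h2].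
by apply/funext => t; rewrite /dquo !fctE opprD addrACA mulrDr.
Qed.

Lemma is_pdM j f g x l m : {for x, continuous g} ->
  is_pd j f x l -> is_pd j g x m ->
  is_pd j (f * g) x (l * g x + f x * m).
Proof.
move=> cg h1 h2; rewrite /is_pd.
rewrite (_ : dquo _ _ _ = (fun t => dquo j f x t * g (x + t *: e_ j) +
   f x * dquo j g x t)).
  apply: cvgD.
    by apply: cvgM; [exact: h1|exact: continuous_axis].
  by apply: cvgM; [exact: cvg_cst|exact: h2].
by apply/funext => t; rewrite /dquo !fctE; ring.
Qed.

Lemma is_pdV j f x l : {for x, continuous f} -> f x != 0 ->
  is_pd j f x l -> is_pd j (fun y => (f y)^-1) x (- l * ((f x)^-1 * (f x)^-1)).
Proof.
move=> cf f0 h; rewrite /is_pd.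
have fne : \forall t \near (0 : R)^', f (x + t *: e_ j) != 0.
  by have /cvgr_neq0 := continuous_axis j cf; apply.
apply: (@cvg_trans _ ((fun t => - dquo j f x t * ((f (x + t *: e_ j))^-1 * (f x)^-1))
   @ 0^')).
  apply: near_eq_cvg; near=> t.
  have ft0 : f (x + t *: e_ j) != 0 by near: t.
  rewrite /dquo; move: (t^-1)%:C => a; field; rewrite ?ft0 ?f0 /=; try done.
apply: cvgM; first by apply: cvgN; exact: h.
apply: cvgM; last exact: cvg_cst.
by apply: cvgV; [exact: f0|exact: continuous_axis].
Unshelve. all: by end_near. Qed.

Lemma near_axis U x j : nbhs x U -> \forall t \near (0 : R)^', U (x + t *: e_ j).
Proof. by move=> Ux; have := @cvg_shift_axis x j; apply. Qed.

Lemma is_pd_ext j f g x l : (\forall y \near x, f y = g y) ->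
  is_pd j f x l -> is_pd j g x l.
Proof.
move=> fg; apply: cvg_trans; apply: near_eq_cvg.
have fgx := nbhs_singleton fg.
apply: filterS (near_axis j fg) => t h.
by rewrite /dquo h fgx.
Qed.

Lemma regular_ext f g x : (\forall y \near x, f y = g y) ->
  regular f x -> regular g x.
Proof.
move=> fg [cf df]; split.
  rewrite /prop_for /continuous_at -(nbhs_singleton fg).
  by apply: cvg_trans; [exact: near_eq_cvg fg|exact: cf].
by move=> j; apply: is_pdW (is_pd_ext fg (pd_pderiv (df j))).
Qed.

End PartialDerivatives.

(** * Smooth functions *)

Section Ck.
Context {R : realType} {d : nat}.
Local Notation C := R[i].
Local Notation V := 'rV[R]_d.
Local Notation e_ j := (delta_mx 0 j : V).
Implicit Types (f g : V -> C) (x : V) (j : 'I_d) (U : set V).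

(** Regularity of all derivatives up to order n, in a form suited to induction on n. *)
Fixpoint Ck n U f {struct n} : Prop :=
  (forall x, U x -> regular f x) /\
  if n is m.+1 then forall j, Ck m U (pderiv j f) else True.

Lemma CkW n U f : Ck n.+1 U f -> Ck n U f.
Proof.
elim: n f => [|n IH] f [h1 h2]; first by split.
by split=> // j; apply: IH.
Qed.

Lemma eq_on_near U f g x : open U -> U x -> (forall y, U y -> f y = g y) ->
  \forall y \near x, f y = g y.
Proof. by move=> oU Ux fg; apply: filterS (open_nbhs_nbhs (conj oU Ux)) => y /fg. Qed.

Lemma pderiv_eq_on U f g j : open U -> (forall y, U y -> f y = g y) ->
  forall x, U x -> pderiv j f x = pderiv j g x.
Proof. by move=> oU fg x Ux; apply: near_pderiv; exact: eq_on_near Ux fg. Qed.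

Lemma pderivs_eq_on U f g s : open U -> (forall y, U y -> f y = g y) ->
  forall x, U x -> pderivs s f x = pderivs s g x.
Proof.
move=> oU fg; elim: s => // j s IH x Ux.
exact: pderiv_eq_on Ux.
Qed.

Lemma Ck_eq_on n U f g : open U -> (forall y, U y -> f y = g y) ->
  Ck n U f -> Ck n U g.
Proof.
move=> oU; elim: n f g => [|n IH] f g fg [h1 h2]; (split=> [x Ux|];
  first by apply: regular_ext (h1 x Ux); exact: eq_on_near Ux fg) => //.
by move=> j; apply: IH (h2 j); exact: pderiv_eq_on.
Qed.

Lemma Ck_cst n U (c : C) : Ck n U (fun=> c).
Proof.
have rc (a : C) x : regular (fun=> a) x.
  by split; [exact: cst_continuous|move=> j; exact: is_pdW (is_pd_cst _ _ _)].
elim: n c => [|n IH] c; (split=> [x _|]; first exact: rc) => // j.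
rewrite (_ : pderiv j _ = fun=> 0); first exact: IH.
by apply/funext => x; exact: is_pdE (is_pd_cst _ _ _).
Qed.

Lemma regularD f g x : regular f x -> regular g x -> regular (f + g) x.
Proof.
move=> rf rg; split; last first.
  by move=> j; exact: is_pdW (is_pdD (regular_pd rf) (regular_pd rg)).
exact: (cvgD rf.1 rg.1).
Qed.

Lemma regularM f g x : regular f x -> regular g x -> regular (f * g) x.
Proof.
move=> rf rg; split; last first.
  move=> j; exact: is_pdW (is_pdM rg.1 (regular_pd rf) (regular_pd rg)).
exact: (cvgM rf.1 rg.1).
Qed.

Lemma regularV f x : f x != 0 -> regular f x -> regular (fun y => (f y)^-1) x.
Proof.
move=> f0 rf; split; last first.
  move=> j; exact: is_pdW (is_pdV rf.1 f0 (regular_pd rf)).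
exact: (cvgV f0 rf.1).
Qed.

Lemma pderivD j f g x : regular f x -> regular g x ->
  pderiv j (f + g) x = pderiv j f x + pderiv j g x.
Proof. by move=> rf rg; exact: is_pdE (is_pdD (regular_pd rf) (regular_pd rg)). Qed.

Lemma pderivM j f g x : regular f x -> regular g x ->
  pderiv j (f * g) x = pderiv j f x * g x + f x * pderiv j g x.
Proof.
by move=> rf rg; exact: is_pdE (is_pdM rg.1 (regular_pd rf) (regular_pd rg)).
Qed.

Lemma CkD n U f g : open U -> Ck n U f -> Ck n U g -> Ck n U (f + g).
Proof.
move=> oU; elim: n f g => [|n IH] f g [f1 f2] [g1 g2]; (split=> [x Ux|];
  first by apply: regularD; auto) => // j.
apply: (Ck_eq_on oU _ (IH _ _ (f2 j) (g2 j))) => x Ux.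
by rewrite pderivD; auto.
Qed.

Lemma CkM n U f g : open U -> Ck n U f -> Ck n U g -> Ck n U (f * g).
Proof.
move=> oU; elim: n f g => [|n IH] f g hf hg.
  by split=> // x Ux; exact: regularM (hf.1 x Ux) (hg.1 x Ux).
split=> [x Ux|j]; first by apply: regularM; [exact: hf.1|exact: hg.1].
apply: (Ck_eq_on oU _ (CkD oU (IH _ _ (hf.2 j) (CkW hg)) (IH _ _ (CkW hf) (hg.2 j)))).
by move=> x Ux; rewrite pderivM; [|exact: hf.1|exact: hg.1].
Qed.

Lemma CkV n U f : open U -> (forall x, U x -> f x != 0) -> Ck n U f ->
  Ck n U (fun x => (f x)^-1).
Proof.
move=> oU f0; elim: n => [|n IH] hf.
  by split=> // x Ux; apply: regularV; [exact: f0|exact: hf.1].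
split=> [x Ux|j]; first by apply: regularV; [exact: f0|exact: hf.1].
have iV := IH (CkW hf).
have h := CkM oU (CkM oU (Ck_cst n U (-1)) (hf.2 j)) (CkM oU iV iV).
apply: (Ck_eq_on oU _ h) => x Ux.
rewrite /= !fctE mulN1r.
exact/esym/(is_pdE (is_pdV (hf.1 x Ux).1 (f0 x Ux) (regular_pd (hf.1 x Ux)))).
Qed.

Lemma pderivs_rcons s j f : pderivs (rcons s j) f = pderivs s (pderiv j f).
Proof. by rewrite /pderivs foldr_rcons. Qed.

Lemma pderivs_cat s1 s2 f : pderivs (s1 ++ s2) f = pderivs s1 (pderivs s2 f).
Proof. by rewrite /pderivs foldr_cat. Qed.

(** All rules of calculus for smooth_on are proved for Ck n, by induction on n, and transferred. *)
Lemma smooth_onP U f : open U -> smooth_on U f <-> forall n, Ck n U f.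
Proof.
move=> oU; split=> [sf n|h s x Ux].
  have reg s x : U x -> regular (pderivs s f) x.
    by move=> Ux; exact: nbhs_singleton (sf s x Ux).
  have [s ->] : exists s, f = pderivs s f by exists [::].
  elim: n s => [|n IH] s; (split=> [x Ux|]; first exact: reg) => // j.
  exact: (IH (j :: s)).
apply: filterS (open_nbhs_nbhs (conj oU Ux)) => y Uy.
have : Ck 0 U (pderivs s f).
  have: Ck (size s) U f by exact: h.
  elim/last_ind: s f {h} => [|s j IH] f //.
  by rewrite size_rcons pderivs_rcons => -[_ /(_ j)]; exact: IH.
by move=> [/(_ y Uy)].
Qed.

Lemma smooth_regular U f x : open U -> smooth_on U f -> U x -> regular f x.
Proof. by move=> oU /(_ [::] x) h Ux; exact: nbhs_singleton (h Ux). Qed.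

Lemma smooth_on_sub U W f : U `<=` W -> smooth_on W f -> smooth_on U f.
Proof. by move=> UW h s x /UW; exact: h. Qed.

Lemma smooth_on_eq U f g : open U -> (forall y, U y -> f y = g y) ->
  smooth_on U f -> smooth_on U g.
Proof.
move=> oU fg /(smooth_onP f oU) h; apply/(smooth_onP g oU) => n.
exact: Ck_eq_on fg (h n).
Qed.

Lemma smooth_onD U f g : open U -> smooth_on U f -> smooth_on U g -> smooth_on U (f + g).
Proof.
move=> oU /(smooth_onP f oU) h1 /(smooth_onP g oU) h2; apply/smooth_onP => // n.
exact: CkD.
Qed.

Lemma smooth_onM U f g : open U -> smooth_on U f -> smooth_on U g -> smooth_on U (f * g).
Proof.
move=> oU /(smooth_onP f oU) h1 /(smooth_onP g oU) h2; apply/smooth_onP => // n.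
exact: CkM.
Qed.

Lemma smooth_onV U f : open U -> (forall x, U x -> f x != 0) -> smooth_on U f ->
  smooth_on U (fun x => (f x)^-1).
Proof.
move=> oU f0 /(smooth_onP f oU) h; apply/(smooth_onP _ oU) => // n.
exact: CkV.
Qed.

Lemma smooth_on_cst U (c : C) : open U -> smooth_on U (fun=> c).
Proof. by move=> oU; apply/(smooth_onP _ oU) => n; exact: Ck_cst. Qed.

Lemma smooth_on_pderiv U f j : smooth_on U f -> smooth_on U (pderiv j f).
Proof. by move=> sf s x Ux; rewrite -pderivs_rcons; exact: sf. Qed.

Lemma smooth_on_pderivs U f s : smooth_on U f -> smooth_on U (pderivs s f).
Proof. by move=> sf s' x Ux; rewrite -pderivs_cat; exact: sf. Qed.

Lemma smooth_on_local U f : (forall x, U x -> exists W g, [/\ nbhs x W,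
   (forall y, W y -> f y = g y) & smooth_on W g]) -> smooth_on U f.
Proof.
move=> h s x /h[W [g [Wx fg sg]]].
have [B [[oB Bx] BW]] : exists B, open_nbhs x B /\ B `<=` W.
  by move: Wx; rewrite nbhsE => -[B]; exists B.
have : smooth_on B f.
  apply: (@smooth_on_eq _ g) => //; first by move=> y /BW /fg.
  exact: smooth_on_sub sg.
by apply.
Qed.

Definition crd j : V -> C := fun x => (x 0 j)%:C.

Lemma continuous_real_complex : continuous (fun t : R => t%:C).
Proof.
move=> t; apply/cvg_normcP => e e0.
apply: filterS ((@cvgrPdist_lt _ _ _ _ _ id t).1 (@cvg_id _ _) _ e0) => u.
by rewrite -rmorphB normcR.
Qed.

Lemma is_pd_coord (u : R -> R) (l : R) i j x :
  (t^-1 * (u (x 0 j + t) - u (x 0 j)) @[t --> 0^'] --> l) ->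
  is_pd i (fun y => (u (y 0 j))%:C) x (if i == j then l%:C else 0).
Proof.
move=> h; rewrite /is_pd.
case: eqVneq => [->|ij].
  rewrite (_ : dquo _ _ _ = (fun t => (t^-1 * (u (x 0 j + t) - u (x 0 j)))%:C)).
    exact: (cvg_comp _ _ h (@continuous_real_complex l)).
  by apply/funext => t; rewrite /dquo !mxE !eqxx mulr1 rmorphM rmorphB.
rewrite (_ : dquo _ _ _ = (fun=> 0)); first exact: cvg_cst.
by apply/funext => t; rewrite /dquo !mxE eqxx eq_sym (negPf ij) mulr0 addr0 subrr mulr0.
Qed.

Lemma is_pd_crd i j x : is_pd i (crd j) x (i == j)%:R.
Proof.
have -> : (i == j)%:R = (if i == j then 1%:C else 0) :> C by case: eqP.
apply: (@is_pd_coord id 1).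
apply: (@cvg_trans _ (cst (1 : R) @ 0^')); last exact: cvg_cst.
apply: near_eq_cvg; near=> t.
rewrite /= addrAC subrr add0r mulVf//.
by near: t; exact: nbhs_dnbhs_neq.
Unshelve. all: by end_near. Qed.

Lemma pderiv_crd i j x : pderiv i (crd j) x = (i == j)%:R.
Proof. apply: is_pdE; exact: is_pd_crd. Qed.

Lemma continuous_crd j : continuous (crd j).
Proof.
move=> x; have h := @coord_continuous R 1 d 0 j x.
exact: (cvg_comp _ _ h (@continuous_real_complex (x 0 j))).
Qed.

Lemma regular_crd j x : regular (crd j) x.
Proof. by split=> [|i]; [exact: continuous_crd|apply: is_pdW; exact: is_pd_crd]. Qed.

Lemma Ck_crd n U j : Ck n U (crd j).
Proof.
case: n => [|n]; (split=> [x _|]; first exact: regular_crd) => // i.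
rewrite (_ : pderiv i _ = fun=> (i == j)%:R); first exact: Ck_cst.
by apply/funext => x; rewrite pderiv_crd.
Qed.

Lemma smooth_on_crd U j : open U -> smooth_on U (crd j).
Proof. by move=> oU; apply/(smooth_onP _ oU) => n; exact: Ck_crd. Qed.

Lemma smooth_on_sum U (I : Type) (r : seq I) (P : pred I) (F : I -> V -> C) : open U ->
  (forall i, P i -> smooth_on U (F i)) ->
  smooth_on U (fun x => \sum_(i <- r | P i) F i x).
Proof.
move=> oU h; elim: r => [|i r IH].
  rewrite (_ : (fun _ => _) = fun=> 0); first exact: smooth_on_cst.
  by apply/funext => x; rewrite big_nil.
have [Pi|nPi] := boolP (P i).
  rewrite (_ : (fun _ => _) = F i + fun x => \sum_(i <- r | P i) F i x).
    exact: smooth_onD oU (h i Pi) IH.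
  by apply/funext => x; rewrite big_cons Pi.
rewrite (_ : (fun _ => _) = fun x => \sum_(i <- r | P i) F i x) //.
by apply/funext => x; rewrite big_cons (negPf nPi).
Qed.

Lemma smooth_on_prod U (I : Type) (r : seq I) (P : pred I) (F : I -> V -> C) : open U ->
  (forall i, P i -> smooth_on U (F i)) ->
  smooth_on U (fun x => \prod_(i <- r | P i) F i x).
Proof.
move=> oU h; elim: r => [|i r IH].
  rewrite (_ : (fun _ => _) = fun=> 1); first exact: smooth_on_cst.
  by apply/funext => x; rewrite big_nil.
have [Pi|nPi] := boolP (P i).
  rewrite (_ : (fun _ => _) = F i * fun x => \prod_(i <- r | P i) F i x).
    exact: smooth_onM oU (h i Pi) IH.
  by apply/funext => x; rewrite big_cons Pi.
rewrite (_ : (fun _ => _) = fun x => \prod_(i <- r | P i) F i x) //.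
by apply/funext => x; rewrite big_cons (negPf nPi).
Qed.

Lemma smooth_onX U f n : open U -> smooth_on U f -> smooth_on U (fun x => f x ^+ n).
Proof.
move=> oU h; elim: n => [|n IH].
  rewrite (_ : (fun _ => _) = fun=> 1); first exact: smooth_on_cst.
  by apply/funext => x; rewrite expr0.
rewrite (_ : (fun _ => _) = f * fun x => f x ^+ n); first exact: smooth_onM.
by apply/funext => x; rewrite exprS.
Qed.

Lemma smooth_rmono U al : open U -> smooth_on U (rmono al).
Proof.
move=> oU; rewrite (_ : rmono al = fun x => \prod_j crd j x ^+ al j).
  by apply: smooth_on_prod => // j _; apply: smooth_onX => //; exact: smooth_on_crd.
by apply/funext => x; rewrite /rmono /mono; apply: eq_bigr => j _; rewrite mxE.
Qed.

End Ck.

(** * Composition with maps that preserve coordinate directions *)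

Section AxisMaps.
Context {R : realType} {m d : nat}.
Local Notation C := R[i].

(** A map that moves along one coordinate axis of its target when its argument moves along a
    coordinate axis, with speed c. All substitutions needed here are of this kind, and the chain
    rule for them involves a single partial derivative. *)
Record axis_map (Phi : 'rV[R]_m -> 'rV[R]_d) (si : 'I_m -> 'I_d)
    (c : 'I_m -> 'rV[R]_m -> R) : Prop := AxisMap {
  axis_cont : continuous Phi;
  axis_smooth : forall j, smooth_on setT (fun x => (c j x)%:C);
  axis_move : forall x j (t : R), Phi (x + t *: delta_mx 0 j) =
     Phi x + (t * c j x) *: delta_mx 0 (si j) }.

Variables (Phi : 'rV[R]_m -> 'rV[R]_d) (si : 'I_m -> 'I_d) (c : 'I_m -> 'rV[R]_m -> R).
Hypothesis axP : axis_map Phi si c.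

Lemma is_pd_comp f x j l : is_pd (si j) f (Phi x) l ->
  is_pd j (f \o Phi) x ((c j x)%:C * l).
Proof.
move=> h; rewrite /is_pd.
have [c0|c0] := eqVneq (c j x) 0.
  rewrite (_ : dquo _ _ _ = fun=> 0); first by rewrite c0 mul0r; exact: cvg_cst.
  apply/funext => t.
  by rewrite /dquo /= (axis_move axP) c0 mulr0 scale0r addr0 subrr mulr0.
rewrite (_ : dquo _ _ _ = fun t => (c j x)%:C * dquo (si j) f (Phi x) (t * c j x)).
  apply: cvgM; first exact: cvg_cst.
  apply: (cvg_comp (fun t => t * c j x) _ _ h).
  have := @continuous_injective_withinNx _ _ (fun t : R => t * c j x) 0.
  rewrite mul0r; apply.
    by rewrite /prop_for /continuous_at; apply: cvgM; [exact: cvg_id|exact: cvg_cst].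
  by move=> t /eqP; rewrite mulf_eq0 (negPf c0) orbF => /eqP.
apply/funext => t; rewrite /dquo /= (axis_move axP) invfM rmorphM mulrA.
by congr (_ * _); rewrite mulrCA -rmorphM divff// mulr1.
Qed.

Lemma regular_comp f x : regular f (Phi x) -> regular (f \o Phi) x.
Proof.
move=> rf; split=> [|j]; first exact: (cvg_comp _ _ (@axis_cont _ _ _ axP x) rf.1).
exact: is_pdW (is_pd_comp (regular_pd rf)).
Qed.

Lemma pderiv_comp f x j : regular f (Phi x) ->
  pderiv j (f \o Phi) x = (c j x)%:C * pderiv (si j) f (Phi x).
Proof. by move=> rf; exact: is_pdE (is_pd_comp (regular_pd rf)). Qed.

Lemma open_axis_preimage U : open U -> open (Phi @^-1` U).
Proof. by move=> oU; apply: open_comp => // x _; exact: (@axis_cont _ _ _ axP x). Qed.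

Lemma smooth_on_comp U f : open U -> smooth_on U f -> smooth_on (Phi @^-1` U) (f \o Phi).
Proof.
move=> oU /(smooth_onP _ oU) sf; apply/(smooth_onP _ (open_axis_preimage oU)) => n.
move: {sf}f (sf n) => f.
elim: n f => [|n IH] f sf; (split=> [x Ux|]; first exact/regular_comp/sf.1) => // j.
have cs := (smooth_onP _ (open_axis_preimage oU)).1
  (smooth_on_sub (@subsetT _ _) (@axis_smooth _ _ _ axP j)) n.
apply: (Ck_eq_on (open_axis_preimage oU) _ (CkM (open_axis_preimage oU) cs (IH _ (sf.2 (si j))))).
by move=> x Ux; rewrite pderiv_comp//; exact: sf.1.
Qed.

End AxisMaps.

(** * Smooth functions flat at 0 *)

Section Theta.
Context {R : realType}.
Implicit Types (p : {poly R}) (t s : R).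

(** p(1/t) exp(-1/t) for t > 0 and 0 otherwise: the derivative of such a function is again of
    this form, with another polynomial p. *)
Definition theta p t : R := if 0 < t then p.[t^-1] * expR (- t^-1) else 0.

Lemma poly_le_pow p : exists B n, 0 <= B /\ forall s, 1 <= s -> `|p.[s]| <= B * s ^+ n.
Proof.
elim/poly_ind: p => [|p c [B [n [B0 h]]]].
  by exists 0, 0%N; split=> // s _; rewrite horner0 normr0 mul0r.
exists (B + `|c|), n.+1; split; first by rewrite addr_ge0.
move=> s s1; rewrite hornerMXaddC (le_trans (ler_normD _ _))// mulrDl lerD//.
  have s0 : 0 <= s by rewrite (le_trans _ s1).
  by rewrite normrM (ger0_norm s0) exprSr mulrA ler_wpM2r// h.
by rewrite ler_peMr// exprn_ege1.
Qed.

(** The exponential dominates every power of 1/t, which gives the derivative 0 at t = 0. *)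
Lemma theta_le p : exists2 B, 0 <= B & forall t, `|t| <= 1 -> `|theta p t| <= B * t ^+ 2.
Proof.
have [B [n [B0 h]]] := poly_le_pow p.
exists (B * (n.+2)`!%:R); first by rewrite mulr_ge0.
move=> t t1; rewrite /theta; case: ifPn => t0; last first.
  by rewrite normr0 mulr_ge0 ?sqr_ge0// mulr_ge0.
have s1 : 1 <= t^-1 by rewrite invf_ge1// (le_trans (ler_norm _)).
have s0 : 0 < t^-1 by rewrite invr_gt0.
(* one term of the exponential series; the two extra powers of 1/t leave the factor t^2 *)
have e1 : (t^-1) ^+ n.+2 / (n.+2)`!%:R <= expR t^-1.
  by apply: le_trans (expR_ge1Dxn n.+1 (ltW s0)); rewrite lerDr.
rewrite normrM expRN normfV (ger0_norm (expR_ge0 _)).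
rewrite ler_pdivrMr ?expR_gt0// (le_trans (h _ s1))//.
rewrite -!mulrA ler_wpM2l//.
have -> : t^-1 ^+ n = t ^+ 2 * t^-1 ^+ n.+2.
  by rewrite !exprS; field; rewrite gt_eqF.
rewrite (_ : _ * (t * _) = t ^+ 2 * (expR t^-1 * (n.+2)`!%:R)); last by ring.
by rewrite ler_wpM2l ?sqr_ge0// -ler_pdivrMr// ltr0n fact_gt0.
Qed.

Lemma theta_derive p t :
  (h^-1 * (theta p (t + h) - theta p t) @[h --> 0^'] -->
     theta ('X^2 * (p - p^`())) t).
Proof.
have [t0|t0|t0] := ltgtP t 0.
- rewrite [theta (_ * _) t]/theta ltNge (ltW t0) /=.
  apply: (@cvg_trans _ (cst (0 : R) @ 0^')); last exact: cvg_cst.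
  apply: near_eq_cvg; near=> h.
  have th0 : t + h < 0.
    rewrite -ltrBrDl sub0r (le_lt_trans (ler_norm _))//.
    by near: h; apply: dnbhs0_lt; rewrite oppr_gt0.
  by rewrite /cst /theta !ltNge (ltW t0) (ltW th0) /= subrr mulr0.
- have id1 : is_derive t 1 (fun u : R => u^-1) (- t ^- 2).
    have h : is_derive t 1 (@id R) 1 by exact: is_derive_id.
    split; first exact: (@derivableV _ _ id t 1 (lt0r_neq0 t0) (@ex_derive _ _ _ _ _ _ _ h)).
    have := @deriveV _ _ id t 1 (lt0r_neq0 t0) (@ex_derive _ _ _ _ _ _ _ h).
    by rewrite (@derive_val _ _ _ _ _ _ _ h) => ->; rewrite /GRing.scale /= mulr1.
  have D : is_derive t 1 (fun u => p.[u^-1] * expR (- u^-1))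
     (theta ('X^2 * (p - p^`())) t).
    have D1 : is_derive t 1 (horner p \o (fun u : R => u^-1)) (p^`().[t^-1] * - t ^- 2).
      by apply: is_derive1_comp; exact: is_derive_poly.
    have D2 : is_derive t 1 (expR \o (fun u : R => - u^-1)) (expR (- t^-1) * - - t ^- 2).
      exact: (is_derive1_comp (is_derive_expR _) (is_deriveN id1)).
    have := is_deriveM D1 D2.
    move=> D; apply: (is_derive_eq D).
    rewrite /theta t0 hornerM hornerXn hornerD hornerN /= exprVn.
    rewrite !/(_ *: _) /=; ring.
  have := @ex_derive _ _ _ _ _ _ _ D; rewrite /derivable => cD.
  have dv := @derive_val _ _ _ _ _ _ _ D.
  rewrite -dv.
  apply: cvg_trans; last exact: cD.
  apply: near_eq_cvg; near=> h.
  have th0 : 0 < t + h.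
    rewrite -ltrBlDr sub0r (le_lt_trans _ (_ : `|h| < t))//.
      by rewrite -normrN ler_norm.
    by near: h; exact: dnbhs0_lt.
  by rewrite /theta t0 th0 /= [h *: _]mulr1 [h + t]addrC.
- rewrite t0 [theta (_ * _) 0]/theta ltxx /=.
  have [B B0 hB] := theta_le p.
  apply/cvgrPdist_le => e e0; near=> h.
  rewrite sub0r add0r [theta p 0]/theta ltxx subr0 normrN normrM normfV.
  have hn0 : h != 0 by near: h; exact: nbhs_dnbhs_neq.
  have h1 : `|h| <= 1 by apply/ltW; near: h; exact: dnbhs0_lt.
  rewrite ler_pdivrMl ?normr_gt0// (le_trans (hB _ h1))//.
  rewrite -real_normK ?num_real// expr2 mulrA mulrC ler_wpM2l//.
  have : `|h| < e / (B + 1) by near: h; apply: dnbhs0_lt; rewrite divr_gt0// ltr_pwDr.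
  rewrite ltr_pdivlMr ?ltr_pwDr// => /ltW; apply: le_trans.
  by rewrite mulrC ler_wpM2l// lerDl.
Unshelve. all: by end_near. Qed.

End Theta.

(** * Cubes and compact sets *)

Section Boxes.
Context {R : realType} {d : nat}.
Local Notation V := 'rV[R]_d.
Implicit Types (x y a : V) (r : R) (W K : set V).

Definition cube a r : set V := [set y | forall j, `|y 0 j - a 0 j| <= r].

Lemma nbhs_boxP x W : nbhs x W <->
  exists2 r, 0 < r & forall y, (forall j, `|y 0 j - x 0 j| < r) -> W y.
Proof.
split=> [/nbhs_ballP[r /= r0 h]|[r r0 h]].
  exists r => // y xy; apply: h; split=> // i j.
  by rewrite (ord1 i) -ball_normE /= distrC.
apply/nbhs_ballP; exists r => //= y [_ xy]; apply: h => j.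
by have := xy 0 j; rewrite -ball_normE /= distrC.
Qed.

Lemma cube_nbhs a r : 0 < r -> nbhs a (cube a r).
Proof. by move=> r0; apply/nbhs_boxP; exists r => // y h j; exact: ltW. Qed.

Lemma compact_cube a r : compact (cube a r).
Proof.
have -> : cube a r = [set v : V | forall j, `[a 0 j - r, a 0 j + r]%classic (v ord0 j)].
  apply/seteqP; split=> y h j; have := h j; rewrite /= in_itv /= ler_distl//.
apply: (@rV_compact _ _ (fun j => `[a 0 j - r, a 0 j + r]%classic)) => j.
exact: segment_compact.
Qed.

Lemma hausdorffV : hausdorff_space V.
Proof. exact: norm_hausdorff. Qed.

Lemma closed_cube a r : closed (cube a r).
Proof. by apply: compact_closed; [exact: hausdorffV|exact: compact_cube]. Qed.

Lemma coord_le_norm x j : `|x 0 j| <= `|x|.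
Proof.
by rewrite [leRHS]/Num.Def.normr /= mx_normrE; apply/bigmax_geP; right => /=; exists (0, j).
Qed.

Lemma compact_in_cube K : compact K -> exists2 r, 0 < r & K `<=` cube 0 r.
Proof.
move=> /compact_bounded[M [Mr h]].
exists (`|M| + 1); first by rewrite ltr_pwDr.
move=> x Kx j; rewrite mxE subr0.
apply: le_trans (coord_le_norm x j) _.
apply: h => //.
by rewrite ltr_pwDr// ler_norm.
Qed.

Lemma compact_finite_cover K (N : V -> set V) : compact K ->
  (forall x, K x -> nbhs x (N x)) ->
  exists s : seq V, (forall x, x \in s -> K x) /\
    forall y, K y -> exists2 x, x \in s & (N x)^° y.
Proof.
rewrite compact_cover => cK hN.
have [|x Kx|D DK cov] := cK V K (fun x => (N x)^°).
- by move=> x _; exact: open_interior.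
- by exists x => //; exact: hN.
- exists (finmap.enum_fset D); split=> [x xD|y /cov[x xD yx]]; last by exists x.
  by have := DK x xD; rewrite inE.
Qed.

End Boxes.

(** * Coordinatewise multiplication *)

Section RowContinuity.
Context {R : realType}.

Lemma continuous_row (T : topologicalType) m (Phi : T -> 'rV[R]_m) :
  (forall j, continuous (fun x => Phi x 0 j)) -> continuous Phi.
Proof.
move=> h x W /nbhs_boxP[r r0 rW].
have H : \forall y \near x, forall j, `|Phi y 0 j - Phi x 0 j| < r.
  apply: filter_forall => j.
  have /cvgrPdist_lt/(_ r r0) := h j x.
  by apply: filterS => y; rewrite distrC.
by apply: filterS H => y; exact: rW.
Qed.

Context {d : nat}.
Local Notation V := 'rV[R]_d.

Lemma hmulC (x y : V) : hmul x y = hmul y x.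
Proof. by apply/rowP => j; rewrite !mxE mulrC. Qed.

Lemma continuous_coord (j : 'I_d) : continuous (fun x : V => x 0 j).
Proof. by move=> x; exact: coord_continuous. Qed.

Lemma continuous_hmul : continuous (fun p : V * V => hmul p.1 p.2).
Proof.
apply: continuous_row => j.
rewrite (_ : (fun _ => _) = fun p : V * V => p.1 0 j * p.2 0 j); last first.
  by apply/funext => p; rewrite mxE.
move=> p.
have h1 : (fun q : V * V => q.1) @ p --> p.1 by exact: cvg_fst.
have h2 : (fun q : V * V => q.2) @ p --> p.2 by exact: cvg_snd.
exact: (cvgM (cvg_comp _ _ h1 (@continuous_coord j p.1))
             (cvg_comp _ _ h2 (@continuous_coord j p.2))).
Qed.

Lemma continuous_hmulr (x : V) : continuous (hmul x).
Proof.
apply: continuous_row => j; rewrite (_ : (fun _ => _) = fun y : V => x 0 j * y 0 j).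
  move=> y; exact: (cvgM (cvg_cst _) (@continuous_coord j y)).
by apply/funext => y; rewrite mxE.
Qed.

Lemma axis_hmul (a : V) : axis_map (hmul a) id (fun j _ => a 0 j).
Proof.
split; first exact: continuous_hmulr.
  by move=> j; exact: smooth_on_cst openT.
move=> x j t; apply/rowP => i; rewrite !mxE.
rewrite eqxx /=; case: (eqVneq i j) => [->|_] /=; ring.
Qed.

Definition affine (a : V) (b : R) (x : V) : V := a + b *: x.

Lemma axis_affine (a : V) (b : R) : axis_map (affine a b) id (fun _ _ => b).
Proof.
split.
- apply: continuous_row => j; rewrite (_ : (fun _ => _) = fun y : V => a 0 j + b * y 0 j).
    move=> x; exact: (cvgD (cvg_cst _) (cvgM (cvg_cst _) (@continuous_coord j x))).
  by apply/funext => y; rewrite !mxE.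
- by move=> j; exact: smooth_on_cst openT.
- move=> x j t; rewrite /affine scalerDr addrA scalerA [b * t]mulrC//.
Qed.

Lemma open_hmul_compact (K W : set V) : compact K -> open W ->
  open [set y | forall x, K x -> W (hmul x y)].
Proof.
move=> /compact_near_coveringP cK oW; rewrite openE => y Hy.
apply: (cK V (nbhs y) (fun y x => W (hmul x y))) => x Kx.
have : nbhs (hmul x y) W by apply: open_nbhs_nbhs; split=> //; exact: Hy.
by move=> /(@continuous_hmul (x, y)).
Qed.

Lemma compact_hmul (K L : set V) : compact K -> compact L ->
  compact [set z | exists x y, [/\ K x, L y & z = hmul x y]].
Proof.
move=> cK cL.
rewrite (_ : [set _ | _] = (fun p : V * V => hmul p.1 p.2) @` (K `*` L)).
  apply: continuous_compact; last exact: compact_setX.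
  exact/continuous_subspaceT/continuous_hmul.
apply/seteqP; split=> [z [x [y [Kx Ly ->]]]|z [[x y] [/= Kx Ly] <-]].
  by exists (x, y).
by exists x, y.
Qed.

End RowContinuity.

(** * Cutoff functions *)

Section Cutoff.
Context {R : realType} {d : nat}.
Local Notation C := R[i].
Local Notation V := 'rV[R]_d.
Implicit Types (x y a : V) (r : R) (W K : set V) (f g chi : V -> C).

Lemma smooth_theta (j : 'I_d) (p : {poly R}) :
  smooth_on setT (fun x => (theta p (x 0 j))%:C).
Proof.
have pd q i x := @is_pd_coord _ _ _ _ i j x (@theta_derive _ q (x 0 j)).
have reg q x : regular (fun x : V => (theta q (x 0 j))%:C) x.
  split; last by move=> i; apply: is_pdW; exact: pd.
  have ct : {for x 0 j, continuous (theta q)}.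
    apply: differentiable_continuous; apply/derivable1_diffP/cvg_ex.
    exists (theta ('X^2 * (q - q^`())) (x 0 j)).
    rewrite (_ : (fun h => _) = (fun h => h^-1 * (theta q (x 0 j + h) - theta q (x 0 j)))).
      exact: theta_derive.
    by apply/funext => h; rewrite /= /GRing.scale /= mulr1 [h + _]addrC.
  exact: (cvg_comp _ _ (@continuous_coord _ _ j x)
    (cvg_comp _ _ ct (@continuous_real_complex _ (theta q (x 0 j))))).
apply/(smooth_onP _ openT) => n; elim: n p => [|n IH] p; (split; first by move=> x _; exact: reg) => // i.
have [ij|ij] := eqVneq i j.
  rewrite (_ : pderiv i _ = (fun x => (theta ('X^2 * (p - p^`())) (x 0 j))%:C)); first exact: IH.
  by apply/funext => x; apply: is_pdE; have := pd p i x; rewrite ij eqxx.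
rewrite (_ : pderiv i _ = (fun x => 0)); first exact: Ck_cst.
by apply/funext => x; apply: is_pdE; have := pd p i x; rewrite (negPf ij).
Qed.

Let th (t : R) := theta 1 t.

Lemma th_gt0 t : 0 < t -> 0 < th t.
Proof. by move=> t0; rewrite /th /theta t0 hornerC mul1r expR_gt0. Qed.
Lemma th_le0 t : t <= 0 -> th t = 0.
Proof. by move=> t0; rewrite /th /theta ltNge t0. Qed.
Lemma th_ge0 t : 0 <= th t.
Proof. by have [/th_gt0/ltW|/th_le0->] := ltP 0 t. Qed.

Definition step (t : R) : R := th t / (th t + th (1 - t)).

Lemma th_sum_gt0 t : 0 < th t + th (1 - t).
Proof.
have [t0|t0] := ltP 0 t; first by rewrite ltr_pwDl ?th_gt0 ?th_ge0.
by rewrite ltr_wpDl ?th_ge0// th_gt0//; lra.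
Qed.

Lemma step_ge1 t : 1 <= t -> step t = 1.
Proof.
move=> t1; have := th_sum_gt0 t; rewrite /step [th (1 - t)]th_le0 ?addr0; last by lra.
by move=> ?; rewrite divff// gt_eqF.
Qed.

Lemma step_le0 t : t <= 0 -> step t = 0.
Proof. by move=> t0; rewrite /step th_le0// mul0r. Qed.

Lemma smooth_step (j : 'I_d) : smooth_on setT (fun x => (step (x 0 j))%:C).
Proof.
have s1 := smooth_theta j 1.
have s2 := smooth_on_comp (axis_affine (const_mx 1) (-1)) openT s1.
rewrite preimage_setT in s2.
have s3 := smooth_onD openT s1 s2.
set F := (X in smooth_on _ X) in s3.
have FE x : F x = (th (x 0 j) + th (1 - x 0 j))%:C.
  by rewrite /F fctE /= /affine !mxE mulN1r rmorphD.
have F0 x : setT x -> F x != 0.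
  by move=> _; rewrite FE (inj_eq (@complexI R) _ 0) gt_eqF// th_sum_gt0.
have := smooth_onM openT s1 (smooth_onV openT F0 s3).
congr (smooth_on _ _); apply/funext => x.
by rewrite !fctE FE /step rmorphM fmorphV.
Qed.

(** For each coordinate a product of two steps, with arguments 2 + s and 2 - s for
    s = (x_j - a_j)/r: both are at least 1 if |s| <= 1, and one is at most 0 if |s| >= 2. *)
Lemma smooth_bump a r : 0 < r -> exists chi, [/\ smooth_on setT chi,
  (forall x, cube a r x -> chi x = 1) &
  (forall x, chi x != 0 -> cube a (2 * r) x)].
Proof.
move=> r0.
pose up := affine (const_mx 2 - r^-1 *: a) (r^-1).
pose dn := affine (const_mx 2 + r^-1 *: a) (- r^-1).
pose chi x := \prod_j ((step (up x 0 j))%:C * (step (dn x 0 j))%:C).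
have upE x j : up x 0 j = 2 + (x 0 j - a 0 j) / r by rewrite !mxE; ring.
have dnE x j : dn x 0 j = 2 - (x 0 j - a 0 j) / r by rewrite !mxE; ring.
exists chi; split.
- rewrite /chi.
  apply: (@smooth_on_prod _ _ setT _ _ _ (fun j (x : V) => (step (up x 0 j))%:C * (step (dn x 0 j))%:C) openT) => j _.
  have := smooth_onM openT
    (smooth_on_comp (axis_affine (const_mx 2 - r^-1 *: a) (r^-1)) openT (smooth_step j))
    (smooth_on_comp (axis_affine (const_mx 2 + r^-1 *: a) (- r^-1)) openT (smooth_step j)).
  by apply.
- move=> x xr; rewrite /chi big1// => j _.
  have /andP[h1 h2] : -1 <= (x 0 j - a 0 j) / r <= 1.
    by rewrite -ler_norml normrM normfV (gtr0_norm r0) ler_pdivrMr// mul1r.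
  by rewrite upE dnE !step_ge1 ?mulr1//; lra.
- move=> x /prodf_neq0 h j.
  have := h j isT; rewrite mulf_eq0 negb_or upE dnE => /andP[h1 h2].
  rewrite -ler_pdivrMr// -[X in X <= _](_ : `|(x 0 j - a 0 j) / r| = _); last first.
    by rewrite normrM normfV (gtr0_norm r0).
  rewrite ler_norml; apply/andP; split; rewrite leNgt; apply/negP => h3.
    by move: h1; rewrite step_le0 ?eqxx//; lra.
  by move: h2; rewrite step_le0 ?eqxx//; lra.
Qed.

Lemma fsupp_closed f : closed (fsupp f).
Proof. exact: closed_closure. Qed.

Lemma fsupp_out f x : ~ fsupp f x -> f x = 0.
Proof. by move=> h; apply/eqP/negPn/negP => fx; apply: h; exact: subset_closure. Qed.

Lemma fsupp_sub f K : closed K -> (forall x, f x != 0 -> K x) -> fsupp f `<=` K.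
Proof. by move=> cK fK; rewrite /fsupp closureE => x; apply; split. Qed.

Lemma cutoff_point x W : nbhs x W -> exists chi, [/\ smooth_on setT chi,
  (\forall y \near x, chi y = 1), compact (fsupp chi) & fsupp chi `<=` W].
Proof.
move=> /nbhs_boxP[r r0 rW].
have r40 : 0 < r / 4 by rewrite divr_gt0.
have [chi [sc c1 c0]] := smooth_bump x r40.
have sub : fsupp chi `<=` cube x (2 * (r / 4)).
  by apply: fsupp_sub => //; exact: closed_cube.
exists chi; split=> //.
- by apply: filterS (cube_nbhs x r40) => y; exact: c1.
- by apply: subclosed_compact _ (@compact_cube _ _ x (2 * (r / 4))) sub; exact: fsupp_closed.
- by move=> y /sub yc; apply: rW => j; apply: le_lt_trans (yc j) _; lra.
Qed.

(** 1 minus the product of the 1 - chi_x, where the chi_x equal 1 near the points x of a finite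
    set and these neighbourhoods cover K. *)
Lemma cutoff K W : compact K -> open W -> K `<=` W -> exists chi,
  [/\ smooth_on setT chi, (exists U, [/\ open U, K `<=` U & forall y, U y -> chi y = 1]),
      compact (fsupp chi) & fsupp chi `<=` W].
Proof.
move=> cK oW KW.
have H x : exists chi : V -> C, K x -> [/\ smooth_on setT chi,
    (\forall y \near x, chi y = 1), compact (fsupp chi) & fsupp chi `<=` W].
  have [Kx|nKx] := pselect (K x); last by exists (fun=> 0).
  have [chi h] := @cutoff_point x W (open_nbhs_nbhs (conj oW (KW x Kx))).
  by exists chi.
pose c x := projT1 (cid (H x)).
have cP x : K x -> _ := projT2 (cid (H x)).
rewrite -/(c _) in cP.
have [s [sK cov]] := @compact_finite_cover _ _ K (fun x => [set y | c x y = 1]) cK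
  (fun x Kx => let: And4 _ h _ _ := cP x Kx in h).
pose chi y := 1 - \prod_(x <- s) (1 - c x y).
have supp : fsupp chi `<=` \big[setU/set0]_(x <- s) fsupp (c x).
  apply: fsupp_sub => [|y].
    by apply: closed_bigsetU => x _; exact: fsupp_closed.
  rewrite /chi => h; apply: contrapT => h2; move/eqP: h; apply.
  rewrite big1_seq ?subrr// => x xs.
  rewrite fsupp_out ?subr0// => h3; apply: h2; rewrite -bigcup_seq; by exists x.
have cpt : compact (\big[setU/set0]_(x <- s) fsupp (c x)).
  rewrite big_seq; elim/big_ind : _ => [|A B|x xs].
  - exact: compact0.
  - exact: compactU.
  - by have [] := cP x (sK x xs).
exists chi; split.
- rewrite (_ : chi = (fun=> 1) + (fun=> -1) * (fun y => \prod_(x <- s | x \in s) (1 - c x y))).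
    apply: (smooth_onD openT (smooth_on_cst _ openT)).
    apply: (smooth_onM openT (smooth_on_cst _ openT)).
    apply: (@smooth_on_prod _ _ setT _ _ _ (fun x y => 1 - c x y) openT) => x xs.
    rewrite (_ : (fun y => 1 - c x y) = (fun=> 1) + (fun=> -1) * c x); last first.
      by apply/funext => y; rewrite !fctE mulN1r.
    apply: (smooth_onD openT (smooth_on_cst _ openT)).
    apply: (smooth_onM openT (smooth_on_cst _ openT)).
    by have [] := cP x (sK x xs).
  by apply/funext => y; rewrite /chi !fctE mulN1r -big_seq.
- exists (\bigcup_(x in [set` s]) [set y | c x y = 1]^°); split.
  + by apply: bigcup_open => x _; exact: open_interior.
  + by move=> y /cov[x xs h]; exists x.
  + move=> y [x /= xs] /interior_subset /= cxy.
    by rewrite /chi (big_rem x)//= cxy subrr mul0r subr0.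
- by apply: subclosed_compact cpt supp; exact: fsupp_closed.
- move=> y /supp; rewrite -bigcup_seq => -[x /= xs].
  by have [_ _ _] := cP x (sK x xs); apply.
Qed.

End Cutoff.

(** * Mean value inequality and symmetry of mixed derivatives *)

Section MeanValue.
Context {R : realType}.
Local Notation C := R[i].
Implicit Types (ga : R -> C).

(** Derivative of a complex function of one real variable. *)
Definition is_dC ga (u : R) (l : C) : Prop :=
  (h^-1)%:C * (ga (u + h) - ga u) @[h --> (0 : R)^'] --> l.

Lemma is_dCB ga gb u l m : is_dC ga u l -> is_dC gb u m ->
  is_dC (fun u => ga u - gb u) u (l - m).
Proof.
move=> h1 h2; rewrite /is_dC.
rewrite (_ : (fun _ => _) = (fun h => (h^-1)%:C * (ga (u + h) - ga u) -
  (h^-1)%:C * (gb (u + h) - gb u))); last by apply/funext => h; ring.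
exact: (cvgB h1 h2).
Qed.

Lemma is_dC_lin u (b : C) : is_dC (fun u => u%:C * b) u b.
Proof.
apply: (@cvg_trans _ (cst b @ (0 : R)^')); last exact: cvg_cst.
apply: near_eq_cvg; near=> h.
have h0 : h != 0 by near: h; exact: nbhs_dnbhs_neq.
by rewrite /cst rmorphD mulrDl addrAC subrr add0r mulrA -rmorphM mulVf// mul1r.
Unshelve. all: by end_near. Qed.

(** The factor 2 comes from applying the real mean value theorem to the real and the
    imaginary part. *)
Lemma mean_value ga (dga : R -> C) (a b M : R) : a <= b ->
  (forall u, a <= u <= b -> is_dC ga u (dga u)) ->
  (forall u, a <= u <= b -> normc (dga u) <= M) ->
  normc (ga b - ga a) <= 2 * (b - a) * M.
Proof.
move=> ab dg gM.
have dRe u : a <= u <= b -> is_derive u 1 (fun u => complex.Re (ga u)) (complex.Re (dga u)).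
  move=> /dg /cvg_ReIm[h _].
  have E : (fun h : R => h^-1 *: (((fun u => complex.Re (ga u)) \o shift u) (h *: 1) -
     complex.Re (ga u))) = (fun h => complex.Re ((h^-1)%:C * (ga (u + h) - ga u))).
    by apply/funext => k; rewrite ReCM ReB /= [k *: 1]mulr1 [k + u]addrC.
  split; first by apply/cvg_ex; exists (complex.Re (dga u)); rewrite E.
  by rewrite /derive E; exact: (cvg_lim _ h).
have dIm u : a <= u <= b -> is_derive u 1 (fun u => complex.Im (ga u)) (complex.Im (dga u)).
  move=> /dg /cvg_ReIm[_ h].
  have E : (fun h : R => h^-1 *: (((fun u => complex.Im (ga u)) \o shift u) (h *: 1) -
     complex.Im (ga u))) = (fun h => complex.Im ((h^-1)%:C * (ga (u + h) - ga u))).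
    by apply/funext => k; rewrite ImCM ImB /= [k *: 1]mulr1 [k + u]addrC.
  split; first by apply/cvg_ex; exists (complex.Im (dga u)); rewrite E.
  by rewrite /derive E; exact: (cvg_lim _ h).
have real_mv (p dp : R -> R) : (forall u, a <= u <= b -> is_derive u 1 p (dp u)) ->
   (forall u, a <= u <= b -> `|dp u| <= M) -> `|p b - p a| <= (b - a) * M.
  move=> hp hM.
  have [||c] := @MVT_segment _ p dp a b ab.
  - by move=> x; rewrite in_itv /= => /andP[h1 h2]; apply: hp; rewrite !ltW.
  - apply: derivable_within_continuous => x; rewrite in_itv /= => xab.
    exact: (@ex_derive _ _ _ _ _ _ _ (hp x xab)).
  - rewrite in_itv /= => cab ->.
    by rewrite normrM mulrC [`|b - a|]ger0_norm ?subr_ge0// ler_wpM2l ?subr_ge0// hM.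
apply: le_trans (normc_ReIm _) _; rewrite ReB ImB.
have h1 := real_mv _ _ dRe (fun u h => le_trans (normc_Re _) (gM u h)).
have h2 := real_mv _ _ dIm (fun u h => le_trans (normc_Im _) (gM u h)).
by apply: le_trans (lerD h1 h2) _; rewrite -mulrA mulr_natl mulr2n.
Qed.

Context {d : nat}.
Local Notation V := 'rV[R]_d.
Local Notation e_ j := (delta_mx 0 j : V).
Implicit Types (f : V -> C).

Lemma is_dC_axis f x j u : regular f (x + u *: e_ j) ->
  is_dC (fun u => f (x + u *: e_ j)) u (pderiv j f (x + u *: e_ j)).
Proof.
move=> rf; rewrite /is_dC (_ : (fun _ => _) = dquo j f (x + u *: e_ j)).
  exact: regular_pd.
by apply/funext => t; rewrite /dquo scalerDl addrA.
Qed.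

Lemma mean_value_axis f x j (a b M : R) : a <= b ->
  (forall u, a <= u <= b -> regular f (x + u *: e_ j)) ->
  (forall u, a <= u <= b -> normc (pderiv j f (x + u *: e_ j)) <= M) ->
  normc (f (x + b *: e_ j) - f (x + a *: e_ j)) <= 2 * (b - a) * M.
Proof.
move=> ab rf fM.
apply: (@mean_value (fun u => f (x + u *: e_ j))
   (fun u => pderiv j f (x + u *: e_ j)) a b M ab) => u uab; last exact: fM.
by apply: is_dC_axis; exact: rf.
Qed.

(** The mean value inequality, applied along j to an increment along i and then along i to
    the j-th derivative, compares the second difference with the mixed derivative. *)
Lemma second_difference U f x i j (e : R) : open U -> smooth_on U f -> U x -> 0 < e ->
  exists2 r, 0 < r & forall t, 0 <= t <= r ->
  normc (f (x + t *: e_ i + t *: e_ j) - f (x + t *: e_ i) - f (x + t *: e_ j) + f x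
     - (t * t)%:C * pderiv i (pderiv j f) x) <= 4 * (t * t) * e.
Proof.
move=> oU sf Ux e0.
have sj := smooth_on_pderiv j sf; have sij := smooth_on_pderiv i sj.
have [cB _] := smooth_regular oU sij Ux.
have nb : \forall y \near x, U y /\ normc (pderiv i (pderiv j f) x - pderiv i (pderiv j f) y) < e.
  apply: filterI; first exact: open_nbhs_nbhs.
  exact: (cvg_normcP _ _ _).1 cB _ e0.
have [r r0 hr] := (nbhs_boxP _ _).1 nb.
have r20 : 0 < r / 3 by rewrite divr_gt0.
exists (r / 3) => // t /andP[t0 tr].
set B := pderiv i (pderiv j f) x in hr *.
have box u w : 0 <= u <= t -> 0 <= w <= t -> U (x + w *: e_ i + u *: e_ j) /\
    normc (pderiv i (pderiv j f) (x + w *: e_ i + u *: e_ j) - B) <= e.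
  move=> ut wt; have [|h1 h2] := hr (x + w *: e_ i + u *: e_ j).
    move=> k; rewrite !mxE eqxx /=.
    by case: (k == i); case: (k == j); rewrite /= ltr_norml; lra.
  by split; [exact: h1|rewrite normcB; exact: ltW h2].
have hin u : 0 <= u <= t -> normc (pderiv j f (x + t *: e_ i + u *: e_ j) -
     pderiv j f (x + u *: e_ j) - t%:C * B) <= 2 * t * e.
  move=> ut.
  pose ga w := pderiv j f ((x + u *: e_ j) + w *: e_ i) - w%:C * B.
  pose dga w := pderiv i (pderiv j f) ((x + u *: e_ j) + w *: e_ i) - B.
  rewrite (_ : _ - _ - _ = ga t - ga 0); last first.
    rewrite /ga scale0r addr0 (addrAC x) mul0r subr0.
    by move: (pderiv j f _) (pderiv j f _) => p q; ring.
  rewrite (_ : 2 * t * e = 2 * (t - 0) * e); last by rewrite subr0.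
  apply: (@mean_value ga dga 0 t _ t0) => w wt.
    apply: is_dCB; last exact: is_dC_lin.
    apply: is_dC_axis; rewrite addrAC; apply: (smooth_regular oU sj).
    by have [h _] := box u w ut wt; exact: h.
  by rewrite /dga addrAC; have [_ h] := box u w ut wt; exact: h.
pose ga u := f (x + t *: e_ i + u *: e_ j) - f (x + u *: e_ j) - u%:C * (t%:C * B).
pose dga u := pderiv j f (x + t *: e_ i + u *: e_ j) - pderiv j f (x + u *: e_ j) - t%:C * B.
rewrite (_ : _ + f x - _ = ga t - ga 0); last first.
  rewrite /ga !scale0r !addr0 rmorphM mul0r subr0.
  by move: (f _) (f _) (f _) (f _) => p q v w; ring.
rewrite (_ : 4 * _ * e = 2 * (t - 0) * (2 * t * e)); last by ring.
apply: (@mean_value ga dga 0 t _ t0) => u ut; last exact: hin.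
have tt : 0 <= t <= t by rewrite t0 lexx.
have z : 0 <= (0 : R) <= t by rewrite t0 lexx.
apply: is_dCB; last exact: is_dC_lin.
apply: is_dCB; apply: is_dC_axis; apply: (smooth_regular oU sf).
  by have [h _] := box u t ut tt; exact: h.
by have [h _] := box u 0 ut z; rewrite scale0r addr0 in h; exact: h.
Qed.

(** The second difference is symmetric in i and j. *)
Lemma schwarz U f x i j : open U -> smooth_on U f -> U x ->
  pderiv i (pderiv j f) x = pderiv j (pderiv i f) x.
Proof.
move=> oU sf Ux; apply/subr0_eq/normc_le0; apply/ler_addgt0Pl => e e0; rewrite addr0.
have e80 : 0 < e / 8 by rewrite divr_gt0.
have [r r0 h1] := second_difference i j oU sf Ux e80.
have [s s0 h2] := second_difference j i oU sf Ux e80.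
pose t := Num.min r s.
have t0 : 0 < t by rewrite lt_min r0.
have {}h1 := h1 t; have {}h2 := h2 t.
rewrite (ltW t0) ge_min lexx in h1; rewrite (ltW t0) ge_min lexx orbT in h2.
move: (h1 isT) (h2 isT); rewrite [x + t *: e_ j + t *: e_ i]addrAC.
set Q1 := (X in normc X <= _ -> _) => {}h1; set Q2 := (X in normc X <= _ -> _) => {}h2.
have tt0 : 0 < t * t by rewrite mulr_gt0.
have : normc ((t * t)%:C * (pderiv i (pderiv j f) x - pderiv j (pderiv i f) x)) <= t * t * e.
  rewrite (_ : (t * t)%:C * _ = Q2 - Q1); last first.
    rewrite /Q1 /Q2; move: (f _) (f _) (f _) (f _) (pderiv i _ x) (pderiv j _ x) => *; ring.
  apply: le_trans (le_normcD _ _) _; rewrite normcN.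
  apply: le_trans (lerD h2 h1) _.
  by rewrite (_ : _ + _ = t * t * e) ?lexx//; field.
by rewrite normcM normcR (gtr0_norm tt0) ler_pM2l.
Qed.

Lemma pderiv_pderivs U f j s x : open U -> smooth_on U f -> U x ->
  pderiv j (pderivs s f) x = pderivs s (pderiv j f) x.
Proof.
move=> oU sf; elim: s x => // i s IH x Ux /=.
rewrite (schwarz _ _ oU (smooth_on_pderivs s sf))//.
exact: pderiv_eq_on oU IH x Ux.
Qed.

Lemma pderivs_mem U f s j x : open U -> smooth_on U f -> U x -> j \in s ->
  pderivs s f x = pderivs (rem j s) (pderiv j f) x.
Proof.
move=> oU sf; elim: s x => // i s IH x Ux; rewrite inE /= eq_sym.
case: eqVneq => [->|ij] /= js.
  exact: pderiv_pderivs oU sf Ux.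
by apply: pderiv_eq_on Ux => // y Uy; exact: IH.
Qed.

End MeanValue.

(** * Bounds on the derivatives of order at most k *)

Section DerivativeBounds.
Context {R : realType} {d : nat}.
Local Notation C := R[i].
Local Notation V := 'rV[R]_d.
Implicit Types (f g : V -> C) (K U : set V) (M N : R) (k : nat).

(** Bound on the partial derivatives of order at most k on K. *)
Definition pb K k f M : Prop :=
  forall s, (size s <= k)%N -> forall x, K x -> normc (pderivs s f x) <= M.

Lemma pb0P K f M : pb K 0 f M <-> forall x, K x -> normc (f x) <= M.
Proof.
split=> [h x Kx|h [|//] _ x Kx]; first exact: (h [::]).
exact: h.
Qed.

Lemma pbSP K k f M :
  pb K k.+1 f M <-> (forall x, K x -> normc (f x) <= M) /\ forall j, pb K k (pderiv j f) M.
Proof.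
split=> [h|[h1 h2]].
  split=> [x Kx|j s sk x Kx]; first exact: (h [::]).
  by rewrite -pderivs_rcons; apply: h => //; rewrite size_rcons.
elim/last_ind => [_ x Kx|s j _]; first exact: h1.
by rewrite size_rcons ltnS pderivs_rcons => sk x Kx; exact: h2.
Qed.

Lemma pb_leM K k f M N : M <= N -> pb K k f M -> pb K k f N.
Proof. by move=> MN h s sk x Kx; apply: le_trans MN; exact: h. Qed.

Lemma pb_leK K k l f M : (k <= l)%N -> pb K l f M -> pb K k f M.
Proof. by move=> kl h s sk x Kx; apply: h => //; exact: leq_trans kl. Qed.

Lemma pb_subset K L k f M : K `<=` L -> pb L k f M -> pb K k f M.
Proof. by move=> KL h s sk x /KL; exact: h. Qed.

Lemma pb_eq_on U K k f g M : open U -> K `<=` U -> (forall x, U x -> f x = g x) ->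
  pb K k f M -> pb K k g M.
Proof.
move=> oU KU fg h s sk x Kx.
rewrite -(pderivs_eq_on s oU fg (KU x Kx)); exact: h.
Qed.

Lemma pderivs_linE U (a : C) f g s x : open U -> smooth_on U f -> smooth_on U g -> U x ->
  pderivs s (a *: f + g) x = a * pderivs s f x + pderivs s g x.
Proof. by move=> oU sf sg Ux; exact: nbhs_singleton (pderivs_lin a sf sg s Ux). Qed.

Lemma smooth_onZ U (a : C) f : open U -> smooth_on U f -> smooth_on U (a *: f).
Proof. by move=> oU sf; rewrite -[a *: f]addr0; exact: (smooth_on_lin a sf (@smooth_on0 _ _ U)). Qed.

Lemma pderivsZ U (a : C) f s x : open U -> smooth_on U f -> U x ->
  pderivs s (a *: f) x = a * pderivs s f x.
Proof.
move=> oU sf Ux; rewrite -[a *: f]addr0 (pderivs_linE a s oU sf (@smooth_on0 _ _ U) Ux).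
by rewrite pderivs0 addr0.
Qed.

Lemma pderivsD U f g s x : open U -> smooth_on U f -> smooth_on U g -> U x ->
  pderivs s (f + g) x = pderivs s f x + pderivs s g x.
Proof.
by move=> oU sf sg Ux; rewrite -[f]scale1r (pderivs_linE 1 s oU sf sg Ux) mul1r scale1r.
Qed.

Lemma pbZ U K k (a : C) f M : open U -> K `<=` U -> smooth_on U f ->
  pb K k f M -> pb K k (a *: f) (normc a * M).
Proof.
move=> oU KU sf h s sk x Kx; rewrite (pderivsZ _ _ oU sf (KU x Kx)) normcM.
by apply: ler_wpM2l; [exact: normc_ge0|exact: h].
Qed.

Lemma pbD U K k f g M N : open U -> K `<=` U -> smooth_on U f -> smooth_on U g ->
  pb K k f M -> pb K k g N -> pb K k (f + g) (M + N).
Proof.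
move=> oU KU sf sg h1 h2 s sk x Kx; rewrite (pderivsD _ oU sf sg (KU x Kx)).
apply: le_trans (le_normcD _ _) _; apply: lerD; [exact: h1|exact: h2].
Qed.

(** Leibniz rule: each of the k derivations doubles the number of terms. *)
Lemma pbM U K k f g M N : open U -> K `<=` U -> smooth_on U f -> smooth_on U g ->
  0 <= M -> 0 <= N -> pb K k f M -> pb K k g N -> pb K k (f * g) (2 ^+ k * (M * N)).
Proof.
move=> oU KU sf sg M0 N0; elim: k f g sf sg => [|k IH] f g sf sg.
  rewrite !pb0P expr0 mul1r => h1 h2 x Kx; rewrite fctE normcM.
  by apply: ler_pM; [exact: normc_ge0|exact: normc_ge0|exact: h1|exact: h2].
move=> hf hg; have [hf1 hf2] := (pbSP _ _ _ _).1 hf; have [hg1 hg2] := (pbSP _ _ _ _).1 hg.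
apply/pbSP; split=> [x Kx|j].
  rewrite fctE normcM; apply: (@le_trans _ _ (M * N)).
    by apply: ler_pM; [exact: normc_ge0|exact: normc_ge0|exact: hf1|exact: hg1].
  by rewrite ler_peMl ?mulr_ge0// exprn_ege1// ler1n.
have sfj := smooth_on_pderiv j sf; have sgj := smooth_on_pderiv j sg.
have h1 := IH _ _ sfj sg (hf2 j) (pb_leK (leqnSn k) hg).
have h2 := IH _ _ sf sgj (pb_leK (leqnSn k) hf) (hg2 j).
have h := pbD oU KU (smooth_onM oU sfj sg) (smooth_onM oU sf sgj) h1 h2.
rewrite (_ : 2 ^+ k.+1 * _ = 2 ^+ k * (M * N) + 2 ^+ k * (M * N)); last by rewrite exprS; ring.
apply: (pb_eq_on oU KU _ h) => x Ux.
exact/esym/(pderivM _ (smooth_regular oU sf Ux) (smooth_regular oU sg Ux)).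
Qed.

Lemma compact_bound K f : compact K -> (forall x, K x -> {for x, continuous f}) ->
  exists2 M, 0 <= M & forall x, K x -> normc (f x) <= M.
Proof.
move=> /compact_near_coveringP cK cf.
have [|A [Ar h]] := cK R (pinfty_nbhs R) (fun M x => normc (f x) <= M).
  move=> x Kx.
  have h := (cvg_normcP _ _ _).1 (cf x Kx) 1 ltr01.
  exists ([set y | normc (f x - f y) < 1], [set M | normc (f x) + 1 < M]).
    split; first exact: (h _).
    by exists (normc (f x) + 1); split; [exact: num_real|].
  move=> [y M] /= [h1 h2]; apply: le_trans (ltW h2).
  rewrite -[f y](subrK (f x)) addrC (le_trans (le_normcD _ _))// lerD2l.
  by rewrite normcB ltW.
exists (`|A| + 1); first by rewrite addr_ge0.
by apply: h; rewrite ltr_pwDr// ler_norm.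
Qed.

Lemma pb_exists U K k f : open U -> K `<=` U -> compact K -> smooth_on U f ->
  exists2 M, 0 <= M & pb K k f M.
Proof.
move=> oU KU cK; elim: k f => [|k IH] f sf;
  have [M M0 hM] := compact_bound cK (fun x Kx => (smooth_regular oU sf (KU x Kx)).1).
  by exists M => //; apply/pb0P.
have H j : exists M, 0 <= M /\ pb K k (pderiv j f) M.
  by have [N] := IH _ (smooth_on_pderiv j sf); exists N.
have [N hN] := fin_all_exists H.
exists (M + \sum_j N j).
  by rewrite addr_ge0// sumr_ge0// => j _; case: (hN j).
have N0 : 0 <= \sum_j N j by rewrite sumr_ge0// => j _; case: (hN j).
apply/pbSP; split=> [x Kx|j]; first by apply: le_trans (hM x Kx) _; rewrite lerDl.
apply: pb_leM (hN j).2; rewrite (bigD1 j)//= addrCA lerDl addr_ge0// sumr_ge0// => i _.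
by case: (hN i).
Qed.

End DerivativeBounds.

Section BoundComp.
Context {R : realType} {m d : nat}.
Local Notation C := R[i].
Variables (Phi : 'rV[R]_m -> 'rV[R]_d) (si : 'I_m -> 'I_d) (c : 'I_m -> 'rV[R]_m -> R).
Hypothesis axP : axis_map Phi si c.

Lemma pb_comp (K : set 'rV[R]_m) k : compact K ->
  exists2 B : R, 0 <= B & forall (U : set 'rV[R]_d) f M, open U -> smooth_on U f ->
    Phi @` K `<=` U -> 0 <= M ->
    pb (Phi @` K) k f M -> pb K k (f \o Phi) (B * M).
Proof.
move=> cK; elim: k => [|k [B B0 hB]].
  exists 1 => // U f M oU sf KU M0 /pb0P h; apply/pb0P => x Kx.
  by rewrite mul1r; apply: h; exists x.
have H j : exists N, 0 <= N /\ pb K k (fun x => (c j x)%:C) N.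
  have [N N0 hN] := pb_exists k openT (@subsetT _ K) cK (@axis_smooth _ _ _ _ _ _ axP j).
  by exists N.
have [N hN] := fin_all_exists H.
have N0 : 0 <= \sum_j N j by rewrite sumr_ge0// => j _; case: (hN j).
exists (1 + \sum_j 2 ^+ k * (N j * B)).
  rewrite addr_ge0// sumr_ge0// => j _; rewrite !mulr_ge0// ?exprn_ge0//.
  by case: (hN j).
move=> U f M oU sf KU M0 /pbSP[h1 h2]; apply/pbSP; split=> [x Kx|j].
  apply: le_trans (h1 (Phi x) _) _; first by exists x.
  rewrite mulrDl mul1r lerDl mulr_ge0// sumr_ge0// => j _; rewrite !mulr_ge0// ?exprn_ge0//.
  by case: (hN j).
have sfj := smooth_on_pderiv (si j) sf.
have oP : open (Phi @^-1` U) := open_axis_preimage axP oU.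
have KP : K `<=` Phi @^-1` U by move=> x Kx; apply: KU; exists x.
have sc : smooth_on (Phi @^-1` U) (fun x => (c j x)%:C).
  exact: smooth_on_sub (@subsetT _ _) (@axis_smooth _ _ _ _ _ _ axP j).
have hj := hB U _ M oU sfj KU M0 (h2 (si j)).
have := pbM oP KP sc (smooth_on_comp axP oU sfj) (hN j).1 (mulr_ge0 B0 M0) (hN j).2 hj.
move=> h; apply: (@pb_leM _ _ _ _ _ (2 ^+ k * (N j * (B * M)))).
  rewrite mulrDl mul1r (bigD1 j)//= mulrDl -!mulrA addrCA lerDl addr_ge0// mulr_ge0//.
  rewrite sumr_ge0// => i _; rewrite !mulr_ge0// ?exprn_ge0//.
  by case: (hN i).
apply: (pb_eq_on oP KP _ h) => x Ux.
exact/esym/(pderiv_comp axP j (smooth_regular oU sf Ux)).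
Qed.

End BoundComp.

(** * Continuity as boundedness *)

Section CinftyTheory.
Context {R : realType} {d : nat}.
Local Notation C := R[i].
Local Notation V := 'rV[R]_d.
Variable Omega : set V.
Hypothesis oO : open Omega.
Implicit Types (f g : Cinfty Omega).

Lemma Cinfty_smooth f : smooth_on Omega f.
Proof. by case: f => f /= /asboolW[]. Qed.

Lemma Cinfty_out f x : ~ Omega x -> f x = 0.
Proof. by case: f => f /= /asboolW[_ h] /h. Qed.

Lemma Cinfty_eq f g : (forall x, Omega x -> f x = g x) -> f = g.
Proof.
move=> fg; apply/val_inj/funext => x /=.
have [/fg //|Ox] := pselect (Omega x).
by rewrite !Cinfty_out.
Qed.

Lemma toCinftyE (g : V -> C) x : smooth_on Omega g -> Omega x -> toCinfty Omega g x = g x.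
Proof.
move=> sg Ox; rewrite /toCinfty /=.
have gO : (g \_ Omega) \in smoothp Omega.
  apply/asboolT; split; last by move=> y Oy; rewrite patchE memNset.
  by apply: smooth_on_eq sg => // y Oy; rewrite patchE mem_set.
by rewrite -[Cinfty_fun _]/(\val _) insubdK// patchE mem_set.
Qed.

Lemma CinftyD f g x : (f + g) x = f x + g x. Proof. by []. Qed.
Lemma CinftyZ (a : C) f x : (a *: f) x = a * f x. Proof. by []. Qed.

Lemma toCinfty_lin (a : C) (u v : V -> C) : smooth_on Omega u -> smooth_on Omega v ->
  toCinfty Omega (a *: u + v) = a *: toCinfty Omega u + toCinfty Omega v.
Proof.
move=> su sv; apply: Cinfty_eq => x Ox.
have suv : smooth_on Omega (a *: u + v) by exact: smooth_on_lin.
by rewrite (toCinftyE suv Ox) CinftyD CinftyZ (toCinftyE su Ox) (toCinftyE sv Ox).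
Qed.

Lemma pderivs_Cinfty_lin (a : C) f g s x : Omega x ->
  pderivs s (a *: f + g) x = a * pderivs s f x + pderivs s g x.
Proof.
move=> Ox; have := pderivs_linE a s oO (Cinfty_smooth f) (Cinfty_smooth g) Ox.
by [].
Qed.

Lemma pderivs_CinftyZ (a : C) f s x : Omega x ->
  pderivs s (a *: f) x = a * pderivs s f x.
Proof. by move=> Ox; exact: (pderivsZ a s oO (Cinfty_smooth f) Ox). Qed.

(** The relation N f M reads: the size of the image of f is at most M. Boundedness on a
    neighbourhood of 0 is turned into a bound by homogeneity. This serves both for forms and for
    operators. *)
Lemma bounded_of_nbhs (N : Cinfty Omega -> R -> Prop) :
  (forall (a : R) f M, 0 < a -> N f M -> N (a%:C *: f) (a * M)) ->
  (forall f M, (forall e, 0 < e -> N f (M + e)) -> N f M) ->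
  nbhs (0 : Cinfty Omega) [set f | N f 1] ->
  exists K k (c : R), [/\ compact K, K `<=` Omega, 0 <= c &
    forall f M, 0 <= M -> pb K k f M -> N f (c * M)].
Proof.
move=> Nhom Ncl [K [k [e [cK KO e0 KN]]]].
exists K, k, (2 / e); split=> //; first by rewrite divr_ge0// ltW.
move=> f M M0 hf; apply: Ncl => de de0.
pose M' := M + de * e / 2.
have M'0 : 0 < M' by rewrite ltr_wpDl// divr_gt0// mulr_gt0.
(* a f is in the given neighbourhood of 0; the margin de makes M' positive *)
pose a := e / (2 * M').
have a0 : 0 < a by rewrite divr_gt0// mulr_gt0.
have -> : 2 / e * M + de = a^-1 * 1.
  by rewrite /a invf_div mulr1 /M'; field; rewrite gt_eqF.
have -> : f = (a^-1)%:C *: (a%:C *: f).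
  by rewrite scalerA -rmorphM mulVf ?gt_eqF// scale1r.
apply: Nhom; first by rewrite invr_gt0.
apply: KN => s sk x Kx.
rewrite [X in _ - X](_ : _ = 0); last by rewrite -[Cinfty_fun 0]/(0 : V -> C) pderivs0.
rewrite subr0 normcE0 ltcR (pderivs_CinftyZ _ _ _ (KO x Kx)) normcM normcR gtr0_norm//.
have h := hf s sk x Kx.
apply: (@le_lt_trans _ _ (a * M)); first by rewrite ler_pM2l.
rewrite /a mulrAC ltr_pdivrMr ?mulr_gt0// ltr_pM2l//.
have : 0 < de * e / 2 by rewrite divr_gt0// mulr_gt0.
rewrite /M'; lra.
Qed.

Lemma continuous_form_bounded (T : Cinfty Omega -> C) : linear T -> continuous T ->
  exists K k (c : R), [/\ compact K, K `<=` Omega, 0 <= c &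
    forall f M, 0 <= M -> pb K k f M -> normc (T f) <= c * M].
Proof.
move=> lT cT.
have T0 : T 0 = 0 by have := lT (-1) 0 0; rewrite scaler0 addr0 scaleN1r addNr.
have TZ a f : T (a *: f) = a * T f by have := lT a f 0; rewrite T0 !addr0.
apply: (bounded_of_nbhs (N := fun f M => normc (T f) <= M)).
- by move=> a f M a0 h; rewrite TZ normcM normcR gtr0_norm// ler_pM2l.
- by move=> f M h; apply/ler_addgt0Pr.
- have h := (cvg_normcP _ _ _).1 (cT 0) 1 ltr01.
  by apply: filterS (h _) => f; rewrite T0 sub0r normcN => /ltW.
Qed.

Lemma bounded_form_continuous (T : Cinfty Omega -> C) K k (c : R) : linear T ->
  compact K -> K `<=` Omega -> 0 <= c ->
  (forall f M, 0 <= M -> pb K k f M -> normc (T f) <= c * M) -> continuous T.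
Proof.
move=> lT cK KO c0 hT f; apply/(@cvg_normc_leP _ _ _ (nbhs_filter f)) => e e0.
have c1 : 0 < c + 1 by rewrite ltr_wpDl.
exists K, k, (e / (c + 1)); split=> //; first by rewrite divr_gt0.
move=> g fg /=.
have -> : T f - T g = T ((-1) *: g + f) by rewrite lT scaleN1r addrC.
apply: (@le_trans _ _ (c * (e / (c + 1)))).
  apply: hT; first by rewrite divr_ge0// ltW.
  move=> s sk x Kx; have := fg s sk x Kx.
  rewrite normcE0 ltcR (pderivs_Cinfty_lin _ _ _ _ (KO x Kx)) mulN1r.
  by rewrite [X in _ -> normc X <= _]addrC -normcB; exact: ltW.
by rewrite mulrCA ler_piMr// ?ltW// ltr_pdivrMr// mul1r ltrDl.
Qed.

End CinftyTheory.

Section Operators.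
Context {R : realType} {d m : nat}.
Local Notation C := R[i].
Variables (Omega : set 'rV[R]_d) (Omega' : set 'rV[R]_m).
Hypotheses (oO : open Omega) (oO' : open Omega').

Lemma continuous_op_bounded (L : Cinfty Omega -> Cinfty Omega') K' k' :
  linear L -> continuous L -> compact K' -> K' `<=` Omega' ->
  exists K k (c : R), [/\ compact K, K `<=` Omega, 0 <= c &
    forall (f : Cinfty Omega) M, 0 <= M -> pb K k f M -> pb K' k' (L f) (c * M)].
Proof.
move=> lL cL cK' KO'.
have L0 : L 0 = 0 by have := lL (-1) 0 0; rewrite scaler0 addr0 scaleN1r addNr.
have LZ a f : L (a *: f) = a *: L f by have := lL a f 0; rewrite L0 !addr0.
apply: (bounded_of_nbhs oO (N := fun (f : Cinfty Omega) M => pb K' k' (L f) M)).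
- move=> a f M a0 h s sk x Kx.
  rewrite LZ (pderivs_CinftyZ oO' _ _ _ (KO' x Kx)) normcM normcR gtr0_norm// ler_pM2l//.
  exact: h.
- by move=> f M h s sk x Kx; apply/ler_addgt0Pr => e e0; exact: h.
- have := cL 0 [set h : Cinfty Omega' | pb K' k' h 1]; rewrite L0; apply.
  exists K', k', 1; split=> // g h s sk x Kx /=.
  have := h s sk x Kx.
  rewrite normcE0 ltcR [X in _ - X](_ : _ = 0).
    by rewrite subr0; exact: ltW.
  by rewrite -[Cinfty_fun 0]/(0 : 'rV[R]_m -> C) pderivs0.
Qed.

Lemma bounded_op_continuous (L : Cinfty Omega -> Cinfty Omega') : linear L ->
  (forall K' k', compact K' -> K' `<=` Omega' -> exists K k (c : R),
    [/\ compact K, K `<=` Omega, 0 <= c &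
    forall (f : Cinfty Omega) M, 0 <= M -> pb K k f M -> pb K' k' (L f) (c * M)]) -> continuous L.
Proof.
move=> lL hL f A [K' [k' [e [cK' KO' e0 hA]]]].
have [K [k [c [cK KO c0 h]]]] := hL K' k' cK' KO'.
have c1 : 0 < c + 1 by rewrite ltr_wpDl.
exists K, k, (e / (c + 1)); split=> //; first by rewrite divr_gt0.
move=> g fg; apply: hA => s sk x Kx.
have e'0 : 0 <= e / (c + 1) by rewrite divr_ge0// ltW.
have hgf : pb K k ((-1) *: f + g) (e / (c + 1)).
  move=> s' sk' y Ky; have := fg s' sk' y Ky.
  rewrite normcE0 ltcR (pderivs_Cinfty_lin oO _ _ _ _ (KO y Ky)) mulN1r.
  by rewrite [X in _ -> normc X <= _]addrC; exact: ltW.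
have := h _ _ e'0 hgf s sk x Kx.
rewrite lL (pderivs_Cinfty_lin oO' _ _ _ _ (KO' x Kx)) mulN1r.
rewrite [X in normc X <= _ -> _]addrC normcE0 ltcR.
move/le_lt_trans; apply.
by rewrite mulrCA gtr_pMr// ltr_pdivrMr// mul1r ltrDl.
Qed.

End Operators.

(** * Bernstein approximation in one coordinate *)

Section RandomWalk.
Context {R : realType}.
Implicit Types (a b : nat -> R) (t : R).

(** Expectation of a at the number of successes in n independent trials with probability t;
    conditioning on the first trial gives the recursion, and Bernstein polynomials without
    binomial coefficients. *)
Fixpoint walk_mean n a t : R :=
  if n is m.+1 then t * walk_mean m (fun k => a k.+1) t + (1 - t) * walk_mean m a t else a 0%N.

Lemma walk_mean_le n a b t : 0 <= t <= 1 -> (forall k, (k <= n)%N -> a k <= b k) ->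
  walk_mean n a t <= walk_mean n b t.
Proof.
move=> /andP[t0 t1]; elim: n a b => [|n IH] a b ab; first exact: ab.
apply: lerD; apply: ler_wpM2l; rewrite ?subr_ge0//; apply: IH => k kn; apply: ab => //.
exact: leqW.
Qed.

Lemma walk_mean_affine n a (c e : R) t : walk_mean n (fun k => c + e * a k) t = c + e * walk_mean n a t.
Proof. by elim: n a => [|n IH] a //=; rewrite !IH; ring. Qed.

Lemma walk_mean_sq n (c t : R) :
  walk_mean n (fun k => (k%:R - c) ^+ 2) t = (n%:R * t - c) ^+ 2 + n%:R * t * (1 - t).
Proof.
elim: n c => [|n IH] c /=; first by ring.
have E : (fun k : nat => (k.+1%:R - c) ^+ 2) = (fun k => (k%:R - (c - 1)) ^+ 2).
  by apply/funext => k; rewrite -natr1; ring.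
by rewrite E !IH -natr1; ring.
Qed.

(** Chebyshev: for u = k/n - t, |u| is at most de + u^2/de, and the mean of u^2 is at most 1/n. *)
Lemma walk_mean_dist n (t de : R) : 0 <= t <= 1 -> 0 < de -> (0 < n)%N ->
  walk_mean n (fun k => `|k%:R / n%:R - t|) t <= de + (n%:R * de)^-1.
Proof.
move=> /[dup] t01 /andP[t0 t1] de0 n0.
have n0' : 0 < n%:R :> R by rewrite ltr0n.
apply: (@le_trans _ _ (walk_mean n (fun k => de + (n%:R ^+ 2 * de)^-1 * (k%:R - n%:R * t) ^+ 2) t)).
  apply: walk_mean_le => // k _.
  set u := k%:R / n%:R - t.
  have -> : (n%:R ^+ 2 * de)^-1 * (k%:R - n%:R * t) ^+ 2 = u ^+ 2 / de.
    by rewrite /u; field; rewrite !gt_eqF.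
  have [h|h] := leP `|u| de; first by apply: le_trans h _; rewrite lerDl divr_ge0 ?sqr_ge0// ltW.
  apply: (@le_trans _ _ (u ^+ 2 / de)); last by rewrite lerDr ltW.
  rewrite ler_pdivlMr// -real_normK ?num_real// expr2 ler_wpM2l//.
  exact: ltW.
rewrite walk_mean_affine walk_mean_sq subrr expr0n add0r lerD2l.
rewrite (_ : _ * _ = (n%:R * de)^-1 * (t * (1 - t))); last by field; rewrite !gt_eqF.
have tt : t * (1 - t) <= 1.
  by rewrite (le_trans (_ : _ <= t * 1)) ?mulr1// -[leRHS]mulr1 ler_wpM2l//; lra.
by rewrite ler_piMr// invr_ge0 mulr_ge0// ltW.
Qed.

End RandomWalk.

Section CoordinateApproximation.
Context {R : realType} {d : nat}.
Local Notation C := R[i].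
Local Notation V := 'rV[R]_d.
Local Notation e_ j := (delta_mx 0 j : V).
Implicit Types (f g p : V -> C) (I : 'I_d -> Prop).

Definition indep j f := forall x (t : R), f (x + t *: e_ j) = f x.

Definition slice (j : 'I_d) (c : R) (x : V) : V :=
  \row_i (if i == j then c else x 0 i).

Lemma axis_slice j c : axis_map (slice j c) id (fun i _ => (i != j)%:R).
Proof.
split.
- apply: continuous_row => i.
  rewrite (_ : (fun _ => _) = fun x : V => if i == j then c else x 0 i).
    by case: eqP => _; [exact: cst_continuous|exact: continuous_coord].
  by apply/funext => x; rewrite mxE.
- by move=> i; exact: smooth_on_cst openT.
- move=> x i t; apply/rowP => l; rewrite !mxE eqxx /=.
  case: (eqVneq l j) => [->|lj].
    by case: (eqVneq i j) => [_|ij] /=; ring.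
  by case: (eqVneq l i) lj => [->|li] lj; rewrite ?lj /=; ring.
Qed.

Lemma slice_move j (x : V) (t : R) : slice j t x = slice j 0 x + t *: e_ j.
Proof.
apply/rowP => l; rewrite !mxE eqxx /=; case: eqVneq => _ /=; ring.
Qed.

Lemma slice_id j (x : V) : slice j (x 0 j) x = x.
Proof. by apply/rowP => l; rewrite !mxE; case: eqVneq => [->|]. Qed.

Lemma slice_cube j r (c : R) x : cube 0 r x -> `|c| <= r -> cube 0 r (slice j c x).
Proof.
move=> xr cr l; rewrite !mxE subr0; case: eqVneq => // _.
by have := xr l; rewrite mxE subr0.
Qed.

Lemma smooth_slice j c f : smooth_on setT f -> smooth_on setT (f \o slice j c).
Proof. by move=> sf; have := smooth_on_comp (axis_slice j c) openT sf. Qed.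

Lemma indep_slice j c f : indep j (f \o slice j c).
Proof.
move=> x t /=; rewrite (axis_move (axis_slice j c)) eqxx mulr0 scale0r addr0//.
Qed.

Lemma indep_slice_other j c i f : indep i f -> indep i (f \o slice j c).
Proof. by move=> fi x t /=; rewrite (axis_move (axis_slice j c)) fi. Qed.

Lemma indep_pderiv i j f : smooth_on setT f -> indep i f -> indep i (pderiv j f).
Proof.
move=> sf fi x t; apply: is_pdE.
have := regular_pd (j := j) (smooth_regular openT sf (Logic.I : [set: V] x)).
rewrite /is_pd (_ : dquo j f (x + t *: e_ i) = dquo j f x)//.
by apply/funext => h; rewrite /dquo addrAC !fi.
Qed.

Lemma pderivs_slice j c f s x : smooth_on setT f -> j \notin s ->
  pderivs s (f \o slice j c) x = pderivs s f (slice j c x).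
Proof.
move=> sf; elim: s x => [|i s IH] x //; rewrite inE negb_or => /andP[ij js] /=.
rewrite (pderiv_eq_on _ openT (fun y _ => IH y js) (Logic.I : setT x)).
have sfs := smooth_on_pderivs s sf.
rewrite (pderiv_comp (axis_slice j c) i (smooth_regular openT sfs (Logic.I : [set: V] (slice j c x)))).
by rewrite eq_sym ij mul1r.
Qed.

(** Polynomials in the coordinate j whose coefficients are smooth and depend neither on the
    coordinate j nor on those in I. *)
Inductive poly_in (j : 'I_d) I : (V -> C) -> Prop :=
| poly_in0 : poly_in j I (fun=> 0)
| poly_inS i g p : smooth_on setT g -> indep j g -> (forall l, I l -> indep l g) ->
    poly_in j I p -> poly_in j I (fun x => crd j x ^+ i * g x + p x).

Variables (j : 'I_d) (I : 'I_d -> Prop).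

Lemma poly_in_smooth p : poly_in j I p -> smooth_on setT p.
Proof.
elim=> [|i g q sg _ _ _ sq]; first exact: smooth_on_cst openT.
have sc := smooth_onX i openT (@smooth_on_crd R d setT j openT).
exact: smooth_onD openT (smooth_onM openT sc sg) sq.
Qed.

Lemma poly_inD p q : poly_in j I p -> poly_in j I q -> poly_in j I (fun x => p x + q x).
Proof.
move=> hp hq; elim: hp => [|i g p' sg ig Ig _ IH].
  by rewrite (_ : (fun _ => _) = q)//; apply/funext => x; rewrite add0r.
rewrite (_ : (fun _ => _) = fun x => crd j x ^+ i * g x + (p' x + q x)).
  exact: poly_inS.
by apply/funext => x; rewrite addrA.
Qed.

Lemma poly_in_affine (a b : C) p : poly_in j I p ->
  poly_in j I (fun x => (a + b * crd j x) * p x).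
Proof.
elim=> [|i g q sg ig Ig hq IH].
  rewrite (_ : (fun _ => _) = fun=> 0); first exact: poly_in0.
  by apply/funext => x; rewrite mulr0.
have sc (c : C) : smooth_on setT (fun x => c * g x).
  exact: (smooth_onM openT (smooth_on_cst c openT) sg).
rewrite (_ : (fun _ => _) = fun x => crd j x ^+ i.+1 * (b * g x) +
   (crd j x ^+ i * (a * g x) + (a + b * crd j x) * q x)).
  have ic (c : C) : indep j (fun x => c * g x) by move=> x t; rewrite ig.
  have Ic (c : C) l : I l -> indep l (fun x => c * g x).
    by move=> Il x t; rewrite Ig.
  exact (poly_inS i.+1 (sc b) (ic b) (Ic b) (poly_inS i (sc a) (ic a) (Ic a) IH)).
by apply/funext => x; rewrite exprS; ring.
Qed.

Lemma poly_in_const g : smooth_on setT g -> indep j g -> (forall l, I l -> indep l g) ->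
  poly_in j I g.
Proof.
move=> sg ig Ig; have := poly_inS 0 sg ig Ig (poly_in0 j I).
by rewrite (_ : (fun _ => _) = g)//; apply/funext => x; rewrite expr0 mul1r addr0.
Qed.

Lemma pderiv_indep g x : indep j g -> pderiv j g x = 0.
Proof.
move=> ig; apply: is_pdE; rewrite /is_pd (_ : dquo _ _ _ = fun=> 0); first exact: cvg_cst.
by apply/funext => t; rewrite /dquo ig subrr mulr0.
Qed.

Lemma pderiv_crdX i (x : V) : pderiv j (fun y : V => crd j y ^+ i.+1) x = i.+1%:R * crd j x ^+ i.
Proof.
elim: i x => [|i IH] x.
  rewrite (_ : (fun _ => _) = crd j); first by rewrite pderiv_crd eqxx mulr1.
  by apply/funext => y; rewrite expr1.
rewrite (_ : (fun _ => _) = crd j * (fun y => crd j y ^+ i.+1)); last first.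
  by apply/funext => y; rewrite exprS.
rewrite pderivM; [|exact: regular_crd|]; last first.
  exact: (smooth_regular openT (smooth_onX i.+1 openT (@smooth_on_crd R d setT j openT)) (Logic.I : setT x)).
by rewrite pderiv_crd eqxx IH mul1r -natr1 exprS; ring.
Qed.

Lemma poly_in_primitive p : poly_in j I p -> exists q, [/\ poly_in j I q,
  (forall x, pderiv j q x = p x) & forall x : V, x 0 j = 0 -> q x = 0].
Proof.
elim=> [|i g p' sg ig Ig hp [q [hq dq q0]]].
  exists (fun=> 0); split=> //; first exact: poly_in0.
  by move=> x; exact: is_pdE (is_pd_cst _ _ _).
pose g' x := (i.+1%:R)^-1 * g x.
have sg' : smooth_on setT g' by exact: (smooth_onM openT (smooth_on_cst _ openT) sg).
have ig' : indep j g' by move=> x t; rewrite /g' ig.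
exists (fun x => crd j x ^+ i.+1 * g' x + q x); split.
- by apply: poly_inS => // l Il x t; rewrite /g' Ig.
- move=> x.
  have r1 := smooth_regular openT (smooth_onX i.+1 openT (@smooth_on_crd R d setT j openT)) (Logic.I : setT x).
  have r2 := smooth_regular openT sg' (Logic.I : setT x).
  have r3 := smooth_regular openT (poly_in_smooth hq) (Logic.I : setT x).
  have := pderivD j (regularM r1 r2) r3; rewrite pderivM// pderiv_crdX (pderiv_indep _ ig') mulr0 addr0 dq.
  move=> E; rewrite [LHS]E /g'; congr (_ + _).
  have : i.+1%:R != 0 :> C by rewrite pnatr_eq0.
  by move: (i.+1%:R : C) (crd j x ^+ i) (g x) => a u v a0; field.
- by move=> x x0; rewrite q0// /crd x0 expr0n mul0r addr0.
Qed.

Variable r : R.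
Hypothesis r0 : 0 < r.

(** The coordinate j, rescaled so that [-r, r] becomes the interval [0, 1] of probabilities. *)
Definition tau (x : V) : R := 1 / 2 + (2 * r)^-1 * x 0 j.
(** The points of [-r, r] that correspond to the frequencies k/n. *)
Definition node n (k : nat) : R := 2 * r * (k%:R / n%:R) - r.

Lemma tau01 x : cube 0 r x -> 0 <= tau x <= 1.
Proof.
move=> /(_ j); rewrite mxE subr0 ler_norml => /andP[h1 h2].
rewrite /tau invfM.
have : -1 <= r^-1 * x 0 j <= 1.
  rewrite mulrC ler_pdivlMr// ler_pdivrMr//; lra.
lra.
Qed.

Lemma coord_tau (x : V) : x 0 j = 2 * r * tau x - r.
Proof. by rewrite /tau; field; rewrite gt_eqF. Qed.

(** Bernstein polynomial in the coordinate j with the nodal coefficients h k, by the recursion of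
    walk_mean. *)
Fixpoint bern n (h : nat -> V -> C) (x : V) : C :=
  if n is m.+1 then (tau x)%:C * bern m (fun k => h k.+1) x + (1 - tau x)%:C * bern m h x
  else h 0%N x.

Lemma bern_dist n h x (c : C) : 0 <= tau x <= 1 ->
  normc (bern n h x - c) <= walk_mean n (fun k => normc (h k x - c)) (tau x).
Proof.
move=> /andP[t0 t1]; elim: n h => [|n IH] h //=.
have -> : (tau x)%:C * bern n (fun k => h k.+1) x + (1 - tau x)%:C * bern n h x - c =
  (tau x)%:C * (bern n (fun k => h k.+1) x - c) + (1 - tau x)%:C * (bern n h x - c).
  by rewrite rmorphB rmorph1; ring.
apply: le_trans (le_normcD _ _) _; rewrite !normcM !normcR !ger0_norm ?subr_ge0//.
by apply: lerD; apply: ler_wpM2l; rewrite ?subr_ge0//; exact: IH.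
Qed.

Lemma smooth_tau (a b : R) : smooth_on setT (fun x => (a + b * tau x)%:C).
Proof.
rewrite (_ : (fun _ => _) = (fun=> (a + b / 2)%:C) + (fun=> (b / (2 * r))%:C) * crd j).
  apply: (smooth_onD openT (smooth_on_cst _ openT)).
  exact: (smooth_onM openT (smooth_on_cst _ openT) (smooth_on_crd _ openT)).
apply/funext => x; rewrite !fctE /crd -rmorphM -rmorphD; congr (_%:C).
by rewrite /tau; field; rewrite gt_eqF.
Qed.

Lemma smooth_tau1 : smooth_on setT (fun x => (tau x)%:C).
Proof.
have := smooth_tau 0 1; congr (smooth_on _ _); apply/funext => x.
by rewrite add0r mul1r.
Qed.

Lemma smooth_tau2 : smooth_on setT (fun x => (1 - tau x)%:C).
Proof. by have := smooth_tau 1 (-1); congr (smooth_on _ _); apply/funext => x; rewrite mulN1r. Qed.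

Lemma smooth_bern n h : (forall k, smooth_on setT (h k)) -> smooth_on setT (bern n h).
Proof.
elim: n h => [|n IH] h sh; first exact: sh.
exact: (smooth_onD openT (smooth_onM openT smooth_tau1 (IH _ (fun k => sh k.+1)))
  (smooth_onM openT smooth_tau2 (IH _ sh))).
Qed.

Lemma pderiv_tau i (a b : R) x : i != j -> pderiv i (fun x => (a + b * tau x)%:C) x = 0.
Proof.
move=> ij; apply: is_pdE; rewrite /is_pd (_ : dquo _ _ _ = fun=> 0); first exact: cvg_cst.
apply/funext => t; rewrite /dquo /tau !mxE eqxx /= eq_sym (negPf ij).
by rewrite mulr0 addr0 subrr mulr0.
Qed.

Lemma pderiv_tau1 i x : i != j -> pderiv i (fun x => (tau x)%:C) x = 0.
Proof.
move=> ij; rewrite (_ : (fun _ => _) = fun x => (0 + 1 * tau x)%:C).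
  exact: pderiv_tau.
by apply/funext => y; rewrite add0r mul1r.
Qed.

Lemma pderiv_tau2 i x : i != j -> pderiv i (fun x => (1 - tau x)%:C) x = 0.
Proof.
move=> ij; rewrite (_ : (fun _ => _) = fun x => (1 + -1 * tau x)%:C).
  exact: pderiv_tau.
by apply/funext => y; rewrite mulN1r.
Qed.

Lemma pderiv_bern i n h x : i != j -> (forall k, smooth_on setT (h k)) ->
  pderiv i (bern n h) x = bern n (fun k => pderiv i (h k)) x.
Proof.
move=> ij; elim: n h => [|n IH] h sh //=.
have rT (u : V -> C) (y : V) : smooth_on setT u -> regular u y.
  by move=> su; exact: smooth_regular openT su (Logic.I : setT y).
have rb1 := rT _ x (smooth_bern n (fun k => sh k.+1)).
have rb2 := rT _ x (smooth_bern n sh).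
have r1 := rT _ x smooth_tau1; have r2 := rT _ x smooth_tau2.
have E := pderivD i (regularM r1 rb1) (regularM r2 rb2).
rewrite [LHS]E !pderivM// (pderiv_tau1 _ ij) (pderiv_tau2 _ ij) !mul0r !add0r.
by rewrite (IH _ (fun k => sh k.+1)) (IH _ sh).
Qed.

Lemma pderivs_bern s n h x : j \notin s -> (forall k, smooth_on setT (h k)) ->
  pderivs s (bern n h) x = bern n (fun k => pderivs s (h k)) x.
Proof.
move=> + sh; elim: s x => [|i s IH] x //; rewrite inE negb_or => /andP[ij js] /=.
rewrite (pderiv_eq_on _ openT (fun y _ => IH y js) (Logic.I : setT x)).
have ij' : i != j by rewrite eq_sym.
exact (@pderiv_bern i n _ x ij' (fun k => smooth_on_pderivs s (sh k))).
Qed.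

Lemma poly_in_bern n h : (forall k, poly_in j I (h k)) -> poly_in j I (bern n h).
Proof.
elim: n h => [|n IH] h hh; first exact: hh.
have := poly_inD (poly_in_affine (1 / 2)%:C ((2 * r)^-1)%:C (IH _ (fun k => hh k.+1)))
  (poly_in_affine (1 - 1 / 2)%:C (- (2 * r)^-1)%:C (IH _ hh)).
congr (poly_in _ _ _); apply/funext => x /=.
by rewrite /tau /crd -!rmorphM -!rmorphD mulNr opprD addrA.
Qed.

(** The degree n depends on f only through a bound L for its derivative along j. The same n thus
    serves for all derivatives of a function that do not involve j. *)
Lemma bern_approx (L e : R) : 0 <= L -> 0 < e -> exists n, forall f, smooth_on setT f ->
  (forall x, cube 0 r x -> normc (pderiv j f x) <= L) ->
  forall x, cube 0 r x -> normc (bern n (fun k => f \o slice j (node n k)) x - f x) <= e.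
Proof.
move=> L0 e0.
(* the values at the node and at x differ by at most 4 r L |k/n - tau x| *)
pose D := 4 * r * L + 1.
have D0 : 0 < D by rewrite /D ltr_wpDl// !mulr_ge0// ltW.
pose de := e / (2 * D); have de0 : 0 < de by rewrite divr_gt0// mulr_gt0.
pose n := (Num.trunc ((de * de)^-1)).+1.
have nde : (n%:R * de)^-1 <= de.
  have h : (de * de)^-1 <= n%:R.
    by apply/ltW; rewrite /n; have /truncn_itv/andP[] : 0 <= (de * de)^-1 by rewrite invr_ge0 mulr_ge0// ltW.
  have dd : 0 < de * de by rewrite mulr_gt0.
  have h1 : 1 <= n%:R * (de * de) by move: h; rewrite -div1r ler_pdivrMr.
  rewrite -[leLHS]div1r ler_pdivrMr; last by rewrite mulr_gt0// ltr0n.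
  by rewrite [leRHS]mulrCA.
exists n => f sf fL x xr.
apply: le_trans (bern_dist _ _ _ (tau01 xr)) _.
apply: (@le_trans _ _ (walk_mean n (fun k => 0 + 4 * r * L * `|k%:R / n%:R - tau x|) (tau x))).
  apply: walk_mean_le; first exact: tau01.
  move=> k kn /=; rewrite add0r.
  have kn01 : 0 <= k%:R / n%:R :> R /\ k%:R / n%:R <= 1 :> R.
    by split; rewrite ?divr_ge0// ler_pdivrMr ?ltr0n// mul1r ler_nat.
  have Nr : `|node n k| <= r.
    rewrite /node ler_norml.
    have : 0 <= 2 * r * (k%:R / n%:R) <= 2 * r.
      case: kn01 => h1 h2; rewrite mulr_ge0 ?mulr_ge0 ?(ltW r0)//=.
      by rewrite ler_piMr// mulr_ge0// ltW.
    lra.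
  have xjr : `|x 0 j| <= r by have := xr j; rewrite mxE subr0.
  have seg a b : `|a| <= r -> `|b| <= r -> a <= b ->
      normc (f (slice j b x) - f (slice j a x)) <= 2 * (b - a) * L.
    move=> ar br ab; rewrite (slice_move j x a) (slice_move j x b).
    have inr u : a <= u <= b -> `|u| <= r.
      by move: ar br; rewrite !ler_norml; lra.
    apply: mean_value_axis => // u uab; last first.
      by rewrite -slice_move; apply: fL; apply: slice_cube => //; exact: inr.
    exact: smooth_regular openT sf (Logic.I : setT _).
  have -> : 4 * r * L * `|k%:R / n%:R - tau x| = 2 * `|node n k - x 0 j| * L.
    have -> : node n k - x 0 j = 2 * r * (k%:R / n%:R - tau x).
      by rewrite coord_tau /node; ring.
    rewrite normrM (ger0_norm (_ : 0 <= 2 * r)); last by rewrite mulr_ge0// ltW.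
    by ring.
  rewrite -{2}(slice_id j x).
  have [h|/ltW h] := leP (x 0 j) (node n k).
    by rewrite (ger0_norm (_ : 0 <= node n k - x 0 j)) ?subr_ge0//; exact: seg.
  rewrite normcB (ler0_norm (_ : node n k - x 0 j <= 0)) ?subr_le0// opprB.
  exact: seg.
rewrite walk_mean_affine add0r.
apply: (@le_trans _ _ (D * (de + (n%:R * de)^-1))).
  apply: ler_pM; first by rewrite !mulr_ge0// ltW.
  - rewrite -[leLHS](_ : walk_mean n (fun=> 0 + 0 * 0) (tau x) = 0); last by rewrite walk_mean_affine mul0r addr0.
    by apply: walk_mean_le; [exact: tau01|move=> k _; rewrite mul0r addr0].
  - by rewrite /D lerDl.
  - by apply: walk_mean_dist => //; exact: tau01.
apply: (@le_trans _ _ (D * (de + de))); first by rewrite ler_pM2l// lerD2l.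
by rewrite /de le_eqVlt; apply/orP; left; apply/eqP; field; rewrite gt_eqF.
Qed.

End CoordinateApproximation.

(** * Density of the polynomials *)

Section Density.
Context {R : realType} {d : nat}.
Local Notation C := R[i].
Local Notation V := 'rV[R]_d.
Local Notation e_ j := (delta_mx 0 j : V).
Local Notation E := (Cinfty [set: V]).
Implicit Types (f g p : V -> C) (I : 'I_d -> Prop).

(* all derivatives of order at most k with at most m derivations along j *)
Definition pbj (K : set V) (j : 'I_d) k m f (M : R) : Prop :=
  forall s, (size s <= k)%N -> (count_mem j s <= m)%N -> forall x, K x ->
    normc (pderivs s f x) <= M.

Lemma smooth_onB U f g : open U -> smooth_on U f -> smooth_on U g ->
  smooth_on U (fun x => f x - g x).
Proof.
move=> oU sf sg; rewrite (_ : (fun _ => _) = f + (-1) *: g).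
  exact: smooth_onD oU sf (smooth_onZ (-1) oU sg).
by apply/funext => x; rewrite fctE scaleN1r.
Qed.

Lemma pderivsB U f g s x : open U -> smooth_on U f -> smooth_on U g -> U x ->
  pderivs s (fun x => f x - g x) x = pderivs s f x - pderivs s g x.
Proof.
move=> oU sf sg Ux; rewrite (_ : (fun _ => _) = (-1) *: g + f).
  by rewrite (pderivs_linE _ _ oU sg sf Ux) mulN1r addrC.
by apply/funext => y; rewrite fctE scaleN1r addrC.
Qed.

(** Induction on the number m of derivations along j. For m = 0 the Bernstein polynomials
    suffice, because they commute with the other derivatives. For m + 1, approximate the
    derivative along j and integrate from the hyperplane x_j = 0, where f is kept as it is. *)
Lemma approx_coord j r k m I : 0 < r -> forall f, smooth_on setT f ->
  (forall l, I l -> indep l f) -> forall e, 0 < e ->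
  exists2 p, poly_in j I p & pbj (cube 0 r) j k m (fun x => f x - p x) e.
Proof.
move=> r0; elim: m => [|m IH] f sf If e e0.
  have [L L0 hL] := pb_exists k.+1 openT (@subsetT _ (cube 0 r)) (@compact_cube _ _ 0 r) sf.
  have [n hn] := bern_approx j r0 L0 e0.
  pose h l := f \o slice j (node r n l).
  have sh l : smooth_on setT (h l) by exact: smooth_slice.
  have hp : poly_in j I (bern j r n h).
    apply: poly_in_bern => l; apply: poly_in_const; first exact: sh.
      exact: indep_slice.
    by move=> i Ii; apply: indep_slice_other; exact: If.
  exists (bern j r n h) => // s sk; rewrite leqn0 => cs x xr.
  have js : j \notin s by apply/count_memPn/eqP.
  rewrite (pderivsB s openT sf (poly_in_smooth hp) (Logic.I : setT x)) normcB.
  rewrite (pderivs_bern r0 n x js sh).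
  have -> : (fun l => pderivs s (h l)) = (fun l => pderivs s f \o slice j (node r n l)).
    by apply/funext => l; apply/funext => y; exact: pderivs_slice.
  apply: (hn (pderivs s f) (smooth_on_pderivs s sf) _ x xr) => y yr.
  exact: (hL (j :: s)).
have e'0 : 0 < Num.min e (e / (2 * r)) by rewrite lt_min e0 divr_gt0// mulr_gt0.
have [q hq aq] := IH _ (smooth_on_pderiv j sf) (fun l Il => indep_pderiv j sf (If l Il)) _ e'0.
have [q' [hq' dq' q'0]] := poly_in_primitive hq.
pose f0 := f \o slice j 0.
have sf0 : smooth_on setT f0 by exact: smooth_slice.
have hf0 : poly_in j I f0.
  apply: poly_in_const => //; first exact: indep_slice.
  by move=> l Il; apply: indep_slice_other; exact: If.
have hp := poly_inD hf0 hq'.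
set p := (fun x => f0 x + q' x) in hp.
exists p => //.
pose u x := f x - p x.
have su : smooth_on setT u by exact: (smooth_onB openT sf (poly_in_smooth hp)).
have du x : pderiv j u x = pderiv j f x - q x.
  have := pderivsB [:: j] openT sf (poly_in_smooth hp) (Logic.I : setT x).
  rewrite /= => E0; rewrite [LHS]E0; congr (_ - _).
  have := pderivD j (smooth_regular openT sf0 (Logic.I : setT x))
     (smooth_regular openT (poly_in_smooth hq') (Logic.I : setT x)).
  rewrite dq' (pderiv_indep _ (@indep_slice _ _ j 0 f)) add0r.
  by apply.
(* the error u vanishes on the hyperplane x_j = 0, and its j-th derivative is small *)
have u0 : u \o slice j 0 = fun=> 0.
  apply/funext => x; rewrite /u /p /f0 /= q'0 ?mxE ?eqxx// addr0.
  rewrite (_ : slice j 0 (slice j 0 x) = slice j 0 x) ?subrr//.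
  by apply/rowP => l; rewrite !mxE; case: eqP.
move=> s sk cs x xr.
have key s' : (size s' <= k)%N -> (count_mem j s' <= m)%N -> forall y, cube 0 r y ->
    normc (pderivs s' (pderiv j u) y) <= Num.min e (e / (2 * r)).
  move=> s1 s2 y yr.
  rewrite (pderivs_eq_on s' openT (fun z _ => du z) (Logic.I : setT y)).
  exact: aq.
(* if s contains j, move one derivation along j to the front; otherwise integrate along j *)
have [js|js] := boolP (j \in s).
  rewrite (pderivs_mem openT su (Logic.I : setT x) js).
  apply: le_trans (key _ _ _ _ xr) _; last by rewrite ge_min lexx.
    by rewrite size_rem// (leq_trans (leq_pred _)).
  by rewrite count_mem_rem eqxx /= leq_subLR add1n.
have cs0 : count_mem j s = 0%N by apply/count_memPn.
have z0 : pderivs s u (slice j 0 x) = 0.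
  by rewrite -(pderivs_slice 0 x su js) u0 -[(fun=> 0)]/(0 : V -> C) pderivs0.
have xjr : `|x 0 j| <= r by have := xr j; rewrite mxE subr0.
have ssu := smooth_on_pderivs s su.
have seg a b : `|a| <= r -> `|b| <= r -> a <= b ->
   normc (pderivs s u (slice j b x) - pderivs s u (slice j a x)) <=
     2 * (b - a) * (e / (2 * r)).
  move=> ar br ab; rewrite (slice_move j x a) (slice_move j x b).
  apply: mean_value_axis => // v vab; first exact: smooth_regular openT ssu (Logic.I : setT _).
  rewrite -slice_move (pderiv_pderivs j s openT su (Logic.I : setT _)).
  apply: le_trans (key _ sk _ _ _) _; first by rewrite cs0.
    by apply: slice_cube => //; move: ar br; rewrite !ler_norml; lra.
  by rewrite ge_min lexx orbT.
have fin (w : R) : 0 <= w -> w <= r -> 2 * w * (e / (2 * r)) <= e.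
  move=> w0 wr; rewrite (_ : 2 * w * _ = e * (w / r)); last by field; rewrite gt_eqF.
  by rewrite ler_piMr ?(ltW e0)// ler_pdivrMr// mul1r.
rewrite -(slice_id j x) -[X in normc X]subr0 -[X in normc (_ - X)]z0.
have r0' : `|0 : R| <= r by rewrite normr0 ltW.
have [h|/ltW h] := leP 0 (x 0 j).
  apply: le_trans (seg _ _ r0' xjr h) _; rewrite subr0; apply: fin => //.
  by rewrite -(ger0_norm h).
rewrite normcB; apply: le_trans (seg _ _ xjr r0' h) _; rewrite sub0r; apply: fin.
  by rewrite oppr_ge0.
by rewrite -(ler0_norm h).
Qed.

Lemma indep_all_const f : (forall l, indep l f) -> forall x, f x = f 0.
Proof.
move=> If x; rewrite [x]row_sum_delta.
elim/big_rec: _ => // i y _ <-.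
by rewrite addrC If.
Qed.

Lemma toCinftyT g : smooth_on setT g -> toCinfty [set: V] g = g :> (V -> C).
Proof. by move=> sg; apply/funext => x; rewrite (toCinftyE openT sg). Qed.

Variable T : E -> C.
Hypothesis lT : linear T.
Hypothesis cT : continuous T.

Local Notation Tg g := (T (toCinfty [set: V] g)).

Lemma form_lin (a : C) f g : smooth_on setT f -> smooth_on setT g ->
  Tg (fun x => a * f x + g x) = a * Tg f + Tg g.
Proof.
move=> sf sg; have := toCinfty_lin openT a sf sg.
by move=> h; rewrite -lT -h.
Qed.

Lemma form0 : T 0 = 0.
Proof. by have := lT (-1) 0 0; rewrite scaler0 addr0 scaleN1r addNr. Qed.

Lemma rmono_crdX al (j : 'I_d) i x :
  rmono al x * (crd j x ^+ i) = rmono [ffun l => (al l + (l == j) * i)%N] x :> C.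
Proof.
rewrite /rmono /mono (bigD1 j)//= mulrAC [RHS](bigD1 j)//= ffunE eqxx mul1n mxE exprD.
by congr (_ * _); apply: eq_bigr => l lj; rewrite ffunE (negPf lj) mul0n addn0.
Qed.

Hypothesis T0 : forall al, Tg (rmono al) = 0.

(** Descending induction on n: the approximation in the coordinate n replaces f by a sum of
    monomials times functions that do not depend on the first n + 1 coordinates. *)
Lemma form_vanish_indep n f al : (n <= d)%N -> smooth_on setT f ->
  (forall l : 'I_d, (l < n)%N -> indep l f) -> Tg (fun x => rmono al x * f x) = 0.
Proof.
elim: {n}(d - n)%N {-2}n (erefl (d - n)%N) f al => [|k IH] n nk f al nd sf If.
  have {}If l : indep l f.
    by apply: If; apply: leq_trans (ltn_ord l) _; rewrite -subn_eq0 nk.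
  have -> : (fun x => rmono al x * f x) = (fun x => f 0 * rmono al x + (fun=> 0) x).
    by apply/funext => x; rewrite addr0 mulrC (indep_all_const If).
  have s0 := @smooth_on_cst R d setT 0 openT.
  rewrite (form_lin _ (smooth_rmono _ openT) s0) T0 mulr0 add0r.
  rewrite (_ : toCinfty _ _ = 0) ?form0//; apply: Cinfty_eq => x _.
  by rewrite toCinftyT.
have {}nd : (n < d)%N by rewrite -subn_gt0 nk.
pose j := Ordinal nd.
pose I (l : 'I_d) := (l < n)%N : Prop.
have van p : poly_in j I p -> forall al, Tg (fun x => rmono al x * p x) = 0.
  elim=> [|i g p' sg ig Ig hp' IHp] be.
    rewrite (_ : toCinfty _ _ = 0) ?form0//; apply: Cinfty_eq => x _.
    have E0 : (fun x : V => rmono be x * 0) = fun=> 0 by apply/funext => y; rewrite mulr0.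
    by rewrite E0 (toCinftyT (@smooth_on_cst R d setT 0 openT)).
  pose be' := [ffun l => (be l + (l == j) * i)%N].
  pose F x := rmono be' x * g x; pose G x := rmono be x * p' x.
  have -> : (fun x => rmono be x * (crd j x ^+ i * g x + p' x)) = (fun x => 1 * F x + G x).
    by apply/funext => x; rewrite mul1r mulrDr mulrA rmono_crdX.
  have sF : smooth_on setT F := smooth_onM openT (smooth_rmono be' openT) sg.
  have sG : smooth_on setT G := smooth_onM openT (smooth_rmono be openT) (poly_in_smooth hp').
  have TG : Tg G = 0 := IHp be.
  rewrite (@form_lin 1 F G sF sG) TG addr0 mul1r.
  apply: (IH n.+1) => //; first by rewrite subnS nk.
  move=> l; rewrite ltnS leq_eqVlt => /orP[/eqP ln|]; last exact: Ig.
  by rewrite (_ : l = j)//; exact: val_inj.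
have [K [k0 [c [cK _ c0 hT]]]] := continuous_form_bounded openT lT cT.
have [r r0 Kr] := compact_in_cube cK.
have smono := @smooth_rmono R d setT al openT.
have [B B0 hB] := pb_exists k0 openT (@subsetT _ K) cK smono.
apply: normc_le0; apply/ler_addgt0Pl => e e0; rewrite addr0.
pose D := c * (2 ^+ k0 * B) + 1.
have D0 : 0 < D by rewrite ltr_wpDl// !mulr_ge0// exprn_ge0.
have eD0 : 0 < e / D by rewrite divr_gt0.
have [p hp ap] := approx_coord j k0 k0 r0 sf If eD0.
have sp := poly_in_smooth hp.
have sfp := smooth_onB openT sf sp.
pose F x := rmono al x * (f x - p x); pose G x := rmono al x * p x.
have -> : (fun x => rmono al x * f x) = (fun x => 1 * F x + G x).
  by apply/funext => x; rewrite mul1r -mulrDr subrK.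
have sF : smooth_on setT F := smooth_onM openT smono sfp.
have sG : smooth_on setT G := smooth_onM openT smono sp.
have TG : Tg G = 0 := van p hp al.
rewrite (@form_lin 1 F G sF sG) TG mul1r addr0.
have hfp : pb K k0 (fun x => f x - p x) (e / D).
  move=> s sk x Kx; apply: ap => //; last exact: Kr.
  exact: leq_trans (count_size _ _) sk.
have hb := pbM openT (@subsetT _ K) smono sfp B0 (ltW eD0) hB hfp.
apply: (@le_trans _ _ (c * (2 ^+ k0 * (B * (e / D))))).
  apply: hT; first by apply: mulr_ge0; [rewrite exprn_ge0|rewrite mulr_ge0 ?(ltW eD0)].
  by rewrite (toCinftyT sF).
rewrite !mulrA -[X in X * e / D]mulrA.
by rewrite ler_pdivrMr// mulrC ler_wpM2l ?(ltW e0)// /D lerDl.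
Qed.

(** Density of the polynomials, in its dual form. *)
Lemma form_vanish (f : E) : T f = 0.
Proof.
have sf := Cinfty_smooth f.
have H0 (l : 'I_d) : (l < 0)%N -> indep l f by [].
have := @form_vanish_indep 0 f [ffun=> 0%N] (leq0n _) sf H0.
have -> : (fun x => rmono [ffun=> 0%N] x * f x) = f.
  apply/funext => y; rewrite /rmono /mono big1 ?mul1r// => j _.
  by rewrite ffunE expr0.
rewrite (_ : toCinfty _ _ = f)//; apply: Cinfty_eq => x _.
by rewrite (toCinftyT sf).
Qed.

End Density.

(** * Support of a continuous linear form *)

Section Support.
Context {R : realType} {d : nat}.
Local Notation C := R[i].
Local Notation V := 'rV[R]_d.
Local Notation E := (Cinfty [set: V]).
Implicit Types (f g h : V -> C) (K L U W B : set V).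

Lemma smooth_cutoff_mul chi g W : open W -> smooth_on setT chi -> fsupp chi `<=` W ->
  smooth_on W g -> smooth_on setT (chi * g).
Proof.
move=> oW schi sub sg; apply: smooth_on_local => x _.
have [Wx|Wx] := pselect (W x).
  exists W, (chi * g); split; [exact: open_nbhs_nbhs|by []|].
  exact: (smooth_onM oW (smooth_on_sub (@subsetT _ W) schi) sg).
exists (~` fsupp chi), (fun=> 0); split.
- apply: open_nbhs_nbhs; split; last by move=> /sub.
  by apply: closed_openC; exact: fsupp_closed.
- by move=> y ny; rewrite fctE fsupp_out// mul0r.
- by apply: smooth_on_cst; apply: closed_openC; exact: fsupp_closed.
Qed.

Lemma fsupp_mull chi g : fsupp (chi * g) `<=` fsupp chi.
Proof.
apply: fsupp_sub; first exact: fsupp_closed.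
move=> x; rewrite fctE mulf_eq0 negb_or => /andP[cx _].
exact: subset_closure.
Qed.

Lemma pb_vanish U K k f M : open U -> K `<=` U -> (forall x, U x -> f x = 0) -> 0 <= M ->
  pb K k f M.
Proof.
move=> oU KU f0 M0 s sk x Kx.
rewrite (@pderivs_eq_on _ _ U f 0 s oU f0 x (KU x Kx)) pderivs0.
by rewrite normc0.
Qed.

Lemma notin_dsupp (Q : E -> C) x : ~ dsupp Q x -> exists2 W, nbhs x W &
  forall phi : E, compact (fsupp phi) -> fsupp phi `<=` W -> Q phi = 0.
Proof.
move=> nQ; apply: contrapT => h; apply: nQ => W Wx; apply: contrapT => h2; apply: h.
exists W => // phi c1 c2; apply: contrapT => /eqP c3; apply: h2.
by exists phi.
Qed.

Variable T : E -> C.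
Hypothesis lT : linear T.
Hypothesis cT : continuous T.
Local Notation Tg g := (T (toCinfty [set: V] g)).

Lemma TgE (f : E) : T f = Tg f.
Proof.
congr T; apply: Cinfty_eq => x _.
by rewrite (toCinftyT (Cinfty_smooth f)).
Qed.

Lemma vanish_near_bound K k (c : R) h U : 0 <= c ->
  (forall (f : E) M, 0 <= M -> pb K k f M -> normc (T f) <= c * M) ->
  smooth_on setT h -> open U -> K `<=` U -> (forall x, U x -> h x = 0) -> Tg h = 0.
Proof.
move=> c0 hT sh oU KU h0; apply: normc_le0; rewrite -[leRHS](mulr0 c).
by apply: hT => //; rewrite (toCinftyT sh); exact: pb_vanish KU h0 _.
Qed.

Lemma dsupp_sub_bound K k (c : R) : compact K -> 0 <= c ->
  (forall (f : E) M, 0 <= M -> pb K k f M -> normc (T f) <= c * M) -> dsupp T `<=` K.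
Proof.
move=> cK c0 hT x Tx; apply: contrapT => Kx.
have oK : open (~` K) by apply: closed_openC; apply: compact_closed cK; exact: hausdorffV.
have [phi [_ sub /eqP]] := Tx _ (open_nbhs_nbhs (conj oK Kx)); apply.
rewrite TgE; apply: (vanish_near_bound (U := ~` fsupp phi) c0 hT).
- exact: Cinfty_smooth.
- by apply: closed_openC; exact: fsupp_closed.
- by move=> y Ky /sub.
- by move=> y; exact: fsupp_out.
Qed.

Lemma dsupp_closed : closed (dsupp T).
Proof.
rewrite -openC openE => x nTx.
have [W Wx hW] := notin_dsupp nTx.
have := nbhs_interior Wx; apply: filterS => y Wy Ty.
by have [phi [c1 c2 /eqP]] := Ty W Wy; apply; exact: hW.
Qed.

Lemma dsupp_compact : compact (dsupp T).
Proof.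
have [K [k [c [cK _ c0 hT]]]] := continuous_form_bounded openT lT cT.
by apply: subclosed_compact cK (dsupp_sub_bound cK c0 hT); exact: dsupp_closed.
Qed.

Lemma out_dsupp x : ~ dsupp T x -> exists chi, [/\ smooth_on setT chi,
  (\forall y \near x, chi y = 1) & forall g, smooth_on setT g -> Tg (chi * g) = 0].
Proof.
move=> nTx.
have [W Wx hW] := notin_dsupp nTx.
have [chi [s1 s2 s3 s4]] := cutoff_point Wx.
exists chi; split=> // g sg.
have scg : smooth_on setT (chi * g) by exact: smooth_onM openT s1 sg.
apply: hW; rewrite (toCinftyT scg).
  by apply: subclosed_compact s3 (@fsupp_mull chi g); exact: fsupp_closed.
by apply: subset_trans s4; exact: fsupp_mull.
Qed.

(** Multiplying by 1 - chi_x, with chi_x equal to 1 near a point x outside the support, does not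
    change the value of T; finitely many x suffice to reach a function that vanishes near the
    compact set on which T is bounded. *)
Lemma support_vanish h B : smooth_on setT h -> open B -> dsupp T `<=` B ->
  (forall x, B x -> h x = 0) -> Tg h = 0.
Proof.
move=> sh oB TB hB.
have [K [k [c [cK _ c0 hT]]]] := continuous_form_bounded openT lT cT.
have cKB : compact (K `&` ~` B).
  have Kc : closed K by apply: compact_closed cK; exact: hausdorffV.
  apply: subclosed_compact cK _; last by move=> x [].
  by apply: closedI => //; exact: open_closedC.
have H x : exists chi, ~ dsupp T x -> [/\ smooth_on setT chi,
  (\forall y \near x, chi y = 1) & forall g, smooth_on setT g -> Tg (chi * g) = 0].
  have [Tx|Tx] := pselect (dsupp T x); first by exists 0.
  by have [chi hc] := out_dsupp Tx; exists chi.
pose ch x := projT1 (cid (H x)).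
have chP x : ~ dsupp T x -> _ := projT2 (cid (H x)).
rewrite -/(ch _) in chP.
have nT x : (K `&` ~` B) x -> ~ dsupp T x by move=> [_ Bx] /TB.
have [s [sK cov]] := @compact_finite_cover _ _ _ (fun x => [set y | ch x y = 1]) cKB
  (fun x Kx => let: And3 _ h _ := chP x (nT x Kx) in h).
(* the product of h with the factors 1 - ch x *)
pose P (r : seq V) : V -> C := foldr (fun x q => q - ch x * q) h r.
have sP r : (forall x, x \in r -> ~ dsupp T x) ->
    smooth_on setT (P r) /\ Tg (P r) = Tg h.
  elim: r => [|x r IH] hr; first by split; [exact: sh|].
  rewrite /P /= -/(P r).
  have [sq eq] := IH (fun y yr => hr y (mem_behead (s := x :: r) yr)).
  have [s1 _ s3] := chP x (hr x (mem_head _ _)).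
  have s4 := smooth_onM openT s1 sq.
  have -> : P r - ch x * P r = (fun y => -1 * (ch x * P r) y + P r y).
    by apply/funext => y; rewrite mulN1r addrC.
  split; last by rewrite (form_lin lT (-1) s4 sq) (s3 _ sq) mulr0 add0r.
  exact: (smooth_onD openT (smooth_onM openT (smooth_on_cst (-1) openT) s4) sq).
have [sPs <-] := sP s (fun x xs => nT x (sK x xs)).
pose U := B `|` \bigcup_(x in [set` s]) [set y | ch x y = 1]^°.
have oU : open U.
  by apply: openU => //; apply: bigcup_open => x _; exact: open_interior.
have Pvan r y : (h y = 0 \/ exists2 x, x \in r & ch x y = 1) -> P r y = 0.
  elim: r => [|x r IH] /=; first by case=> // -[].
  move=> H0; rewrite /P /= -/(P r) !fctE.
  have [cx|cx] := eqVneq (ch x y) 1; first by rewrite cx mul1r subrr.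
  rewrite IH ?mulr0 ?subrr//; case: H0 => [|[z]]; first by left.
  rewrite inE => /orP[/eqP ->|zr] cz; last by right; exists z.
  by rewrite cz eqxx in cx.
apply: (vanish_near_bound c0 hT sPs oU).
- move=> y Ky; have [By|By] := pselect (B y); first by left.
  by have [x xs cx] := cov y (conj Ky By); right; exists x.
- move=> y [By|[x xs cx]]; apply: Pvan; first by left; exact: hB.
  by right; exists x => //; exact: interior_subset cx.
Qed.

Lemma set_nbhsP (A S : set V) :
  set_nbhs A S <-> exists B, [/\ open B, A `<=` B & B `<=` S].
Proof.
split=> [h|[B [oB AB BS]] x Ax].
  exists (S^°); split; [exact: open_interior| |exact: interior_subset].
  by move=> x /h.
by apply: filterS BS (open_nbhs_nbhs (conj oB (AB x Ax))).
Qed.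

(** The value of T on a germ along the support does not depend on the smooth extension. *)
Lemma evE g (h : E) B : open B -> dsupp T `<=` B -> (forall x, B x -> h x = g x) ->
  ev T g = T h.
Proof.
move=> oB TB hg; rewrite /ev.
have hP : set_nbhs (dsupp T) [set x | h x = g x] by apply/set_nbhsP; exists B.
set Q := (X in xget 0 X).
have : Q (xget 0 Q) by apply: (xgetPex 0); exists h.
move: (xget 0 Q) => h' /set_nbhsP[B' [oB' TB' hB']].
apply/eqP; rewrite -subr_eq0; apply/eqP.
have sD : smooth_on setT (fun x => -1 * h x + h' x).
  exact: (smooth_onD openT (smooth_onM openT (smooth_on_cst (-1) openT) (Cinfty_smooth h))
    (Cinfty_smooth h')).
have TE : Tg (fun x => -1 * h x + h' x) = T h' - T h.
  rewrite (form_lin lT (-1) (Cinfty_smooth h) (Cinfty_smooth h')).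
  by rewrite mulN1r -(TgE h) -(TgE h') addrC.
rewrite -TE.
apply: (support_vanish sD (openI oB oB')); first by move=> x Tx; split; [exact: TB|exact: TB'].
by move=> x [Bx B'x]; rewrite (hg x Bx) (hB' x B'x) mulN1r addNr.
Qed.

Lemma ev_smooth g : smooth_on setT g -> ev T g = Tg g.
Proof. by move=> sg; apply: (evE openT) => // x _; rewrite (toCinftyT sg). Qed.

Lemma ev_E (f : E) : ev T f = T f.
Proof. exact: (evE openT). Qed.

Lemma ev_eq_near f g B : open B -> dsupp T `<=` B -> (forall x, B x -> f x = g x) ->
  smooth_on setT f -> ev T g = Tg f.
Proof. by move=> oB TB fg sf; apply: (evE oB TB) => x Bx; rewrite (toCinftyT sf) fg. Qed.

(** Multiply by a cutoff function that equals 1 near the support and is supported in W. *)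
Lemma ev_bounded W : open W -> dsupp T `<=` W -> exists L k (c : R),
  [/\ compact L, L `<=` W, 0 <= c,
   (forall g M, smooth_on W g -> 0 <= M -> pb L k g M -> normc (ev T g) <= c * M) &
   (forall a f g, smooth_on W f -> smooth_on W g ->
      ev T (fun x => a * f x + g x) = a * ev T f + ev T g)].
Proof.
move=> oW TW.
have [K [k [c [cK _ c0 hT]]]] := continuous_form_bounded openT lT cT.
have [chi [s1 [U [oU TU chi1]] s3 s4]] := cutoff dsupp_compact oW TW.
have [N N0 hN] := pb_exists k openT (@subsetT _ (fsupp chi)) s3 s1.
have evg g : smooth_on W g -> ev T g = Tg (chi * g).
  move=> sg; apply: (ev_eq_near oU TU); last exact: smooth_cutoff_mul oW s1 s4 sg.
  by move=> x Ux; rewrite fctE chi1// mul1r.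
exists (fsupp chi), k, (c * (2 ^+ k * N)); split; [exact: s3|exact: s4| | |].
- by rewrite !mulr_ge0// exprn_ge0.
- move=> g M sg M0 hg; rewrite (evg g sg) -mulrA -(mulrA (2 ^+ k)).
  have sgc := smooth_cutoff_mul oW s1 s4 sg.
  have Q0 : 0 <= 2 ^+ k * (N * M) by rewrite !mulr_ge0// exprn_ge0.
  apply: hT => //; rewrite (toCinftyT sgc) => s sk x Kx.
  have [Lx|Lx] := pselect (fsupp chi x).
    exact: (pbM oW s4 (smooth_on_sub (@subsetT _ W) s1) sg N0 M0 hN hg sk Lx).
  have oC : open (~` fsupp chi) by apply: closed_openC; exact: fsupp_closed.
  have v0 y : (~` fsupp chi) y -> (chi * g) y = 0.
    by move=> ny; rewrite fctE fsupp_out// mul0r.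
  by rewrite (@pderivs_eq_on _ _ _ (chi * g) 0 s oC v0 x Lx) pderivs0 normc0.
- move=> a f g sf sg.
  have saf : smooth_on W (fun x => a * f x + g x).
    exact: (smooth_onD oW (smooth_onM oW (smooth_on_cst a oW) sf) sg).
  rewrite (evg _ saf) (evg f sf) (evg g sg).
  have sfc := smooth_cutoff_mul oW s1 s4 sf; have sgc := smooth_cutoff_mul oW s1 s4 sg.
  rewrite -(form_lin lT a sfc sgc); congr (T (toCinfty _ _)).
  by apply/funext => x; rewrite !fctE; ring.
Qed.

(** Scaling by a nonzero constant is a bijection of the smooth extensions, so the identity
    also holds when there is none and both sides take the default value. *)
Lemma evZ (a : C) g : a != 0 -> ev T (fun x => a * g x) = a * ev T g.
Proof.
move=> a0.
have TZ (f : E) : T (a *: f) = a * T f by have := lT a f 0; rewrite (form0 lT) !addr0.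
have [[h /set_nbhsP[B [oB TB hB]]]|none] := pselect (exists h : E, set_nbhs (dsupp T) [set x | h x = g x]).
  rewrite (evE oB TB hB) -TZ; apply: (evE oB TB) => x Bx.
  have h1 : h x = g x := hB x Bx.
  by change (a * h x = a * g x); rewrite h1.
have n2 : ~ exists h : E, set_nbhs (dsupp T) [set x | h x = a * g x].
  move=> [h /set_nbhsP[B [oB TB hB]]]; apply: none; exists (a^-1 *: h).
  apply/set_nbhsP; exists B; split=> // x Bx.
  have h1 : h x = a * g x := hB x Bx.
  by change (a^-1 * h x = g x); rewrite h1 mulrA mulVf// mul1r.
rewrite /ev !xgetPN ?(form0 lT) ?mulr0//.
- by move=> h hh; apply: none; exists h.
- by move=> h hh; apply: n2; exists h.
Qed.

End Support.

(** * Forms applied to functions with parameters *)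

Section MeanValueSym.
Context {R : realType}.

Lemma mean_value_sym (ga dga : R -> R[i]) (t M : R) :
  (forall u, `|u| <= `|t| -> is_dC ga u (dga u)) ->
  (forall u, `|u| <= `|t| -> normc (dga u) <= M) ->
  normc (ga t - ga 0) <= 2 * `|t| * M.
Proof.
move=> h1 h2; have [t0|/ltW t0] := leP 0 t.
  have := @mean_value _ ga dga 0 t M t0; rewrite subr0 (ger0_norm t0); apply=> u /andP[u0 ut].
    by apply: h1; rewrite (ger0_norm u0) (ger0_norm t0).
  by apply: h2; rewrite (ger0_norm u0) (ger0_norm t0).
have := @mean_value _ ga dga t 0 M t0; rewrite sub0r (ler0_norm t0) normcB; apply=> u /andP[u0 ut].
  by apply: h1; rewrite (ler0_norm ut) (ler0_norm t0) lerN2.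
by apply: h2; rewrite (ler0_norm ut) (ler0_norm t0) lerN2.
Qed.

End MeanValueSym.

Section ParametricForms.
Context {R : realType} {m d : nat}.
Local Notation C := R[i].
Local Notation V := 'rV[R]_d.
Local Notation PV := 'rV[R]_m.
Local Notation E := (Cinfty [set: V]).
Implicit Types (F : 'rV[R]_(m + d) -> C) (x : PV) (y : V).

Lemma continuous_row_mx : continuous (fun p : PV * V => row_mx p.1 p.2).
Proof.
apply: continuous_row => l p.
have h1 : (fun q : PV * V => q.1) @ p --> p.1 by exact: cvg_fst.
have h2 : (fun q : PV * V => q.2) @ p --> p.2 by exact: cvg_snd.
case: (split_ordP l) => j ->.
  rewrite (_ : (fun _ => _) = fun q : PV * V => q.1 0 j).
    exact: (cvg_comp _ _ h1 (@continuous_coord _ _ j p.1)).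
  by apply/funext => q; rewrite row_mxEl.
rewrite (_ : (fun _ => _) = fun q : PV * V => q.2 0 j).
  exact: (cvg_comp _ _ h2 (@continuous_coord _ _ j p.2)).
by apply/funext => q; rewrite row_mxEr.
Qed.

Lemma axis_row_mx x : axis_map (row_mx x : V -> 'rV[R]_(m + d)) (@rshift m d) (fun _ _ => 1).
Proof.
split.
- apply: continuous_row => l; case: (split_ordP l) => j ->.
    rewrite (_ : (fun _ => _) = fun=> x 0 j); first exact: cst_continuous.
    by apply/funext => q; rewrite row_mxEl.
  rewrite (_ : (fun _ => _) = fun y : V => y 0 j); first exact: continuous_coord.
  by apply/funext => q; rewrite row_mxEr.
- by move=> i; exact: smooth_on_cst openT.
- move=> y j t; apply/rowP => l; rewrite mulr1.
  case: (split_ordP l) => i ->; rewrite [RHS]mxE ?row_mxEl ?row_mxEr.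
    by rewrite !mxE eq_lrshift andbF mulr0 addr0.
  by rewrite !mxE eq_rshift.
Qed.

Lemma row_mx_movel x y j (t : R) :
  row_mx (x + t *: delta_mx 0 j) y = row_mx x y + t *: delta_mx 0 (lshift d j).
Proof.
apply/rowP => l.
case: (split_ordP l) => i ->; rewrite [RHS]mxE ?row_mxEl ?row_mxEr.
  by rewrite !mxE eq_lshift.
by rewrite !mxE eq_rlshift andbF mulr0 addr0.
Qed.

(** Functions with parameters are functions on the product space; fixing the parameter gives a
    section. *)
Definition section F x : V -> C := F \o row_mx x.

Lemma smooth_section F x : smooth_on setT F -> smooth_on setT (section F x).
Proof. by move=> sF; have := smooth_on_comp (axis_row_mx x) openT sF. Qed.

Lemma pderiv_section F x j y : smooth_on setT F ->
  pderiv j (section F x) y = section (pderiv (rshift m j) F) x y.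
Proof.
move=> sF; have := pderiv_comp (axis_row_mx x) j
  (smooth_regular openT sF (Logic.I : [set: 'rV[R]_(m + d)] (row_mx x y))).
by rewrite mul1r.
Qed.

(** Uniform continuity on a compact set, for all derivatives in y of order at most k. *)
Lemma section_near_cont F K x0 k (e : R) : smooth_on setT F -> compact K -> 0 < e ->
  \forall x \near x0, pb K k (fun y => section F x y - section F x0 y) e.
Proof.
move=> + /compact_near_coveringP cK e0; elim: k F => [|k IH] F sF.
  have h : \forall x \near x0, K `<=` (fun y => normc (section F x y - section F x0 y) <= e).
    apply: (cK PV (nbhs x0) (fun x y => normc (section F x y - section F x0 y) <= e)) => y0 Ky0.
    have [cF _] := smooth_regular openT sF (Logic.I : [set: 'rV[R]_(m + d)] (row_mx x0 y0)).
    have cp := cvg_comp _ _ (@continuous_row_mx (x0, y0)) cF.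
    have e20 : 0 < e / 2 by rewrite divr_gt0.
    have [[A B] /= [Ax By] AB] := (cvg_normcP _ _ _).1 cp _ e20.
    exists (B, A) => // -[y x] /= [yB xA].
    have h1 := AB (x, y) (conj xA yB).
    have h2 := AB (x0, y) (conj (nbhs_singleton Ax) yB).
    rewrite /section /=.
    rewrite -[X in normc X](subrKA (F (row_mx x0 y0))).
    apply: le_trans (le_normcD _ _) _; rewrite [leRHS]splitr.
    by apply: lerD; apply: ltW; [rewrite normcB|]; [exact: h1|exact: h2].
  by apply: filterS h => x Kx; apply/pb0P => y; exact: Kx.
have h0 := IH F sF.
pose P (j : 'I_d) (x : PV) := pb K k (fun y =>
    section (pderiv (rshift m j) F) x y - section (pderiv (rshift m j) F) x0 y) e.
have hP j : \forall x \near x0, P j x := IH _ (smooth_on_pderiv (rshift m j) sF).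
have hj : \forall x \near x0, forall j, P j x by exact: filter_forall hP.
apply: filterS2 h0 hj => x a b; apply/pbSP; split=> [y Ky|j]; first exact: (a [::]).
apply: (pb_eq_on openT (@subsetT _ K) _ (b j)) => y _.
have := pderivsB [:: j] openT (smooth_section x sF) (smooth_section x0 sF) (Logic.I : setT y).
by rewrite /= (pderiv_section x j y sF) (pderiv_section x0 j y sF) => ->.
Qed.

(** Difference quotients in the parameter converge in C^oo: by the mean value inequality their
    error is the oscillation of the derivative, and the derivatives in y commute with those in x. *)
Lemma section_near_diff F K x k (e : R) j : smooth_on setT F -> compact K -> 0 < e ->
  \forall t \near (0 : R), pb K k (fun y => section F (x + t *: delta_mx 0 j) y -
     (t%:C * section (pderiv (lshift d j) F) x y + section F x y)) (`|t| * e).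
Proof.
move=> + cK e0; elim: k F => [|k IH] F sF.
  have e20 : 0 < e / 2 by rewrite divr_gt0.
  have sFj := smooth_on_pderiv (lshift d j) sF.
  have [r r0 hr] := (nbhs_boxP _ _).1 (section_near_cont x 0 sFj cK e20).
  exists r => // t /=; rewrite sub0r normrN => tr.
  apply/pb0P => y Ky.
  pose ga u := section F (x + u *: delta_mx 0 j) y - u%:C * section (pderiv (lshift d j) F) x y.
  pose dga u := section (pderiv (lshift d j) F) (x + u *: delta_mx 0 j) y -
     section (pderiv (lshift d j) F) x y.
  rewrite (_ : _ - _ = ga t - ga 0); last first.
    by rewrite /ga scale0r addr0 mul0r subr0 opprD addrA.
  apply: (@le_trans _ _ (2 * `|t| * (e / 2))); last first.
    by rewrite le_eqVlt; apply/orP; left; apply/eqP; field.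
  apply: (@mean_value_sym _ ga dga) => u ut.
    apply: is_dCB; last exact: is_dC_lin.
    have := @is_dC_axis _ _ F (row_mx x y) (lshift d j) u.
    rewrite /section /= (_ : (fun u => F (row_mx (x + u *: delta_mx 0 j) y)) =
      (fun u => F (row_mx x y + u *: delta_mx 0 (lshift d j)))); last first.
      by apply/funext => v; rewrite row_mx_movel.
    rewrite row_mx_movel; apply.
    exact: (smooth_regular openT sF (Logic.I : [set: 'rV[R]_(m + d)] _)).
  have hu : pb K 0 (fun y => section (pderiv (lshift d j) F) (x + u *: delta_mx 0 j) y -
     section (pderiv (lshift d j) F) x y) (e / 2).
    apply: hr => i; rewrite !mxE [x 0 i + _]addrC addrK.
    apply: le_lt_trans tr; apply: le_trans ut.
    by rewrite eqxx /=; case: (i == j); rewrite ?mulr1// mulr0 normr0.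
  exact: ((pb0P _ _ _).1 hu).
have h0 := IH F sF.
pose P (i : 'I_d) (t : R) := pb K k (fun y =>
    section (pderiv (rshift m i) F) (x + t *: delta_mx 0 j) y -
    (t%:C * section (pderiv (lshift d j) (pderiv (rshift m i) F)) x y +
      section (pderiv (rshift m i) F) x y)) (`|t| * e).
have hP i : \forall t \near (0 : R), P i t := IH _ (smooth_on_pderiv (rshift m i) sF).
have hi : \forall t \near (0 : R), forall i, P i t by exact: filter_forall hP.
apply: filterS2 h0 hi => t a b; apply/pbSP; split=> [y Ky|i]; first exact: (a [::]).
apply: (pb_eq_on openT (@subsetT _ K) _ (b i)) => y _.
have sFj := smooth_on_pderiv (lshift d j) sF.
have s2 := smooth_onD openT (smooth_onM openT (smooth_on_cst t%:C openT) (smooth_section x sFj))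
  (smooth_section x sF).
have E1 := pderivsB [:: i] openT (smooth_section (x + t *: delta_mx 0 j) sF) s2 (Logic.I : setT y).
have E2 := pderivs_linE t%:C [:: i] openT (smooth_section x sFj) (smooth_section x sF) (Logic.I : setT y).
have S : pderiv (rshift m i) (pderiv (lshift d j) F) = pderiv (lshift d j) (pderiv (rshift m i) F).
  by apply/funext => z; exact: (schwarz _ _ openT sF (Logic.I : [set: 'rV[R]_(m + d)] z)).
rewrite /= (pderiv_section x i y sFj) (pderiv_section x i y sF) S in E2.
rewrite /= (pderiv_section _ i y sF) in E1.
apply: esym; apply: (etrans E1); congr (_ - _).
exact: E2.
Qed.

Variable T : E -> C.
Hypothesis lT : linear T.
Hypothesis cT : continuous T.
Local Notation Tg g := (T (toCinfty [set: V] g)).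

(** The form T applied to F(x, y) as a function of y. *)
Definition partial_form F : PV -> C := fun x => Tg (section F x).

Lemma TgB f g : smooth_on setT f -> smooth_on setT g ->
  Tg (fun y => f y - g y) = Tg f - Tg g.
Proof.
move=> sf sg; rewrite (_ : (fun y => f y - g y) = fun y => -1 * g y + f y).
  by rewrite (form_lin lT (-1) sg sf) mulN1r addrC.
by apply/funext => y; rewrite mulN1r addrC.
Qed.

Lemma partial_form_cont F x : smooth_on setT F -> {for x, continuous (partial_form F)}.
Proof.
move=> sF.
have [K [k [c [cK _ c0 hT]]]] := continuous_form_bounded openT lT cT.
rewrite /prop_for /continuous_at; apply/(@cvg_normc_leP _ _ _ (nbhs_filter x)) => e e0.
have c1 : 0 < c + 1 by rewrite ltr_wpDl.
have ec : 0 < e / (c + 1) by rewrite divr_gt0.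
apply: filterS (section_near_cont x k sF cK ec) => x' h.
have s1 := smooth_section x sF; have s2 := smooth_section x' sF.
rewrite normcB /partial_form -(TgB s2 s1).
apply: (@le_trans _ _ (c * (e / (c + 1)))).
  by apply: hT; [exact: ltW|rewrite (toCinftyT (smooth_onB openT s2 s1))].
by rewrite mulrCA ler_piMr// ?ltW// ltr_pdivrMr// mul1r ltrDl.
Qed.

Lemma is_pd_partial_form F x j : smooth_on setT F ->
  is_pd j (partial_form F) x (partial_form (pderiv (lshift d j) F) x).
Proof.
move=> sF.
have [K [k [c [cK _ c0 hT]]]] := continuous_form_bounded openT lT cT.
rewrite /is_pd; apply/cvg_normc_leP => e e0.
have c1 : 0 < c + 1 by rewrite ltr_wpDl.
have ec : 0 < e / (c + 1) by rewrite divr_gt0.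
have h := section_near_diff x k j sF cK ec.
near=> t.
have t0 : t != 0 by near: t; exact: nbhs_dnbhs_neq.
have ht : pb K k (fun y => section F (x + t *: delta_mx 0 j) y -
     (t%:C * section (pderiv (lshift d j) F) x y + section F x y)) (`|t| * (e / (c + 1))).
  by near: t; exact: (cvg_within _ h).
have sj := smooth_section x (smooth_on_pderiv (lshift d j) sF).
have s1 := smooth_section x sF; have s2 := smooth_section (x + t *: delta_mx 0 j) sF.
have s3 := smooth_onD openT (smooth_onM openT (smooth_on_cst t%:C openT) sj) s1.
have : normc (partial_form F (x + t *: delta_mx 0 j) -
    (t%:C * partial_form (pderiv (lshift d j) F) x + partial_form F x)) <= c * (`|t| * (e / (c + 1))).
  rewrite /partial_form -(form_lin lT _ sj s1) -(TgB s2 s3).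
  by apply: hT; [rewrite mulr_ge0// ltW|rewrite (toCinftyT (smooth_onB openT s2 s3))].
rewrite /dquo; move: (partial_form F x) (partial_form _ _) (partial_form _ _) => p q r hpq.
rewrite normcB (_ : _ - _ = (t^-1)%:C * (r - (t%:C * q + p))); last first.
  by rewrite !(mulrBr, mulrDr) mulrA -rmorphM mulVf// mul1r; ring.
rewrite normcM normcR normfV ler_pdivrMl ?normr_gt0//.
apply: le_trans hpq _; rewrite mulrCA ler_wpM2l//.
by rewrite mulrCA ler_piMr// ?ltW// ltr_pdivrMr// mul1r ltrDl.
Unshelve. all: by end_near. Qed.

Lemma regular_partial_form F x : smooth_on setT F -> regular (partial_form F) x.
Proof.
move=> sF; split; first exact: partial_form_cont.
by move=> j; apply: is_pdW; exact: is_pd_partial_form.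
Qed.

Lemma pderiv_partial_form F j : smooth_on setT F ->
  pderiv j (partial_form F) = partial_form (pderiv (lshift d j) F).
Proof. by move=> sF; apply/funext => x; apply: is_pdE; exact: is_pd_partial_form. Qed.

Lemma smooth_partial_form F : smooth_on setT F -> smooth_on setT (partial_form F).
Proof.
move=> sF; apply/(smooth_onP _ openT) => n; elim: n F sF => [|n IH] F sF;
  (split; first by move=> x _; exact: regular_partial_form) => // j.
by rewrite pderiv_partial_form//; apply: IH; exact: smooth_on_pderiv.
Qed.

Lemma pderivs_partial_form F s : smooth_on setT F ->
  pderivs s (partial_form F) = partial_form (pderivs (map (lshift d) s) F).
Proof.
move=> sF; elim: s => //= j s ->; rewrite pderiv_partial_form//.
exact: smooth_on_pderivs.
Qed.

End ParametricForms.

(** * The operators of a distribution supported in the dilations *)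

Section Multiplicative.
Context {R : realType} {d : nat}.
Local Notation C := R[i].
Local Notation V := 'rV[R]_d.
Local Notation E := (Cinfty [set: V]).
Implicit Types (f g : V -> C) (K L U W : set V) (al : {ffun 'I_d -> nat}).

Definition axis_of (l : 'I_(d + d)) : 'I_d :=
  match fintype.split l with inl j => j | inr j => j end.
(** The partial derivative of x_j y_j in one factor is the other factor. *)
Definition swap_half (l : 'I_(d + d)) : 'I_(d + d) :=
  match fintype.split l with inl j => rshift d j | inr j => lshift d j end.
Definition mulmap (z : 'rV[R]_(d + d)) : V := hmul (lsubmx z) (rsubmx z).

Lemma axis_mulmap : axis_map mulmap axis_of (fun l z => z 0 (swap_half l)).
Proof.
split.
- apply: continuous_row => j.
  rewrite (_ : (fun _ => _) = fun z : 'rV[R]_(d + d) => z 0 (lshift d j) * z 0 (rshift d j)).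
    move=> z; exact: (cvgM (@continuous_coord _ _ (lshift d j) z) (@continuous_coord _ _ (rshift d j) z)).
  by apply/funext => z; rewrite !mxE.
- by move=> l; exact: smooth_on_crd openT.
- move=> z l t; apply/rowP => i; rewrite !mxE /axis_of /swap_half eqxx /=.
  case: (split_ordP l) => j ->.
    by rewrite eq_lshift eq_rlshift /=; case: eqVneq => [->|_] /=; ring.
  by rewrite eq_rshift eq_lrshift /=; case: eqVneq => [->|_] /=; ring.
Qed.

Lemma mulmap_row x y : mulmap (row_mx x y) = hmul x y.
Proof. by rewrite /mulmap row_mxKl row_mxKr. Qed.

Lemma section_mulmap f x : section (f \o mulmap) x = (fun y => f (hmul x y)).
Proof. by apply/funext => y; rewrite /section /= mulmap_row. Qed.

Lemma smooth_mulmap f : smooth_on setT f -> smooth_on setT (f \o mulmap).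
Proof. by move=> sf; have := smooth_on_comp axis_mulmap openT sf. Qed.

Lemma pderivs_section (F : 'rV[R]_(d + d) -> C) s (x y : V) : smooth_on setT F ->
  pderivs s (section F x) y = pderivs (map (@rshift d d) s) F (row_mx x y).
Proof.
elim/last_ind: s F => [|s j IH] F sF //.
rewrite map_rcons !pderivs_rcons -IH; last exact: smooth_on_pderiv.
apply: (pderivs_eq_on s openT) (Logic.I : setT y) => z _.
exact: pderiv_section.
Qed.

Lemma rmono_hmul al (x y : V) : rmono al (hmul x y) = rmono al x * rmono al y.
Proof.
rewrite /rmono /mono -big_split; apply: eq_bigr => j _ /=.
by rewrite !mxE rmorphM exprMn.
Qed.

Lemma smooth_hmul Omega f x : open Omega -> smooth_on Omega f ->
  smooth_on [set y | Omega (hmul x y)] (fun y => f (hmul x y)).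
Proof. by move=> oO sf; have := smooth_on_comp (axis_hmul x) oO sf. Qed.

Lemma open_hmul Omega (x : V) : open Omega -> open [set y | Omega (hmul x y)].
Proof. by move=> oO; have := open_axis_preimage (axis_hmul x) oO. Qed.

Section Operator.
Variables (Omega : set V) (T : E -> C).
Hypothesis oO : open Omega.
Hypothesis lT : linear T.
Hypothesis cT : continuous T.
Hypothesis TO : dsupp T `<=` dilations Omega.
Local Notation Tg g := (T (toCinfty [set: V] g)).

Lemma dsupp_hmul x : Omega x -> dsupp T `<=` [set y | Omega (hmul x y)].
Proof. by move=> Ox y /TO h /=; rewrite hmulC; exact: h. Qed.

(** Near a compact subset K of Omega the operator only sees the values of f near the products of
    K with the support of T; there f may be replaced by a smooth function on the whole space. The
    set L adds further products on which f is kept. *)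
Lemma Mop_local f K L : smooth_on Omega f -> compact K -> K `<=` Omega -> compact L ->
  (forall x y, K x -> L y -> Omega (hmul x y)) ->
  exists F U N, [/\ smooth_on setT F, open U, open N, K `<=` N &
   [/\ (forall x y, K x -> L y -> U (hmul x y)), (forall x, U x -> F x = f x) &
    forall x, N x -> ev T (fun y => f (hmul x y)) = Tg (fun y => F (hmul x y))]].
Proof.
move=> sf cK KO cL KLO.
pose D := dsupp T `|` L.
have cD : compact D by apply: compactU => //; exact: dsupp_compact.
have sub : [set z | exists x y, [/\ K x, D y & z = hmul x y]] `<=` Omega.
  move=> _ [x [y [Kx [Ty|Ly] ->]]]; last exact: KLO.
  exact: (dsupp_hmul (KO x Kx) Ty).
have [chi [s1 [U [oU KU chi1]] s3 s4]] := cutoff (compact_hmul cK cD) oO sub.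
exists (chi * f), U, [set x | forall y, dsupp T y -> U (hmul y x)].
have sF := smooth_cutoff_mul oO s1 s4 sf.
have FU x : U x -> (chi * f) x = f x by move=> Ux; rewrite fctE chi1// mul1r.
split; [exact: sF|exact: oU| | |].
- by apply: open_hmul_compact oU; exact: dsupp_compact.
- move=> x Kx y Ty; apply: KU; exists x, y; split=> //; first by left.
  by rewrite hmulC.
- split=> //; first by move=> x y Kx Ly; apply: KU; exists x, y; split=> //; right.
  move=> x Nx; apply: (ev_eq_near lT cT (@open_hmul _ x oU)).
  + by move=> y Ty /=; rewrite hmulC; exact: Nx.
  + by move=> y Uy; exact: FU.
  + by have := @smooth_hmul _ _ x openT sF.
Qed.

Lemma partial_form_mulmap F x :
  partial_form T (F \o mulmap) x = Tg (fun y => F (hmul x y)).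
Proof. by rewrite /partial_form section_mulmap. Qed.

Lemma Mop_smooth f : smooth_on Omega f ->
  smooth_on Omega (fun x => ev T (fun y => f (hmul x y))).
Proof.
move=> sf; apply: smooth_on_local => x Ox.
have xO : [set x] `<=` Omega by move=> _ ->.
have [F [U [N [sF oU oN KN [_ _ hN]]]]] := @Mop_local f [set x] set0 sf (@compact_set1 _ x)
  xO (@compact0 _) (fun _ _ _ h => False_ind _ h).
exists N, (partial_form T (F \o mulmap)); split.
- by apply: open_nbhs_nbhs; split=> //; exact: KN.
- by move=> y Ny; rewrite partial_form_mulmap; exact: hN.
- have sp := smooth_partial_form lT cT (smooth_mulmap sF).
  exact: (smooth_on_sub (@subsetT _ N) sp).
Qed.

Lemma MopE (f : Cinfty Omega) x : Omega x -> Mop Omega T f x = ev T (fun y => f (hmul x y)).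
Proof. by move=> Ox; rewrite /Mop toCinftyE//; apply: Mop_smooth; exact: Cinfty_smooth. Qed.

Lemma Mop_linear : linear (Mop Omega T).
Proof.
move=> a f g; apply: Cinfty_eq => x Ox.
rewrite -[RHS]/(a * Mop Omega T f x + Mop Omega T g x) !MopE//.
have [L [k [c [_ _ _ _ h]]]] := ev_bounded lT cT (@open_hmul _ x oO) (dsupp_hmul Ox).
by rewrite -(h a _ _ (@smooth_hmul _ _ x oO (Cinfty_smooth f)) (@smooth_hmul _ _ x oO (Cinfty_smooth g))).
Qed.

(** Derivatives in x are taken under T, which is bounded by derivatives in y; both are
    derivatives of f(xy) on a compact set of pairs (x, y). *)
Lemma Mop_continuous : continuous (Mop Omega T).
Proof.
apply: (bounded_op_continuous oO oO Mop_linear) => K' k' cK' KO'.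
pose W := [set y : V | forall x, K' x -> Omega (hmul x y)].
have oW : open W by exact: open_hmul_compact.
have TW : dsupp T `<=` W by move=> y Ty x Kx; exact: (dsupp_hmul (KO' x Kx) Ty).
have [L [kL [c [cL LW c0 hc _]]]] := ev_bounded lT cT oW TW.
pose K2 := [set z : 'rV[R]_(d + d) | exists x y, [/\ K' x, L y & z = row_mx x y]].
have cK2 : compact K2.
  rewrite (_ : K2 = (fun p : V * V => row_mx p.1 p.2) @` (K' `*` L)).
    apply: continuous_compact; last exact: compact_setX.
    exact/continuous_subspaceT/continuous_row_mx.
  apply/seteqP; split=> [z [x [y [Kx Ly ->]]]|z [[x y] [/= Kx Ly] <-]].
    by exists (x, y).
  by exists x, y.
have [B B0 hB] := pb_comp axis_mulmap (k' + kL) cK2.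
pose K := [set z : V | exists x y, [/\ K' x, L y & z = hmul x y]].
exists K, (k' + kL)%N, (c * B); split.
- exact: compact_hmul.
- by move=> _ [x [y [Kx Ly ->]]]; exact: LW.
- exact: mulr_ge0.
- move=> f M M0 hf.
  have [F [U [N [sF oU oN KN [KLU FU hN]]]]] :=
    @Mop_local f K' L (Cinfty_smooth f) cK' KO' cL (fun x y Kx Ly => LW y Ly x Kx).
  pose Phi := F \o mulmap.
  have sPhi : smooth_on setT Phi := smooth_mulmap sF.
  have hPhi : pb K2 (k' + kL) Phi (B * M).
    have sub : mulmap @` K2 `<=` U.
      by move=> _ [_ [x [y [Kx Ly ->]]] <-]; rewrite mulmap_row; exact: KLU.
    apply: (hB setT F M openT sF (@subsetT _ _) M0).
    apply: (pb_eq_on oU sub (fun x Ux => esym (FU x Ux))).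
    apply: pb_subset hf => _ [_ [x [y [Kx Ly ->]]] <-].
    by rewrite mulmap_row; exists x, y.
  have MN y : (N `&` Omega) y -> Mop Omega T f y = partial_form T Phi y.
    by move=> [Ny Oy]; rewrite MopE// hN// partial_form_mulmap.
  move=> s sk x Kx.
  rewrite (pderivs_eq_on s (openI oN oO) MN (conj (KN x Kx) (KO' x Kx))).
  rewrite (pderivs_partial_form lT cT s sPhi) /partial_form.
  have sP2 := smooth_on_pderivs (map (lshift d) s) sPhi.
  have ss := smooth_section x sP2.
  rewrite -(ev_smooth lT cT ss) -mulrA.
  apply: hc; [exact: smooth_on_sub (@subsetT _ W) ss|exact: mulr_ge0|].
  move=> r rk y Ly; rewrite pderivs_section// -pderivs_cat.
  apply: hPhi; last by exists x, y.
  by rewrite size_cat !size_map addnC leq_add.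
Qed.

Lemma momentE al : moment T al = Tg (rmono al).
Proof. by rewrite /moment (ev_smooth lT cT)//; exact: smooth_rmono openT. Qed.

Lemma Mop_rmono al :
  Mop Omega T (toCinfty Omega (rmono al)) = moment T al *: toCinfty Omega (rmono al).
Proof.
have sr := @smooth_rmono R d Omega al oO; have srT := @smooth_rmono R d setT al openT.
apply: Cinfty_eq => x Ox.
transitivity (moment T al * toCinfty Omega (rmono al) x); last by [].
rewrite (MopE _ Ox) (toCinftyE oO sr Ox) momentE.
have s2 : smooth_on setT (fun y => rmono al x * rmono al y + (fun=> 0) y).
  exact: (smooth_onD openT (smooth_onM openT (smooth_on_cst _ openT) srT) (smooth_on_cst 0 openT)).
rewrite (@ev_eq_near _ _ _ lT cT _ _ _ (@open_hmul _ x oO) (dsupp_hmul Ox) _ s2).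
  rewrite (form_lin lT _ srT (smooth_on_cst 0 openT)) [X in _ + X](_ : _ = 0).
    by rewrite addr0 mulrC.
  rewrite (_ : toCinfty _ _ = 0) ?(form0 lT)//; apply: Cinfty_eq => y _.
  by rewrite (toCinftyT (smooth_on_cst 0 openT)).
by move=> y Oy; rewrite addr0 (toCinftyE oO sr Oy) rmono_hmul.
Qed.

End Operator.
End Multiplicative.

(** * Moments determine the form *)

Section Uniqueness.
Context {R : realType} {d : nat}.
Local Notation C := R[i].
Local Notation V := 'rV[R]_d.
Local Notation E := (Cinfty [set: V]).

Lemma form_ext (T S : E -> C) : linear T -> continuous T -> linear S -> continuous S ->
  (forall al, moment T al = moment S al) -> T = S.
Proof.
move=> lT cT lS cS TS; apply/funext => f; apply/subr0_eq.
pose D f := T f - S f.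
have lD : linear D.
  by move=> a u v; rewrite /D lT lS scalerBr addrACA opprD.
have cD : continuous D by move=> u; exact: (cvgB (cT u) (cS u)).
apply: (form_vanish lD cD) => al.
by have := TS al; rewrite (momentE lT cT) (momentE lS cS) /D => ->; rewrite subrr.
Qed.

Lemma cdistr_lin (A : set V) (a : C) (T S : E -> C) : cdistr A T -> cdistr A S ->
  cdistr A (a *: T + S) /\ forall al, moment (a *: T + S) al = a * moment T al + moment S al.
Proof.
move=> [lT cT _ TA] [lS cS _ SA].
have lD : linear (a *: T + S).
  move=> b u v; rewrite !fctE lT lS !scalerDr !scalerA mulrC.
  by rewrite addrACA.
have cD : continuous (a *: T + S).
  by move=> u; exact: (cvgD (cvgM (cvg_cst a) (cT u)) (cS u)).
split; last by move=> al; rewrite (momentE lD cD) (momentE lT cT) (momentE lS cS).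
split; [exact: lD|exact: cD|exact: dsupp_compact lD cD|].
move=> x Dx.
have [Tx|Tx] := pselect (dsupp T x); first exact: TA.
have [Sx|Sx] := pselect (dsupp S x); first exact: SA.
exfalso.
have [W [Wx hT hS]] : exists W, [/\ nbhs x W,
   (forall phi : E, compact (fsupp phi) -> fsupp phi `<=` W -> T phi = 0) &
   (forall phi : E, compact (fsupp phi) -> fsupp phi `<=` W -> S phi = 0)].
  have [W1 W1x h1] := notin_dsupp Tx; have [W2 W2x h2] := notin_dsupp Sx.
  exists (W1 `&` W2); split; first exact: filterI.
    by move=> phi c1 c2; apply: h1 => // y /c2[].
  by move=> phi c1 c2; apply: h2 => // y /c2[].
have [phi [c1 c2 /eqP]] := Dx W Wx; apply.
by rewrite !fctE hT// hS// scaler0 addr0.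
Qed.

Lemma dilationsT : dilations [set: V] = setT.
Proof. by apply/seteqP; split. Qed.

(** On the whole space, T star S is T composed with the operator of S. *)
Lemma starE (T S : E -> C) : linear T -> continuous T -> linear S -> continuous S ->
  star T S = T \o Mop setT S.
Proof.
move=> lT cT lS cS; apply/funext => f /=.
have ST : dsupp S `<=` dilations [set: V] by rewrite dilationsT; exact: subsetT.
have -> : star T S f = ev T (Mop setT S f).
  rewrite /star; congr (ev T _); apply/funext => x.
  by rewrite (MopE openT lS cS ST).
exact: ev_E.
Qed.

(** The operator of S multiplies the monomials by the moments of S. *)
Lemma star_form (T S : E -> C) : linear T -> continuous T -> linear S -> continuous S ->
  [/\ linear (star T S), continuous (star T S) &
   forall al, moment (star T S) al = moment T al * moment S al].
Proof.
move=> lT cT lS cS.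
have ST : dsupp S `<=` dilations [set: V] by rewrite dilationsT; exact: subsetT.
have lM := Mop_linear openT lS cS ST; have cM := Mop_continuous openT lS cS ST.
have E0 := starE lT cT lS cS.
have l1 : linear (star T S) by rewrite E0 => a u v /=; rewrite lM lT.
have c1 : continuous (star T S).
  by rewrite E0 => u; exact: (cvg_comp _ _ (cM u) (cT _)).
split; [exact: l1|exact: c1|move=> al].
rewrite (momentE l1 c1) (momentE lT cT) E0 /= (Mop_rmono openT lS cS ST).
have TZ (a : C) (f : E) : T (a *: f) = a * T f by have := lT a f 0; rewrite (form0 lT) !addr0.
by rewrite TZ mulrC.
Qed.

End Uniqueness.

(** * Hadamard operators *)

Section HadamardOperators.
Context {R : realType} {d : nat}.
Local Notation C := R[i].
Local Notation V := 'rV[R]_d.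
Local Notation E := (Cinfty [set: V]).
Variable Omega : set V.
Hypothesis oO : open Omega.
Hypothesis O0 : Omega !=set0.
Implicit Types (f g : V -> C) (K U W : set V) (L : Cinfty Omega -> Cinfty Omega) (al : {ffun 'I_d -> nat}).
Local Notation op := (Cinfty Omega -> Cinfty Omega).
Local Notation mon al := (toCinfty Omega (rmono al)).

(** Points at which no monomial vanishes; multiplication by them is invertible. *)
Definition regular_pt (x : V) := forall j, x 0 j != 0.

Lemma near_regular_pt (x : V) W : nbhs x W -> exists2 y, W y & regular_pt y.
Proof.
move=> /nbhs_boxP[r r0 rW].
exists (\row_j (if x 0 j == 0 then r / 2 else x 0 j)).
  apply: rW => j; rewrite mxE; case: eqP => [->|_].
    by rewrite subr0 gtr0_norm ?divr_gt0// ltr_pdivrMr// ltr_pMr// ltr1n.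
  by rewrite subrr normr0.
by move=> j; rewrite mxE; case: ifPn => // _; rewrite gt_eqF// divr_gt0.
Qed.

Lemma rmono_neq0 al x : regular_pt x -> rmono al x != 0.
Proof.
move=> rx; rewrite /rmono /mono; apply/prodf_neq0 => j _.
by rewrite expf_neq0// mxE (inj_eq (@complexI R) _ 0); exact: rx.
Qed.

Lemma exists_regular_pt : exists2 x, Omega x & regular_pt x.
Proof. by case: O0 => x Ox; exact: (near_regular_pt (open_nbhs_nbhs (conj oO Ox))). Qed.

Definition hinv (x : V) : V := \row_j (x 0 j)^-1.

Lemma hmul_hinvr x y : regular_pt x -> hmul x (hmul (hinv x) y) = y.
Proof. by move=> rx; apply/rowP => j; rewrite !mxE mulrA mulfV ?(rx j) ?mul1r//. Qed.

(** The value at x of L applied to the dilated function g(a .); with a = 1/x this is the form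
    that represents L. *)
Definition form_at (a x : V) (L : op) : E -> C :=
  fun g : E => L (toCinfty Omega (fun y => g (hmul a y))) x.

Lemma smooth_dilate (a : V) g : smooth_on setT g -> smooth_on Omega (fun y => g (hmul a y)).
Proof.
move=> sg; have := smooth_on_comp (axis_hmul a) openT sg.
exact: smooth_on_sub (@subsetT _ Omega).
Qed.

Section FormAt.
Variables (a x : V) (L : op).
Hypothesis Ox : Omega x.
Hypothesis lL : linear L.
Hypothesis cL : continuous L.

Lemma op_bounded_at : exists K k (c : R), [/\ compact K, K `<=` Omega, 0 <= c &
  forall (f : Cinfty Omega) M, 0 <= M -> pb K k f M -> normc (L f x) <= c * M].
Proof.
have xO : [set x] `<=` Omega by move=> _ ->.
have [K [k [c [cK KO c0 h]]]] := continuous_op_bounded oO oO 0 lL cL (@compact_set1 _ x) xO.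
exists K, k, c; split=> // f M M0 hf.
by have := (pb0P _ _ _).1 (h f M M0 hf) x erefl.
Qed.

Lemma form_at_linear : linear (form_at a x L).
Proof.
move=> b u v; rewrite /form_at.
have := toCinfty_lin oO b (smooth_dilate a (Cinfty_smooth u)) (smooth_dilate a (Cinfty_smooth v)).
move=> h; transitivity (L (b *: toCinfty Omega (fun y => u (hmul a y)) +
   toCinfty Omega (fun y => v (hmul a y))) x); last by rewrite lL.
by rewrite -h.
Qed.

Lemma form_at_continuous : continuous (form_at a x L).
Proof.
have [K [k [c [cK KO c0 h]]]] := op_bounded_at.
have [B B0 hB] := pb_comp (axis_hmul a) k cK.
have cKa : compact (hmul a @` K).
  apply: continuous_compact; last exact: cK.
  by apply: continuous_subspaceT => y; exact: continuous_hmulr.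
apply: (@bounded_form_continuous _ _ _ openT _ _ k _ form_at_linear cKa (@subsetT _ _) (mulr_ge0 c0 B0)).
move=> g M M0 hg; rewrite /form_at -mulrA; apply: h; first exact: mulr_ge0.
have sg := smooth_dilate a (Cinfty_smooth g).
apply: (@pb_eq_on _ _ Omega K k _ _ _ oO KO (fun y Oy => esym (toCinftyE oO sg Oy))).
exact: (hB setT g M openT (Cinfty_smooth g) (@subsetT _ _) M0 hg).
Qed.

End FormAt.

(** The value of L f at x depends on f only near a compact subset of Omega, so f may be replaced by
    a smooth function on the whole space, where the polynomials are dense. *)
Lemma op_ext (L1 L2 : op) : linear L1 -> continuous L1 -> linear L2 -> continuous L2 ->
  (forall al, L1 (mon al) = L2 (mon al)) -> L1 = L2.
Proof.
move=> l1 c1 l2 c2 h12; apply/funext => f; apply: Cinfty_eq => x Ox.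
pose one : V := const_mx 1.
have onem y : hmul one y = y by apply/rowP => j; rewrite !mxE mul1r.
have e12 : form_at one x L1 = form_at one x L2.
  have lf1 := @form_at_linear one x L1 l1; have cf1 := @form_at_continuous one x L1 Ox l1 c1.
  have lf2 := @form_at_linear one x L2 l2; have cf2 := @form_at_continuous one x L2 Ox l2 c2.
  apply: (form_ext lf1 cf1 lf2 cf2) => al.
  rewrite (momentE lf1 cf1) (momentE lf2 cf2) /form_at.
  have -> : (fun y => toCinfty [set: V] (rmono al) (hmul one y)) = rmono al.
    by apply/funext => y; rewrite onem (toCinftyT (@smooth_rmono R d setT al openT)).
  by rewrite h12.
have [K1 [k1 [b1 [cK1 KO1 b10 hb1]]]] := @op_bounded_at x L1 Ox l1 c1.
have [K2 [k2 [b2 [cK2 KO2 b20 hb2]]]] := @op_bounded_at x L2 Ox l2 c2.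
have KO : K1 `|` K2 `<=` Omega by move=> y [/KO1|/KO2].
have [chi [s1 [U [oU KU chi1]] s3 s4]] := cutoff (compactU cK1 cK2) oO KO.
have sF := smooth_cutoff_mul oO s1 s4 (Cinfty_smooth f).
pose F := toCinfty [set: V] (chi * f).
have FE : F = chi * f :> (V -> C) by exact: toCinftyT.
pose G := toCinfty Omega (fun y => F (hmul one y)).
have GE y : Omega y -> G y = (chi * f) y.
  move=> Oy; rewrite /G (toCinftyE oO (smooth_dilate one (Cinfty_smooth F)) Oy).
  by rewrite onem FE.
have GF (L : op) K k c : linear L -> K `<=` K1 `|` K2 ->
  (forall (f : Cinfty Omega) M, 0 <= M -> pb K k f M -> normc (L f x) <= c * M) -> L f x = L G x.
  move=> lL KK hL.
  have E0 : L (-1 *: G + f) x = L f x - L G x.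
    by rewrite lL scaleN1r addrC.
  apply/subr0_eq; rewrite -E0; apply: normc_le0; rewrite -[leRHS](mulr0 c).
  apply: hL => //; apply: (@pb_vanish _ _ (U `&` Omega)) => //.
  - exact: openI.
  - by move=> y /KK Ky; split; [exact: KU|exact: KO].
  - move=> y [Uy Oy]; transitivity (-1 * G y + f y); first by [].
    by rewrite GE// fctE chi1// mul1r mulN1r addNr.
rewrite (GF L1 K1 k1 b1 l1 (@subsetUl _ _ _) hb1) (GF L2 K2 k2 b2 l2 (@subsetUr _ _ _) hb2).
by have := congr1 (fun Q : E -> C => Q F) e12.
Qed.

Lemma Mop_hadamard T : cdistr (dilations Omega) T -> hadamard_ops Omega (Mop Omega T).
Proof.
move=> [lT cT _ TO]; split; [exact: Mop_linear|exact: Mop_continuous|move=> al].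
by exists (moment T al); exact: Mop_rmono.
Qed.

Lemma mon_inj al (a b : C) : a *: mon al = b *: mon al -> a = b.
Proof.
have [x Ox rx] := exists_regular_pt.
move=> /(congr1 (fun f : Cinfty Omega => f x)) h.
have {}h : a * mon al x = b * mon al x by exact: h.
rewrite (toCinftyE oO (@smooth_rmono R d Omega al oO) Ox) in h.
exact: mulIf (rmono_neq0 al rx) _ _ h.
Qed.

Lemma form_at_moment L x al (m : C) : Omega x -> regular_pt x -> linear L -> continuous L ->
  L (mon al) = m *: mon al -> moment (form_at (hinv x) x L) al = m.
Proof.
move=> Ox rx lL cL hm.
have lf := @form_at_linear (hinv x) x L lL.
have cf := @form_at_continuous (hinv x) x L Ox lL cL.
rewrite (momentE lf cf) /form_at.
have sr := @smooth_rmono R d Omega al oO.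
have LZ (b : C) (f : Cinfty Omega) : L (b *: f) = b *: L f.
  have L0 : L 0 = 0 by have := lL (-1) 0 0; rewrite scaler0 addr0 scaleN1r addNr.
  by have := lL b f 0; rewrite L0 !addr0.
rewrite (_ : toCinfty _ _ = rmono al (hinv x) *: mon al).
  rewrite LZ hm.
  transitivity (rmono al (hinv x) * (m * mon al x)); first by [].
  rewrite (toCinftyE oO sr Ox) mulrCA -rmono_hmul.
  rewrite (_ : hmul _ _ = const_mx 1); last by apply/rowP => j; rewrite !mxE mulVf ?(rx j).
  rewrite (_ : rmono _ _ = 1) ?mulr1// /rmono /mono big1// => j _.
  by rewrite !mxE expr1n.
have srT := @smooth_rmono R d setT al openT.
apply: Cinfty_eq => y Oy.
transitivity (rmono al (hinv x) * mon al y); last by [].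
rewrite (toCinftyE oO (smooth_dilate (hinv x) (Cinfty_smooth (toCinfty [set: V] (rmono al)))) Oy).
by rewrite (toCinftyE oO sr Oy) (toCinftyT srT) rmono_hmul.
Qed.

(** The support of T lies in x^-1 K for every point x of Omega with nonzero coordinates, where
    K bounds L on a neighbourhood of x; as K is closed, this passes to all points of Omega. *)
Lemma hadamard_representation L : hadamard_ops Omega L ->
  exists2 T, cdistr (dilations Omega) T & Mop Omega T = L.
Proof.
move=> [lL cL eL].
have [x0 Ox0 rx0] := exists_regular_pt.
pose T := form_at (hinv x0) x0 L.
have lT : linear T := @form_at_linear (hinv x0) x0 L lL.
have cT : continuous T := @form_at_continuous (hinv x0) x0 L Ox0 lL cL.
have TE x : Omega x -> regular_pt x -> T = form_at (hinv x) x L.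
  move=> Ox rx.
  have lf := @form_at_linear (hinv x) x L lL.
  have cf := @form_at_continuous (hinv x) x L Ox lL cL.
  apply: (form_ext lT cT lf cf) => al; have [m hm] := eL al.
  by rewrite !(form_at_moment _ _ lL cL hm).
have TO : dsupp T `<=` dilations Omega.
  move=> y Ty x Ox.
  have [r r0 rO] : exists2 r, 0 < r & cube x r `<=` Omega.
    have [r r0 h] := (nbhs_boxP _ _).1 (open_nbhs_nbhs (conj oO Ox)).
    exists (r / 2); first by rewrite divr_gt0.
    by move=> z hz; apply: h => j; apply: le_lt_trans (hz j) _; rewrite ltr_pdivrMr// ltr_pMr// ltr1n.
  have [K [k [c [cK KO c0 h]]]] := continuous_op_bounded oO oO 0 lL cL (@compact_cube _ _ x r) rO.
  have Kcl : closed K by apply: compact_closed cK; exact: hausdorffV.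
  (* K bounds L on a whole cube around x, and points without zero coordinates are dense in it *)
  have claim x' : cube x r x' -> regular_pt x' -> K (hmul x' y).
    move=> x'r rx'; apply: contrapT => nK.
    have Ox' := rO _ x'r.
    have oW : open [set z | (~` K) (hmul x' z)].
      by apply: (@open_hmul _ _ (~` K) x'); exact: closed_openC.
    have [phi [_ sub /eqP]] := Ty _ (open_nbhs_nbhs (conj oW nK)); apply.
    rewrite (TE x' Ox' rx') /form_at.
    set G := toCinfty _ _.
    apply: normc_le0; rewrite -[leRHS](mulr0 c).
    apply: ((pb0P _ _ _).1 (h G 0 (lexx 0) _) x' x'r).
    have oF : open (~` fsupp phi) by apply: closed_openC; exact: fsupp_closed.
    have oP : open [set z | (~` fsupp phi) (hmul (hinv x') z)].
      exact: (@open_hmul _ _ (~` fsupp phi) (hinv x')).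
    apply: (@pb_vanish _ _ ([set z | (~` fsupp phi) (hmul (hinv x') z)] `&` Omega)) => //.
    - exact: openI.
    - move=> z Kz; split; last exact: KO.
      by move=> /sub /=; rewrite hmul_hinvr.
    - move=> z [nz Oz]; rewrite /G (toCinftyE oO (smooth_dilate _ (Cinfty_smooth phi)) Oz).
      exact: fsupp_out.
  rewrite hmulC; apply: KO; apply: contrapT => nK.
  have oW : open [set z | (~` K) (hmul y z)].
    by apply: (@open_hmul _ _ (~` K) y); exact: closed_openC.
  have nW : nbhs x [set z | (~` K) (hmul y z)].
    by apply: open_nbhs_nbhs; split=> //=; rewrite hmulC.
  have [z [zr zK] rz] := near_regular_pt (filterI (cube_nbhs x r0) nW).
  by apply: zK; rewrite hmulC; exact: claim.
exists T; first by split=> //; exact: dsupp_compact.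
apply: op_ext => //; first exact: Mop_linear.
  exact: Mop_continuous.
move=> al; have [m hm] := eL al.
by rewrite Mop_rmono// hm (form_at_moment Ox0 rx0 lL cL hm).
Qed.

Lemma comp_hadamard L1 L2 : hadamard_ops Omega L1 -> hadamard_ops Omega L2 ->
  hadamard_ops Omega (L1 \o L2).
Proof.
move=> [l1 c1 e1] [l2 c2 e2]; split.
- by move=> a u v /=; rewrite l2 l1.
- by move=> u; exact: (cvg_comp _ _ (c2 u) (c1 _)).
- move=> al; have [m1 h1] := e1 al; have [m2 h2] := e2 al; exists (m2 * m1).
  have L0 : L1 0 = 0 by have := l1 (-1) 0 0; rewrite scaler0 addr0 scaleN1r addNr.
  have := l1 m2 (mon al) 0; rewrite L0 !addr0 /= h2 => ->.
  by rewrite h1 scalerA.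
Qed.

(** T star S is the form that represents the composition of the operators of T and S: both have
    the same moments. This locates its support. *)
Lemma star_cdistr T S : cdistr (dilations Omega) T -> cdistr (dilations Omega) S ->
  cdistr (dilations Omega) (star T S) /\ forall al, moment (star T S) al = moment T al * moment S al.
Proof.
move=> hT hS; have [lT cT _ TO] := hT; have [lS cS _ SO] := hS.
have [ls cs ms] := star_form lT cT lS cS.
split=> //.
have [U hU UE] := hadamard_representation (comp_hadamard (Mop_hadamard hT) (Mop_hadamard hS)).
have [lU cU _ UO] := hU.
rewrite (_ : star T S = U)//; apply: form_ext => // al.
rewrite ms; apply: (@mon_inj al).
rewrite -(Mop_rmono oO lU cU UO) UE /= (Mop_rmono oO lS cS SO).
have lM := Mop_linear oO lT cT TO.
have M0 : Mop Omega T 0 = 0 by have := lM (-1) 0 0; rewrite scaler0 addr0 scaleN1r addNr.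
have := lM (moment S al) (mon al) 0; rewrite M0 !addr0 => ->.
by rewrite (Mop_rmono oO lT cT TO) scalerA mulrC.
Qed.

Lemma cdistr_ext T S : cdistr (dilations Omega) T -> cdistr (dilations Omega) S ->
  (forall al, moment T al = moment S al) -> T = S.
Proof. by move=> [lT cT _ _] [lS cS _ _] TS; exact: (form_ext lT cT lS cS TS). Qed.

Lemma hadamard_ops_lin (a : C) L1 L2 : hadamard_ops Omega L1 -> hadamard_ops Omega L2 ->
  hadamard_ops Omega (a *: L1 + L2).
Proof.
move=> [l1 c1 e1] [l2 c2 e2].
have l3 : linear (a *: L1 + L2).
  move=> b u v; rewrite !fctE l1 l2 !scalerDr !scalerA mulrC.
  by rewrite addrACA.
split=> //.
- apply: (bounded_op_continuous oO oO l3) => K' k' cK' KO'.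
  have [K1 [k1 [b1 [cK1 KO1 b10 hb1]]]] := continuous_op_bounded oO oO k' l1 c1 cK' KO'.
  have [K2 [k2 [b2 [cK2 KO2 b20 hb2]]]] := continuous_op_bounded oO oO k' l2 c2 cK' KO'.
  exists (K1 `|` K2), (maxn k1 k2), (normc a * b1 + b2); split.
  + exact: compactU.
  + by move=> x [/KO1|/KO2].
  + by rewrite addr_ge0// mulr_ge0// normc_ge0.
  + move=> f M M0 hf s sk x Kx.
    have p1 : pb K1 k1 f M by apply: pb_leK (leq_maxl _ _) _; apply: pb_subset hf; exact: subsetUl.
    have p2 : pb K2 k2 f M by apply: pb_leK (leq_maxr _ _) _; apply: pb_subset hf; exact: subsetUr.
    have -> : pderivs s ((a *: L1 + L2) f) x = a * pderivs s (L1 f) x + pderivs s (L2 f) x.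
      exact: (pderivs_Cinfty_lin oO a (L1 f) (L2 f) s (KO' x Kx)).
    apply: le_trans (le_normcD _ _) _; rewrite mulrDl normcM -mulrA.
    apply: lerD; last exact: (hb2 f M M0 p2 s sk x Kx).
    by apply: ler_wpM2l; [exact: normc_ge0|exact: (hb1 f M M0 p1 s sk x Kx)].
- move=> al; have [m1 h1] := e1 al; have [m2 h2] := e2 al; exists (a * m1 + m2).
  by rewrite !fctE h1 h2 scalerA scalerDl.
Qed.

Lemma id_hadamard : hadamard_ops Omega id.
Proof.
split; [by []|by move=> f; exact: cvg_id|move=> al].
by exists 1; rewrite scale1r.
Qed.

Lemma hadamard_ops_algebra : is_algebra eq (hadamard_ops Omega) (fun M N => M \o N).
Proof.
split.
- by move=> a u v; exact: hadamard_ops_lin.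
- by move=> u v; exact: comp_hadamard.
- by move=> u u' v v' _ _ _ _ -> ->.
- by [].
- by [].
- by move=> a u v w _ _ [lw _ _]; apply/funext => f /=; rewrite lw.
- by exists id; [exact: id_hadamard|].
Qed.

Lemma cdistr_unit : exists2 e, cdistr (dilations Omega) e & forall al, moment e al = 1.
Proof.
have [e he eE] := hadamard_representation id_hadamard.
exists e => // al; apply: (@mon_inj al); have [le ce _ eO] := he.
by rewrite -(Mop_rmono oO le ce eO) eE scale1r.
Qed.

Lemma cdistr_algebra : is_algebra eq (cdistr (dilations Omega)) star.
Proof.
split.
- by move=> a u v hu hv; exact: (cdistr_lin a hu hv).1.
- by move=> u v hu hv; exact: (star_cdistr hu hv).1.
- by move=> u u' v v' _ _ _ _ -> ->.
- move=> u v w hu hv hw.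
  have [h1 m1] := star_cdistr hv hw; have [h2 m2] := star_cdistr hu hv.
  have [h3 m3] := star_cdistr hu h1; have [h4 m4] := star_cdistr h2 hw.
  by apply: (cdistr_ext h3 h4) => al; rewrite m3 m1 m4 m2 mulrA.
- move=> a u v w hu hv hw.
  have [h1 m1] := cdistr_lin a hu hv; have [h2 m2] := star_cdistr hu hw.
  have [h3 m3] := star_cdistr hv hw; have [h4 m4] := star_cdistr h1 hw.
  have [h5 m5] := cdistr_lin a h2 h3.
  by apply: (cdistr_ext h4 h5) => al; rewrite m4 m1 m5 m2 m3 mulrDl mulrA.
- move=> a u v w hu hv hw.
  have [h1 m1] := cdistr_lin a hu hv; have [h2 m2] := star_cdistr hw hu.
  have [h3 m3] := star_cdistr hw hv; have [h4 m4] := star_cdistr hw h1.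
  have [h5 m5] := cdistr_lin a h2 h3.
  by apply: (cdistr_ext h4 h5) => al; rewrite m4 m1 m5 m2 m3 mulrDr mulrCA.
- have [e he me] := cdistr_unit; exists e => // u hu.
  have [h1 m1] := star_cdistr he hu; have [h2 m2] := star_cdistr hu he.
  by split; apply: cdistr_ext => // al; rewrite ?m1 ?m2 me ?mul1r ?mulr1.
Qed.

Lemma Mop_iso : algebra_iso (cdistr (dilations Omega)) star
  eq (hadamard_ops Omega) (fun M N => M \o N) (Mop Omega).
Proof.
split.
- exact: cdistr_algebra.
- exact: hadamard_ops_algebra.
- exact: Mop_hadamard.
- move=> a u v hu hv; have [h m] := cdistr_lin a hu hv.
  have [lh ch _ hO] := h; have [lu cu _ uO] := hu; have [lv cv _ vO] := hv.
  have [l3 c3 _] := hadamard_ops_lin a (Mop_hadamard hu) (Mop_hadamard hv).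
  apply: (op_ext (Mop_linear oO lh ch hO) (Mop_continuous oO lh ch hO) l3 c3) => al.
  rewrite (Mop_rmono oO lh ch hO) m !fctE (Mop_rmono oO lu cu uO) (Mop_rmono oO lv cv vO).
  by rewrite scalerA scalerDl.
- move=> u v hu hv; have [h m] := star_cdistr hu hv.
  have [lh ch _ hO] := h; have [lu cu _ uO] := hu; have [lv cv _ vO] := hv.
  have [l3 c3 _] := comp_hadamard (Mop_hadamard hu) (Mop_hadamard hv).
  apply: (op_ext (Mop_linear oO lh ch hO) (Mop_continuous oO lh ch hO) l3 c3) => al.
  have lM := Mop_linear oO lu cu uO.
  have M0 : Mop Omega u 0 = 0 by have := lM (-1) 0 0; rewrite scaler0 addr0 scaleN1r addNr.
  rewrite (Mop_rmono oO lh ch hO) m /= (Mop_rmono oO lv cv vO).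
  have := lM (moment v al) (mon al) 0; rewrite M0 !addr0 => ->.
  by rewrite (Mop_rmono oO lu cu uO) scalerA mulrC.
- move=> u v hu hv uv; apply: (cdistr_ext hu hv) => al; apply: (@mon_inj al).
  have [lu cu _ uO] := hu; have [lv cv _ vO] := hv.
  by rewrite -(Mop_rmono oO lu cu uO) uv (Mop_rmono oO lv cv vO).
- by move=> w hw; have [T hT TE] := hadamard_representation hw; exists T.
Qed.

End HadamardOperators.

#[local] Existing Instance summability.totally_filter.
Local Notation fsetT T := (finmap.finset_of (Phant T)).

(** * Unconditional summation *)

Section Unconditional.
Context {R : realType} (I : choiceType).
Local Notation C := R[i].
Implicit Types (x y : I -> C) (A B D : fsetT I).

Lemma partial_sumE x A : summability.partial_sum x A = \sum_(i <- finmap.enum_fset A) x i.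
Proof. by rewrite /summability.partial_sum [RHS]finmap.big_seq_fsetE. Qed.

Lemma uncond_cvgP x (l : C) :
  (summability.partial_sum x @ summability.totally --> l) <->
  forall e : R, 0 < e -> exists A, forall B, finmap.fsubset A B ->
    normc (l - \sum_(i <- finmap.enum_fset B) x i) < e.
Proof.
rewrite (@cvg_normcP _ _ _ (summability.totally_filter)).
split=> h e e0; have := h e e0.
  by move=> [A _ hA]; exists A => B AB; rewrite -partial_sumE; exact: (hA B AB).
by move=> [A hA]; exists A => // B AB; rewrite partial_sumE; exact: (hA B AB).
Qed.

Lemma uncond_cvg_lin (a : C) x y (l m : C) :
  (summability.partial_sum x @ summability.totally --> l) ->
  (summability.partial_sum y @ summability.totally --> m) ->
  (summability.partial_sum (fun i => a * x i + y i) @ summability.totally --> a * l + m).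
Proof.
move=> h1 h2.
rewrite (_ : summability.partial_sum _ = fun A =>
   a * summability.partial_sum x A + summability.partial_sum y A).
  exact: (cvgD (cvgM (cvg_cst a) h1) h2).
by apply/funext => A; rewrite !partial_sumE big_split mulr_sumr.
Qed.

Lemma uncond_cvg_unique x (l m : C) :
  (summability.partial_sum x @ summability.totally --> l) ->
  (summability.partial_sum x @ summability.totally --> m) -> l = m.
Proof.
move=> h1 h2; apply/subr0_eq/normc_le0/ler_addgt0Pl => e e0; rewrite addr0.
have e20 : 0 < e / 2 by rewrite divr_gt0.
have [A hA] := (uncond_cvgP _ _).1 h1 _ e20; have [B hB] := (uncond_cvgP _ _).1 h2 _ e20.
have h3 := hA _ (finmap.fsubsetUl A B); have h4 := hB _ (finmap.fsubsetUr A B).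
rewrite -(subrKA (\sum_(i <- finmap.enum_fset (finmap.fsetU A B)) x i)).
apply: le_trans (le_normcD _ _) _; rewrite [e]splitr; apply: lerD; first exact: ltW.
by rewrite normcB ltW.
Qed.

Lemma normc_sum (J : Type) (r : seq J) (P : pred J) (F : J -> C) :
  normc (\sum_(i <- r | P i) F i) <= \sum_(i <- r | P i) normc (F i).
Proof.
elim/big_rec2: _ => [|i u v _ h]; first by rewrite normc0.
by apply: le_trans (le_normcD _ _) _; rewrite lerD2l.
Qed.

Lemma fsub_mem A B : finmap.fsubset A B ->
  {subset finmap.enum_fset A <= finmap.enum_fset B}.
Proof. by move=> /finmap.fsubsetP. Qed.

Lemma sum_fsub (G : nmodType) A B (F : I -> G) : finmap.fsubset A B ->
  \sum_(i <- finmap.enum_fset B) F i = \sum_(i <- finmap.enum_fset A) F i +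
  \sum_(i <- finmap.enum_fset B | i \notin finmap.enum_fset A) F i.
Proof.
move=> /fsub_mem AB; rewrite (bigID (fun i => i \in finmap.enum_fset A)) /=; congr (_ + _).
rewrite -big_filter; apply: perm_big; apply: uniq_perm.
- by rewrite filter_uniq// finmap.fset_uniq.
- exact: finmap.fset_uniq.
- by move=> i; rewrite mem_filter andb_idr//; exact: AB.
Qed.

(** Unconditional convergence from the boundedness of the sums of absolute values over an
    exhausting sequence of finite sets, together with convergence along that sequence. *)
Lemma uncond_cvg_exhaustion x (l : C) (box : nat -> (fsetT I)) (M : R) :
  (forall n m, (n <= m)%N -> finmap.fsubset (box n) (box m)) ->
  (forall A, exists n, finmap.fsubset A (box n)) ->
  (forall n, \sum_(i <- finmap.enum_fset (box n)) normc (x i) <= M) ->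
  (forall e : R, 0 < e -> exists n, forall m, (n <= m)%N ->
     normc (l - \sum_(i <- finmap.enum_fset (box m)) x i) < e) ->
  summability.partial_sum x @ summability.totally --> l.
Proof.
move=> mono exh hM hl; apply/uncond_cvgP => e e0.
pose b n := \sum_(i <- finmap.enum_fset (box n)) normc (x i).
have e20 : 0 < e / 2 by rewrite divr_gt0.
have [n1 hn1] : exists n1, forall n, b n - b n1 <= e / 2.
  have sb : has_sup (range b).
    by split; [exists (b 0%N), 0%N|exists M => _ [n _ <-]; exact: hM].
  have [_ [n1 _ <-] hn1] := sup_adherent e20 sb.
  exists n1 => n; rewrite lerBlDr.
  have : b n <= sup (range b) by apply: sup_upper_bound => //; exists n.
  by move: hn1; lra.
have [n2 hn2] := hl _ e20.
pose N := maxn n1 n2.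
exists (box N) => A NA.
have [m Am] := exh A.
have Nm := finmap.fsubset_trans NA Am.
rewrite (sum_fsub _ NA) opprD addrA (lt_le_trans (le_lt_trans (le_normcD _ _) _) (lexx _))//.
rewrite [e]splitr normcN; apply: ltr_leD; first exact: hn2 (leq_maxr _ _).
apply: le_trans (normc_sum _ _ _) _.
have bN : b n1 <= b N.
  rewrite /b (sum_fsub _ (mono _ _ (leq_maxl n1 n2))) lerDl.
  by apply: sumr_ge0 => i _; exact: normc_ge0.
apply: le_trans (hn1 m).
have := sum_fsub (fun i => normc (x i)) Nm; rewrite -/(b m) -/(b N) => Em.
have : b m - b N <= b m - b n1 by rewrite lerD2l lerN2.
apply: le_trans; rewrite Em addrC addKr.
rewrite -big_filter -[leRHS]big_filter.
set s1 := [seq i <- finmap.enum_fset A | i \notin finmap.enum_fset (box N)].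
set s2 := [seq i <- finmap.enum_fset (box m) | i \notin finmap.enum_fset (box N)].
have sub : {subset s1 <= s2}.
  move=> i; rewrite !mem_filter => /andP[-> iA] /=.
  exact: (fsub_mem Am).
have u1 : uniq s1 by rewrite filter_uniq// finmap.fset_uniq.
have u2 : uniq s2 by rewrite filter_uniq// finmap.fset_uniq.
rewrite [leRHS](bigID (fun i => i \in s1)) /=.
have -> : \sum_(i <- s2 | i \in s1) normc (x i) = \sum_(i <- s1) normc (x i).
  rewrite -big_filter; apply: perm_big; apply: uniq_perm => //; first by rewrite filter_uniq.
  by move=> i; rewrite mem_filter andb_idr//; exact: sub.
by rewrite lerDl; apply: sumr_ge0 => i _; exact: normc_ge0.
Qed.

End Unconditional.

(** * Uniqueness of the coefficients of a power series *)

Section TaylorUniqueness.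
Context {R : realType} {d : nat}.
Local Notation C := R[i].
Local Notation I := {ffun 'I_d -> nat}.
Implicit Types (c : I -> C) (z : 'rV[C]_d) (al be : I).

Lemma mono_scale_coord (u : C) (j : 'I_d) z be :
  mono be (\row_i ((if i == j then u else 1) * z 0 i)) = u ^+ be j * mono be z.
Proof.
rewrite /mono (bigD1 j)//= [in RHS](bigD1 j)//= mxE eqxx exprMn mulrA.
congr (_ * _); apply: eq_bigr => i ij.
by rewrite mxE (negPf ij) mul1r.
Qed.

Definition null_on (r : R) c :=
  forall z, (forall j, normc (z 0 j) <= r) -> psums c z @ summability.totally --> (0 : C).

(** Averaging over z_j -> u z_j, where u^(2^n) = -1, keeps the exponents congruent to al_j modulo
    2^(n+1) among those congruent modulo 2^n. *)
Lemma null_on_double r c al (j : 'I_d) n : null_on r c ->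
  (forall be, c be != 0 -> be j = al j %[mod 2 ^ n]) ->
  null_on r (fun be => if be j == al j %[mod 2 ^ n.+1] then c be else 0).
Proof.
move=> hc cmod z zr.
have n0 : (0 < 2 ^ n)%N by rewrite expn_gt0.
pose u : C := (2 ^ n).-root (-1).
have un : u ^+ (2 ^ n) = -1 by rewrite /u rootCK.
have nu : normc u = 1.
  apply/eqP; rewrite -(@pexpr_eq1 _ _ (2 ^ n))// ?normc_ge0//.
  by rewrite -normcX un normcN normc1.
have u0 : u != 0 by rewrite -normc_eq0 nu oner_eq0.
pose z' := \row_i ((if i == j then u else 1) * z 0 i).
have z'r i : normc (z' 0 i) <= r.
  rewrite mxE normcM; case: ifP => _; rewrite ?nu ?normc1 mul1r; exact: zr.
pose a := u^-1 ^+ al j.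
have h := uncond_cvg_lin (a := a / 2) (hc z' z'r)
  (uncond_cvg_lin (a := - 1 / 2) (hc z zr) (hc z zr)).
rewrite !mulr0 !addr0 in h.
rewrite /psums (_ : (fun be => _) = (fun be => a / 2 * (c be * mono be z') +
   (- 1 / 2 * (c be * mono be z) + c be * mono be z))); first exact: h.
apply/funext => be; rewrite mono_scale_coord.
have [c0|c0] := eqVneq (c be) 0; first by rewrite c0 if_same !mul0r !mulr0 !addr0.
have ua : a * u ^+ be j = if be j == al j %[mod 2 ^ n.+1] then 1 else -1.
  rewrite /a exprVn; apply: (@mulfI _ (u ^+ al j)); first by rewrite expf_neq0.
  rewrite mulrA mulfV ?expf_neq0// mul1r.
  have := cmod be c0 => E.
  have uE m : u ^+ m = (-1) ^+ (m %/ 2 ^ n) * u ^+ (m %% 2 ^ n).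
    by rewrite -un -exprM mulnC -exprD -divn_eq.
  rewrite (uE (be j)) (uE (al j)) E mulrAC; congr (_ * _).
  have odE m : (m %% 2 ^ n.+1 = odd (m %/ 2 ^ n) * 2 ^ n + m %% 2 ^ n)%N.
    have Em : m = ((m %/ 2 ^ n)./2 * 2 ^ n.+1 + (odd (m %/ 2 ^ n) * 2 ^ n + m %% 2 ^ n))%N.
      rewrite {1}(divn_eq m (2 ^ n)) -{1}(odd_double_half (m %/ 2 ^ n)) -muln2 expnS.
      by rewrite mulnDl -mulnA addnA (addnC (odd _ * _)%N).
    rewrite {1}Em modnMDl modn_small//.
    rewrite expnS mul2n -addnn; apply: (@leq_ltn_trans (2 ^ n + m %% 2 ^ n)).
      by rewrite leq_add2r; case: odd; rewrite ?mul1n.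
    by rewrite ltn_add2l ltn_mod.
  rewrite (odE (be j)) (odE (al j)) E eqn_add2r eqn_pmul2r//.
  rewrite -signr_odd -[in RHS]signr_odd.
  by case: (odd (be j %/ _)); case: (odd (al j %/ _)); rewrite ?expr0 ?expr1 ?mulr1 ?mulrN1 ?opprK.
rewrite (_ : a / 2 * _ = (a * u ^+ be j) / 2 * (c be * mono be z)); last by ring.
by rewrite ua; case: ifP => _; field.
Qed.

Lemma null_on_mod r c al n : null_on r c ->
  null_on r (fun be => if [forall j, be j == al j %[mod 2 ^ n]] then c be else 0).
Proof.
move=> hc.
have one (j : 'I_d) c' : null_on r c' ->
    null_on r (fun be => if be j == al j %[mod 2 ^ n] then c' be else 0).
  move=> hc'; elim: n => [|n IH].
    rewrite (_ : (fun _ => _) = c')//; apply/funext => be.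
    by rewrite expn0 !modn1 eqxx.
  have := @null_on_double r _ al j n IH.
  rewrite (_ : (fun be => _) = (fun be => if be j == al j %[mod 2 ^ n.+1] then c' be else 0)).
    by apply=> be; case: ifP => [/eqP//|]; rewrite eqxx.
  apply/funext => be; case: ifP => // E; case: ifP => // /eqP E2.
  exfalso; move/eqP: E2; apply/negP; rewrite negbK.
  have D : (2 ^ n %| 2 ^ n.+1)%N by rewrite expnS dvdn_mull.
  by rewrite -(modn_dvdm (be j) D) -(modn_dvdm (al j) D) (eqP E).
have all_ (s : seq 'I_d) : null_on r (fun be => if all (fun j => be j == al j %[mod 2 ^ n]) s
     then c be else 0).
  elim: s => [|j s IH] //=.
  have := one j _ IH; congr (null_on _ _); apply/funext => be.
  by case: (be j == _ %[mod _]).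
have := all_ (enum 'I_d); congr (null_on _ _); apply/funext => be.
congr (if _ then _ else _); apply/allP/forallP => [h j|h j _]; last exact: h.
by apply: h; rewrite mem_enum.
Qed.

(** For large n the subseries of exponents congruent to al modulo 2^n meets a given finite set
    of exponents at most in al. Both that subseries and the full one sum to 0, so the term of
    index al is small. *)
Lemma null_on_zero r c : 0 < r -> null_on r c -> forall al, c al = 0.
Proof.
move=> r0 hc al.
pose z : 'rV[C]_d := const_mx r%:C.
have zr j : normc (z 0 j) <= r by rewrite mxE normcR gtr0_norm.
have mz : mono al z != 0.
  apply/prodf_neq0 => j _; rewrite mxE expf_neq0// (inj_eq (@complexI R) _ 0) gt_eqF//.
suff : c al * mono al z = 0 by move/eqP; rewrite mulf_eq0 (negPf mz) orbF => /eqP.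
apply: normc_le0; apply/ler_addgt0Pl => e e0; rewrite addr0.
have e30 : 0 < e / 3 by rewrite divr_gt0.
have [A0 hA0] := (uncond_cvgP _ _).1 (hc z zr) _ e30.
(* modulo 2^bd the exponents in A0 and al are determined by their residues *)
pose bd := (\max_(be <- al :: finmap.enum_fset A0) \max_j be j).+1.
have ltbd be j : be \in al :: finmap.enum_fset A0 -> (be j < 2 ^ bd)%N.
  move=> hbe; apply: leq_ltn_trans (ltn_expl bd (leqnn 2)); apply: leqW.
  rewrite (big_rem be)//= leq_max; apply/orP; left; exact: leq_bigmax.
pose P be := [forall j, be j == al j %[mod 2 ^ bd]].
have Pal be : be \in al :: finmap.enum_fset A0 -> P be -> be = al.
  move=> hbe /forallP h; apply/ffunP => j; have /eqP := h j.
  by rewrite !modn_small//; apply: ltbd; rewrite ?mem_head.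
have [A1 hA1] := (uncond_cvgP _ _).1 (null_on_mod al bd hc zr) _ e30.
pose A := finmap.fsetU A1 (finmap.fsetU A0 (finmap.fset1 al)).
have hA := hA1 A (finmap.fsubsetUl _ _).
have alA : al \in finmap.enum_fset A by rewrite !finmap.inE eqxx !orbT.
pose F be := c be * mono be z.
have E1 : \sum_(be <- finmap.enum_fset A) (if P be then c be else 0) * mono be z =
   F al + \sum_(be <- finmap.enum_fset A | P be && (be != al)) F be.
  rewrite (bigD1_seq al)//= ?finmap.fset_uniq//; congr (_ + _).
    by rewrite (_ : P al)//; apply/forallP.
  rewrite big_mkcond [RHS]big_mkcond; apply: eq_bigr => be _.
  by case: (P be); case: (be == al); rewrite //= mul0r.
pose D := [seq be <- finmap.enum_fset A | P be && (be != al)].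
have DA0 be : be \in D -> be \notin finmap.enum_fset A0.
  rewrite mem_filter => /andP[/andP[Pb ba] _]; apply/negP => hb.
  by move/eqP: ba; apply; apply: Pal; rewrite // inE hb orbT.
(* A0 and A0 with D are both beyond A0, so the sum over D is small *)
pose B := finmap.seq_fset tt (finmap.enum_fset A0 ++ D).
have uB : perm_eq (finmap.enum_fset B) (finmap.enum_fset A0 ++ D).
  apply: uniq_perm; first exact: finmap.fset_uniq.
    rewrite cat_uniq finmap.fset_uniq filter_uniq ?finmap.fset_uniq// andbT.
    by apply/hasPn => be /DA0.
  by move=> be; exact: finmap.seq_fsetE.
have hB : normc (\sum_(be <- finmap.enum_fset B) F be) < e / 3.
  have := hA0 B _; rewrite sub0r normcN; apply.
  by apply/finmap.fsubsetP => be hb; rewrite finmap.seq_fsetE mem_cat; apply/orP; left; exact: hb.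
have hA00 : normc (\sum_(be <- finmap.enum_fset A0) F be) < e / 3.
  by have := hA0 A0 (finmap.fsubset_refl _); rewrite sub0r normcN.
rewrite (perm_big _ uB) big_cat /= big_filter in hB.
rewrite sub0r normcN E1 in hA.
set S := (X in _ + X) in hA; set S0 := (X in normc X < _) in hA00.
rewrite -/S -/S0 in hB.
have -> : c al * mono al z = (F al + S) - (S0 + S) + S0 by rewrite /F; ring.
apply: le_trans (le_normcD _ _) _; apply: le_trans (lerD (le_normcD _ _) (lexx _)) _.
rewrite normcN; move: hA hB hA00; lra.
Qed.

End TaylorUniqueness.

Lemma ge0_ReE {R : realType} (e : R[i]) : 0 <= e -> e = (complex.Re e)%:C.
Proof. by rewrite lecE /=; case: e => x y /= /andP[/eqP -> _]. Qed.

(** * Submultiplicative derivative bounds *)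

Section SubmultiplicativeBound.
Context {R : realType} {d : nat}.
Local Notation C := R[i].
Local Notation V := 'rV[R]_d.
Variables (W L : set V) (k : nat).
Hypotheses (oW : open W) (LW : L `<=` W) (cL : compact L).
Implicit Types (f g u : V -> C) (M N : R).

Definition pb_scale : R := 2 ^+ k.
(** The factor 2^k of the Leibniz rule, absorbed in the bound, makes it submultiplicative. *)
Definition sub_bound f M : Prop := smooth_on W f /\ pb L k f (pb_scale^-1 * M).

Lemma pb_scale_gt0 : 0 < pb_scale. Proof. by rewrite /pb_scale exprn_gt0. Qed.
Lemma pb_scale_ge1 : 1 <= pb_scale. Proof. by rewrite /pb_scale exprn_ege1// ler1n. Qed.
Lemma pb_scaleV_ge0 M : 0 <= M -> 0 <= pb_scale^-1 * M.
Proof. by move=> M0; rewrite mulr_ge0// invr_ge0 ltW// pb_scale_gt0. Qed.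

Lemma sub_bound_le f M N : M <= N -> sub_bound f M -> sub_bound f N.
Proof.
move=> MN [sf h]; split=> //; apply: pb_leM h.
by rewrite ler_wpM2l// invr_ge0 ltW// pb_scale_gt0.
Qed.

Lemma sub_boundM f g M N : 0 <= M -> 0 <= N -> sub_bound f M -> sub_bound g N ->
  sub_bound (fun x => f x * g x) (M * N).
Proof.
move=> M0 N0 [sf hf] [sg hg]; split; first exact: smooth_onM oW sf sg.
rewrite (_ : pb_scale^-1 * (M * N) = 2 ^+ k * ((pb_scale^-1 * M) * (pb_scale^-1 * N))).
  exact: (pbM oW LW sf sg (pb_scaleV_ge0 M0) (pb_scaleV_ge0 N0) hf hg).
by rewrite -/pb_scale; field; rewrite gt_eqF// pb_scale_gt0.
Qed.

Lemma sub_boundD f g M N : sub_bound f M -> sub_bound g N ->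
  sub_bound (fun x => f x + g x) (M + N).
Proof.
move=> [sf hf] [sg hg]; split; first exact: smooth_onD oW sf sg.
by rewrite mulrDr; exact: pbD oW LW sf sg hf hg.
Qed.

Lemma sub_boundZ (a : C) f M : sub_bound f M -> sub_bound (fun x => a * f x) (normc a * M).
Proof.
move=> [sf hf]; split; first exact: smooth_onM oW (smooth_on_cst a oW) sf.
by rewrite mulrCA; exact: (pbZ a oW LW sf hf).
Qed.

Lemma pderivs_cst (a : C) s : (0 < size s)%N -> pderivs s (fun _ : V => a) = fun=> 0.
Proof.
case/lastP: s => // s j _; rewrite pderivs_rcons.
rewrite (_ : pderiv j _ = 0) ?pderivs0//.
by apply/funext => x; exact: is_pdE (is_pd_cst _ _ _).
Qed.

Lemma sub_bound_cst (a : C) : sub_bound (fun=> a) (pb_scale * normc a).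
Proof.
split; first exact: smooth_on_cst.
rewrite mulrA mulVf ?gt_eqF ?pb_scale_gt0// mul1r => -[|j s] _ x _ //.
by rewrite pderivs_cst// normc0 normc_ge0.
Qed.

Lemma sub_bound_prod (J : Type) (r : seq J) (F : J -> V -> C) (M : J -> R) :
  (forall i, 0 <= M i) -> (forall i, sub_bound (F i) (M i)) ->
  sub_bound (fun x => \prod_(i <- r) F i x) (pb_scale * \prod_(i <- r) M i).
Proof.
move=> M0 hF; elim: r => [|i r IH].
  rewrite big_nil (_ : (fun _ => _) = fun=> 1); last by apply/funext => x; rewrite big_nil.
  by have := sub_bound_cst 1; rewrite normc1.
rewrite big_cons (_ : (fun _ => _) = fun x => F i x * \prod_(i <- r) F i x); last first.
  by apply/funext => x; rewrite big_cons.
rewrite mulrCA; apply: sub_boundM => //.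
by rewrite mulr_ge0 ?(ltW pb_scale_gt0)//; apply: prodr_ge0 => l _; exact: M0.
Qed.

Lemma sub_boundX f M n : 0 <= M -> sub_bound f M -> sub_bound (fun x => f x ^+ n) (pb_scale * M ^+ n).
Proof.
move=> M0 hf.
rewrite (_ : (fun x => f x ^+ n) = fun x => \prod_(i <- iota 0 n) f x); last first.
  by apply/funext => x; rewrite big_const_seq count_predT size_iota iter_mulr_1.
rewrite (_ : M ^+ n = \prod_(i <- iota 0 n) M); last first.
  by rewrite big_const_seq count_predT size_iota iter_mulr_1.
exact: (@sub_bound_prod nat (iota 0 n) (fun=> f) (fun=> M) (fun=> M0) (fun=> hf)).
Qed.

Lemma sub_bound_lim f M : (forall e : R, 0 < e -> sub_bound f (M + e)) -> sub_bound f M.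
Proof.
move=> h; split; first by have [] := h 1 ltr01.
move=> s sk x Lx; apply/ler_addgt0Pr => e e0.
have Be : 0 < pb_scale * e by rewrite mulr_gt0// pb_scale_gt0.
have [_ h1] := h _ Be; apply: le_trans (h1 s sk x Lx) _.
by rewrite mulrDr mulrA mulVf ?gt_eqF ?pb_scale_gt0// mul1r.
Qed.

(** With v = 1/(1 - u), the identity v = 1 + u v turns a bound M for v into the bound
    2^k + M/2; iterated from any initial bound, this converges to 2 * 2^k. *)
Lemma sub_bound_geom u : sub_bound u (1 / 2) -> (forall x, W x -> 1 - u x != 0) ->
  sub_bound (fun x => (1 - u x)^-1) (2 * pb_scale).
Proof.
move=> hu u1.
have su : smooth_on W (fun x => 1 - u x).
  exact: (smooth_onB oW (smooth_on_cst 1 oW) hu.1).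
have sv : smooth_on W (fun x => (1 - u x)^-1) := smooth_onV oW u1 su.
have [M0 M00 hM0] := pb_exists k oW LW cL sv.
(* any finite bound will do *)
have start : sub_bound (fun x => (1 - u x)^-1) (2 * pb_scale + pb_scale * M0).
  apply: (@sub_bound_le _ (pb_scale * M0)).
    by rewrite lerDr mulr_ge0// ltW// pb_scale_gt0.
  by split=> //; rewrite mulrA mulVf ?mul1r// gt_eqF// pb_scale_gt0.
have BM : 0 <= pb_scale * M0 by rewrite mulr_ge0// ltW// pb_scale_gt0.
have key n : sub_bound (fun x => (1 - u x)^-1) (2 * pb_scale + pb_scale * M0 / 2 ^+ n).
  elim: n => [|n IH]; first by rewrite expr0 divr1.
  have p0 : 0 <= 2 * pb_scale + pb_scale * M0 / 2 ^+ n.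
    by rewrite addr_ge0// ?divr_ge0 ?exprn_ge0// mulr_ge0// ltW// pb_scale_gt0.
  have h1 := sub_boundD (sub_bound_cst 1) (sub_boundM (ltac:(lra) : 0 <= 1 / 2) p0 hu IH).
  have E : pb_scale * normc (1 : C) + 1 / 2 * (2 * pb_scale + pb_scale * M0 / 2 ^+ n) =
      2 * pb_scale + pb_scale * M0 / 2 ^+ n.+1.
    by rewrite normc1 exprS; field; rewrite expf_neq0.
  rewrite E in h1; have [_ h2] := h1; split=> //.
  apply: (pb_eq_on oW LW _ h2) => x Wx.
  by field; exact: u1.
apply: sub_bound_lim => e e0.
have [n hn] : exists n, pb_scale * M0 / 2 ^+ n <= e.
  exists (Num.trunc (pb_scale * M0 / e)).+1.
  set n := (Num.trunc _).+1.
  have h1 : pb_scale * M0 / e <= n%:R.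
    by apply/ltW; have /truncn_itv/andP[] : 0 <= pb_scale * M0 / e by rewrite divr_ge0// ltW.
  have h2 : (n%:R : R) <= 2 ^+ n by rewrite -natrX ler_nat ltnW// ltn_expl.
  rewrite ler_pdivrMr ?exprn_gt0// [e * _]mulrC -ler_pdivrMr//.
  exact: le_trans h1 h2.
by apply: sub_bound_le (key n); rewrite lerD2l.
Qed.

End SubmultiplicativeBound.

Lemma differentiable_remainder (K : numFieldType) (U W : normedModType K) (f : U -> W)
    (df : {linear U -> W}) x : continuous df ->
  (forall e : K, 0 < e -> \forall h \near (0 : U), `|f (h + x) - (f x + df h)| <= e * `|h|) ->
  differentiable f x.
Proof.
move=> cdf hdf.
have key : f \o shift x = cst (f x) + df +o_ (0 : U) id by apply/eqaddoP => e e0; exact: hdf.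
by apply/diff_locallyP; rewrite (diff_unique cdf key); split.
Qed.

Lemma coordC_le_norm {R : realType} {d : nat} (z : 'rV[R[i]]_d) j : `|z 0 j| <= `|z|.
Proof.
rewrite [leRHS]/Num.Def.normr /= mx_normE.
have := @le_bigmax _ _ _ (0%:nng : {nonneg R[i]})
  (fun ij : 'I_1 * 'I_d => `|z ij.1 ij.2|%:nng) (0, j).
exact.
Qed.

(** * The Hadamard transform near 0 *)

Section Transform.
Context {R : realType} {d : nat}.
Local Notation C := R[i].
Local Notation V := 'rV[R]_d.
Local Notation E := (Cinfty [set: V]).
Variable T : E -> C.
Hypothesis lT : linear T.
Hypothesis cT : continuous T.
Implicit Types (z h : 'rV[C]_d) (al : {ffun 'I_d -> nat}).

Definition open_cube (rho : R) : set V := [set xi | forall j, `|xi 0 j| < rho].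

Lemma open_open_cube rho : open (open_cube rho).
Proof.
rewrite openE => x hx.
have H : \forall y \near x, forall j : 'I_d, `|(y : V) 0 j| < rho.
  apply: (@filter_forall _ _ _ _ (nbhs_filter x)) => j.
  have cn : {for x, continuous (fun y : V => `|y 0 j|)}.
    exact: (cvg_comp _ _ (@continuous_coord _ _ j x) (@norm_continuous _ _ (x 0 j))).
  exact: (cn _ (@open_nbhs_nbhs _ _ [set t | t < rho] (conj (@open_lt _ rho) (hx j)))).
exact: H.
Qed.

Variables (rho : R) (L : set V) (k : nat) (c : R).
Hypotheses (rho0 : 0 < rho) (cL : compact L) (LW : L `<=` open_cube rho) (c0 : 0 <= c).
Hypothesis TW : dsupp T `<=` open_cube rho.
Local Notation W := (open_cube rho).
Hypothesis hb : forall (g : V -> C) M, smooth_on W g -> 0 <= M -> pb L k g M ->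
  normc (ev T g) <= c * M.
Hypothesis hl : forall (a : C) (f g : V -> C), smooth_on W f -> smooth_on W g ->
  ev T (fun x => a * f x + g x) = a * ev T f + ev T g.
Local Notation oW := (@open_open_cube rho).
Local Notation B := (pb_scale (R := R) k).
Local Notation SB := (sub_bound W L k).

Lemma ev_bound g M : 0 <= M -> SB g M -> normc (ev T g) <= c * M.
Proof.
move=> M0 [sg hg]; apply: le_trans (hb sg (pb_scaleV_ge0 k M0) hg) _.
rewrite ler_wpM2l// ler_piMl// invf_le1 ?pb_scale_gt0//; exact: pb_scale_ge1.
Qed.

Definition crd_bound : R := B * (rho + 1).
Lemma crd_bound_ge1 : 1 <= crd_bound.
Proof.
rewrite /crd_bound; apply: le_trans (pb_scale_ge1 k) _; apply: ler_peMr; first exact: ltW (pb_scale_gt0 k).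
by rewrite lerDr ltW.
Qed.
Lemma crd_bound_gt0 : 0 < crd_bound. Proof. exact: lt_le_trans ltr01 crd_bound_ge1. Qed.

Lemma sub_bound_crd j : SB (crd j) crd_bound.
Proof.
split; first exact: smooth_on_crd oW.
rewrite /crd_bound mulrA mulVf ?gt_eqF ?pb_scale_gt0// mul1r.
elim/last_ind => [_ x Lx|s i _ _ x Lx].
  rewrite -[pderivs _ _ _]/((x 0 j)%:C) normcR; apply: le_trans (ltW (LW Lx j)) _; by rewrite lerDl.
rewrite pderivs_rcons (_ : pderiv i (crd j) = fun=> (i == j)%:R); last first.
  by apply/funext => y; rewrite pderiv_crd.
case: s => [|i' s]; last by rewrite pderivs_cst// normc0 addr_ge0// ltW.
rewrite -[pderivs _ _ _]/((i == j)%:R : C).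
by case: (i == j); rewrite ?normc1 ?normc0 ?lerDr ?addr_ge0// ltW.
Qed.

(** For |z_j| at most this radius, z_j x_j has bound 1/2. *)
Definition conv_radius : R := (2 * crd_bound)^-1.
Lemma conv_radius_gt0 : 0 < conv_radius. Proof. by rewrite invr_gt0 mulr_gt0// crd_bound_gt0. Qed.

Definition small z := forall j, normc (z 0 j) <= conv_radius.

Lemma sub_bound_scaled_crd z j : small z -> SB (fun x => z 0 j * crd j x) (1 / 2).
Proof.
move=> zs; have hZ := sub_boundZ oW LW (z 0 j) (sub_bound_crd j).
apply: (sub_bound_le _ hZ).
  apply: (@le_trans _ _ (conv_radius * crd_bound)); first by rewrite ler_pM2r ?crd_bound_gt0.
  by rewrite /conv_radius le_eqVlt; apply/orP; left; apply/eqP; field; rewrite gt_eqF// crd_bound_gt0.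
Qed.

Lemma coord_lt1 z j x : small z -> W x -> 1 - z 0 j * crd j x != 0.
Proof.
move=> zs Wx; apply/eqP => /subr0_eq E1.
have := congr1 (@ComplexField.Normc.normc R) E1; rewrite normc1 normcM normcR => E2.
have : (1 : R) <= conv_radius * rho.
  rewrite E2; apply: ler_pM; [exact: normc_ge0|by []|exact: zs|exact: ltW (Wx j)].
move=> h; suff : conv_radius * rho < 1 by rewrite ltNge h.
have r2 : 0 < 2 * crd_bound by rewrite mulr_gt0// crd_bound_gt0.
rewrite /conv_radius [_ * rho]mulrC (ltr_pdivrMr _ _ r2) mul1r.
have : rho <= crd_bound.
  rewrite /crd_bound; apply: le_trans (_ : 1 * (rho + 1) <= _); first by rewrite mul1r lerDl.
  by rewrite ler_wpM2r ?pb_scale_ge1// addr_ge0// ltW.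
have := crd_bound_gt0; lra.
Qed.

Definition gfactor z j (x : V) : C := (1 - z 0 j * crd j x)^-1.
Definition hkernel z (x : V) : C := \prod_j gfactor z j x.

Lemma sub_bound_gfactor z j : small z -> SB (gfactor z j) (2 * B).
Proof.
move=> zs; apply: (sub_bound_geom oW LW cL (sub_bound_scaled_crd j zs)) => x Wx.
exact: coord_lt1.
Qed.

Lemma hadamard_transformE z : hadamard_transform T z = ev T (hkernel z).
Proof.
rewrite /hadamard_transform; congr (ev T _); apply/funext => xi.
by apply: eq_bigr => j _; rewrite /gfactor mulrC.
Qed.

Lemma small_hadamardW z : small z -> hadamardW (dsupp T) z.
Proof.
move=> zs x Tx j; have := coord_lt1 j zs (TW Tx).
by rewrite subr_eq0 eq_sym mulrC.
Qed.

Lemma moment_bound al : normc (moment T al) <= c * (B * (B ^+ d * \prod_j crd_bound ^+ al j)).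
Proof.
have h : SB (rmono al) (B * \prod_j (B * crd_bound ^+ al j)).
  rewrite (_ : rmono al = fun x => \prod_j crd j x ^+ al j).
    apply: (@sub_bound_prod _ _ W L k oW LW 'I_d (index_enum 'I_d)
       (fun j x => crd j x ^+ al j) (fun j => B * crd_bound ^+ al j)) => j.
      by rewrite mulr_ge0 ?exprn_ge0 ?ltW ?pb_scale_gt0 ?crd_bound_gt0.
    by apply: (sub_boundX oW LW); [exact: ltW crd_bound_gt0|exact: sub_bound_crd].
  by apply/funext => x; rewrite /rmono /mono; apply: eq_bigr => j _; rewrite mxE.
rewrite big_split /= prodr_const card_ord in h.
apply: ev_bound h.
have B0 : 0 <= B := ltW (pb_scale_gt0 k).
rewrite mulr_ge0// mulr_ge0 ?exprn_ge0//; apply: prodr_ge0 => j _.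
by rewrite exprn_ge0// ltW// crd_bound_gt0.
Qed.

(** Multi-indices with entries below n, as functions on the finite type of their values. *)
Definition emb n (f : {ffun 'I_d -> 'I_n}) : {ffun 'I_d -> nat} := [ffun j => val (f j)].

Lemma emb_inj n : injective (@emb n).
Proof.
move=> f g fg; apply/ffunP => j; apply: val_inj.
by have := congr1 (fun u : {ffun 'I_d -> nat} => u j) fg; rewrite !ffunE.
Qed.

Definition box n : finmap.finset_of (Phant {ffun 'I_d -> nat}) :=
  finmap.seq_fset tt [seq emb f | f <- index_enum {ffun 'I_d -> 'I_n}].

Lemma mem_box n al : (al \in finmap.enum_fset (box n)) = [forall j, (al j < n)%N].
Proof.
have -> : (al \in finmap.enum_fset (box n)) =
   (al \in [seq emb f | f <- index_enum {ffun 'I_d -> 'I_n}]) by exact: (finmap.seq_fsetE tt _ al).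
apply/mapP/forallP => [[f _ ->] j|h]; first by rewrite ffunE; exact: ltn_ord.
exists [ffun j => Ordinal (h j)]; first by rewrite mem_index_enum.
by apply/ffunP => j; rewrite !ffunE.
Qed.

Lemma sum_box (G : nmodType) n (F : {ffun 'I_d -> nat} -> G) :
  \sum_(al <- finmap.enum_fset (box n)) F al = \sum_(f : {ffun 'I_d -> 'I_n}) F (emb f).
Proof.
rewrite -(big_map (@emb n) predT F); apply: perm_big; apply: uniq_perm.
- exact: finmap.fset_uniq.
- rewrite map_inj_uniq ?index_enum_uniq//; exact: emb_inj.
- by move=> al; exact: (finmap.seq_fsetE tt _ al).
Qed.

Lemma box_mono n m : (n <= m)%N -> finmap.fsubset (box n) (box m).
Proof.
move=> nm; apply/finmap.fsubsetP => al h.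
have := h : al \in finmap.enum_fset (box n); rewrite mem_box => /forallP h1.
suff : al \in finmap.enum_fset (box m) by [].
by rewrite mem_box; apply/forallP => j; exact: leq_trans (h1 j) nm.
Qed.

Lemma box_exhaust (A : finmap.finset_of (Phant {ffun 'I_d -> nat})) :
  exists n, finmap.fsubset A (box n).
Proof.
exists (\max_(be <- finmap.enum_fset A) \max_j be j).+1; apply/finmap.fsubsetP => be hbe.
have {}hbe : be \in finmap.enum_fset A by [].
suff : be \in finmap.enum_fset (box (\max_(be <- finmap.enum_fset A) \max_j be j).+1) by [].
rewrite mem_box; apply/forallP => j; rewrite ltnS (big_rem be)//= leq_max.
by apply/orP; left; exact: leq_bigmax.
Qed.

Lemma geom_half_le n : \sum_(i < n) (1 / 2 : R) ^+ i <= 2.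
Proof.
suff : \sum_(i < n) (1 / 2 : R) ^+ i = 2 - 2 * (1 / 2) ^+ n.
  by move=> ->; rewrite lerBlDr lerDl mulr_ge0// exprn_ge0//; lra.
elim: n => [|n IH]; first by rewrite big_ord0 expr0; lra.
by rewrite big_ord_recr /= IH exprS; field.
Qed.

Lemma normc_mono al z : normc (mono al z) = \prod_j normc (z 0 j) ^+ al j.
Proof.
rewrite /mono; elim/big_rec2: _ => [|j u v _ <-]; first by rewrite normc1.
by rewrite normcM normcX.
Qed.

Lemma ev_sum (J : Type) (s : seq J) (a : J -> C) (F : J -> V -> C) :
  (forall i, smooth_on W (F i)) ->
  smooth_on W (fun x => \sum_(i <- s) a i * F i x) /\
  ev T (fun x => \sum_(i <- s) a i * F i x) = \sum_(i <- s) a i * ev T (F i).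
Proof.
move=> sF; elim: s => [|i s [sI IH]].
  have s0 := @smooth_on_cst R d W 0 oW.
  rewrite big_nil (_ : (fun _ => _) = fun=> 0); last by apply/funext => x; rewrite big_nil.
  split; first exact: s0.
  apply: normc_le0; rewrite -[leRHS](mulr0 c); apply: hb => // u uk x Lx.
  by rewrite -[(fun=> 0)]/(0 : V -> C) pderivs0 normc0.
rewrite (_ : (fun _ => _) = fun x => a i * F i x + (fun x => \sum_(i <- s) a i * F i x) x).
  split; last by rewrite (hl _ (sF i) sI) IH big_cons.
  exact: (smooth_onD oW (smooth_onM oW (smooth_on_cst (a i) oW) (sF i)) sI).
by apply/funext => x; rewrite big_cons.
Qed.

Definition partial_geom n z j (x : V) : C := \sum_(i < n) (z 0 j * crd j x) ^+ i.

(** The partial sums over boxes of multi-indices are the values of T on products of partial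
    geometric series. *)
Lemma ev_box n z :
  \sum_(al <- finmap.enum_fset (box n)) moment T al * mono al z =
  ev T (fun x => \prod_j partial_geom n z j x).
Proof.
rewrite sum_box.
rewrite (_ : (fun x => \prod_j partial_geom n z j x) = fun x =>
   \sum_(f <- index_enum {ffun 'I_d -> 'I_n}) mono (emb f) z * rmono (emb f) x).
  have [_ ->] := @ev_sum _ (index_enum {ffun 'I_d -> 'I_n}) (fun f => mono (emb f) z)
    (fun f => rmono (emb f)) (fun f => smooth_rmono (emb f) oW).
  by apply: eq_bigr => f _; rewrite mulrC.
apply/funext => x; rewrite /partial_geom bigA_distr_bigA /=; apply: eq_bigr => f _.
rewrite /rmono /mono -big_split; apply: eq_bigr => j _ /=.
by rewrite ffunE mxE exprMn.
Qed.

Lemma sub_bound_partial_geom n z j : small z ->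
  SB (partial_geom n z j) (4 * (B * B)) /\
  SB (fun x => gfactor z j x - partial_geom n z j x) (2 * (B * B) * (1 / 2) ^+ n).
Proof.
move=> zs.
have h0 : (0 : R) <= 1 / 2 by lra.
have B0 : 0 <= 2 * B by rewrite mulr_ge0// ltW// pb_scale_gt0.
have w0 : 0 <= B * (1 / 2) ^+ n by rewrite mulr_ge0 ?exprn_ge0// ltW// pb_scale_gt0.
have hw := sub_boundX oW LW n h0 (sub_bound_scaled_crd j zs).
have h1 := sub_boundM oW LW w0 B0 hw (sub_bound_gfactor j zs).
have E1 x : W x -> (z 0 j * crd j x) ^+ n * gfactor z j x = gfactor z j x - partial_geom n z j x.
  move=> Wx; have w1 := coord_lt1 j zs Wx.
  have : 1 - (z 0 j * crd j x) ^+ n = (1 - z 0 j * crd j x) * partial_geom n z j x.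
    rewrite /partial_geom -{1}(expr1n _ n) subrXX; congr (_ * _).
    by apply: eq_bigr => i _; rewrite expr1n mul1r.
  move=> E2; rewrite -[partial_geom _ _ _ _](mulKf w1) -E2 -/(gfactor z j x); ring.
have spg : smooth_on W (partial_geom n z j).
  have sw (i : 'I_n) : true -> smooth_on W (fun x => (z 0 j * crd j x) ^+ (i : nat)).
    by move=> _; exact (smooth_onX (i : nat) oW (sub_bound_scaled_crd j zs).1).
  exact (smooth_on_sum (index_enum 'I_n) oW sw).
have h2 : SB (fun x => gfactor z j x - partial_geom n z j x) (2 * (B * B) * (1 / 2) ^+ n).
  split; first exact: (smooth_onB oW (sub_bound_gfactor j zs).1 spg).
  apply: (pb_eq_on oW LW E1).
  by have := h1.2; congr (pb _ _ _ _); ring.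
split=> //.
have h3 := sub_boundD oW LW (sub_bound_gfactor j zs) (sub_boundZ oW LW (-1) h2).
have {}h3 : SB (partial_geom n z j) (2 * B + normc (-1 : C) * (2 * (B * B) * (1 / 2) ^+ n)).
  rewrite [X in sub_bound _ _ _ X _](_ : _ =
    fun x => gfactor z j x + -1 * (gfactor z j x - partial_geom n z j x)); first exact h3.
  by apply/funext => x; ring.
apply: sub_bound_le h3; rewrite normcN normc1 mul1r.
have : (1 / 2 : R) ^+ n <= 1 by rewrite exprn_ile1//; lra.
have := pb_scale_ge1 (R := R) k => B1 p1.
have : B <= B * B by rewrite ler_peMl// ltW// pb_scale_gt0.
have : 2 * (B * B) * (1 / 2) ^+ n <= 2 * (B * B).
  by rewrite ler_piMr// !mulr_ge0// ltW// pb_scale_gt0.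
lra.
Qed.

(** Telescoping over the factors; each replacement costs a remainder (1/2)^n. *)
Lemma sub_bound_box_error n z (s : seq 'I_d) : small z ->
  SB (fun x => \prod_(j <- s) gfactor z j x - \prod_(j <- s) partial_geom n z j x)
     ((size s)%:R * (B * (4 * (B * B)) ^+ size s) * (1 / 2) ^+ n).
Proof.
move=> zs.
have B1 := pb_scale_ge1 (R := R) k; have B0 := pb_scale_gt0 (R := R) k.
pose Q := 4 * (B * B).
have Q0 : 0 <= Q by rewrite !mulr_ge0// ltW.
have QB : 2 * B <= Q.
  rewrite /Q; have : B <= B * B by rewrite ler_peMl// ltW.
  lra.
have q0 : 0 <= (1 / 2 : R) ^+ n by rewrite exprn_ge0//; lra.
elim: s => [|j s IH].
  rewrite mul0r mul0r (_ : (fun _ => _) = fun=> 0); last by apply/funext => x; rewrite !big_nil subrr.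
  by have := sub_bound_cst (W := W) L k oW (0 : C); rewrite normc0 mulr0.
rewrite (_ : (fun _ => _) = fun x =>
   gfactor z j x * (\prod_(j <- s) gfactor z j x - \prod_(j <- s) partial_geom n z j x) +
   (gfactor z j x - partial_geom n z j x) * \prod_(j <- s) partial_geom n z j x); last first.
  by apply/funext => x; rewrite !big_cons; ring.
have [h1 h2] := sub_bound_partial_geom n j zs.
have hs := @sub_bound_prod _ _ W L k oW LW _ s (fun j => partial_geom n z j) (fun=> Q) (fun=> Q0)
   (fun j => (sub_bound_partial_geom n j zs).1).
rewrite big_const_seq count_predT iter_mulr_1 in hs.
have p1 : 0 <= (size s)%:R * (B * Q ^+ size s) * (1 / 2) ^+ n.
  by rewrite !mulr_ge0 ?exprn_ge0// ?ltW//; lra.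
have p2 : 0 <= 2 * (B * B) * (1 / 2) ^+ n by rewrite !mulr_ge0// ltW.
have p3 : 0 <= B * Q ^+ size s by rewrite mulr_ge0 ?exprn_ge0// ltW.
have p4 : 0 <= 2 * B by rewrite mulr_ge0// ltW.
have h3 := sub_boundD oW LW (sub_boundM oW LW p4 p1 (sub_bound_gfactor j zs) IH) (sub_boundM oW LW p2 p3 h2 hs).
apply: sub_bound_le h3.
rewrite -/Q [size (j :: s)]/= -natr1 exprS.
rewrite [leRHS](_ : _ = Q * ((size s)%:R * (B * Q ^+ size s) * (1 / 2) ^+ n) +
  Q * (1 / 2) ^+ n * (B * Q ^+ size s)); last by ring.
apply: lerD; first exact: (ler_wpM2r p1 QB).
rewrite ler_wpM2r// ler_wpM2r// /Q.
have : 0 <= B * B by rewrite mulr_ge0// ltW.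
lra.
Qed.

(** The partial sums over boxes converge by the telescoping estimate, and the moments are bounded
    by a geometric sequence, which gives unconditional convergence. *)
Lemma transform_expansion z : small z ->
  psums (moment T) z @ summability.totally --> hadamard_transform T z.
Proof.
move=> zs; rewrite hadamard_transformE.
have B0 := pb_scale_gt0 (R := R) k.
pose K0 := c * (B * B ^+ d).
have K00 : 0 <= K0 by rewrite !mulr_ge0// ?exprn_ge0// ltW.
apply: (@uncond_cvg_exhaustion _ _ _ _ box (K0 * 2 ^+ d)).
- exact: box_mono.
- exact: box_exhaust.
- move=> n; rewrite sum_box.
  apply: (@le_trans _ _ (\sum_(f : {ffun 'I_d -> 'I_n}) K0 * \prod_j (1 / 2) ^+ (f j : nat))).
    apply: ler_sum => f _; rewrite normcM normc_mono.
    apply: (@le_trans _ _ (c * (B * (B ^+ d * \prod_j crd_bound ^+ emb f j)) * \prod_j conv_radius ^+ emb f j)).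
      apply: ler_pM; [exact: normc_ge0| |exact: moment_bound|].
        by apply: prodr_ge0 => j _; rewrite exprn_ge0// normc_ge0.
      apply: ler_prod => j _; rewrite exprn_ge0 ?normc_ge0//=.
      by apply: lerXn2r; rewrite ?nnegrE ?normc_ge0//; exact: ltW conv_radius_gt0.
    rewrite (_ : c * _ * _ = K0 * (\prod_j crd_bound ^+ emb f j * \prod_j conv_radius ^+ emb f j)); last first.
      by rewrite /K0; ring.
    rewrite -big_split /= ler_wpM2l// le_eqVlt; apply/orP; left; apply/eqP.
    apply: eq_bigr => j _; rewrite -exprMn ffunE; congr (_ ^+ _).
    by rewrite /conv_radius; field; rewrite gt_eqF// crd_bound_gt0.
  rewrite -mulr_sumr ler_wpM2l// -(bigA_distr_bigA (fun (j : 'I_d) (i : 'I_n) => (1 / 2 : R) ^+ i)) /=.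
  rewrite -[X in _ <= _ ^+ X]card_ord -prodr_const.
  apply: ler_prod => j _; rewrite geom_half_le andbT.
  by apply: sumr_ge0 => i _; rewrite exprn_ge0//; lra.
- move=> e e0.
  pose K1 := c * (d%:R * (B * (4 * (B * B)) ^+ d)) + 1.
  have K10 : 0 < K1.
    by rewrite /K1 ltr_wpDl// !mulr_ge0// ?exprn_ge0// ?mulr_ge0// ltW.
  exists (Num.trunc (K1 / e)).+1 => m.
  set n := (Num.trunc _).+1 => nm.
  rewrite ev_box.
  have hS := sub_bound_box_error m (index_enum 'I_d) zs.
  rewrite [size _](_ : _ = d) in hS; last by rewrite -[RHS]card_ord cardE enumT.
  have [sv _] := @sub_bound_prod _ _ W L k oW LW _ (index_enum 'I_d) (gfactor z) (fun=> 2 * B)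
    (fun=> mulr_ge0 (ler0n _ 2) (ltW B0)) (fun j => sub_bound_gfactor j zs).
  have [sp _] := @sub_bound_prod _ _ W L k oW LW _ (index_enum 'I_d) (fun j => partial_geom m z j)
    (fun=> 4 * (B * B)) (fun=> mulr_ge0 (ler0n _ 4) (mulr_ge0 (ltW B0) (ltW B0)))
    (fun j => (sub_bound_partial_geom m j zs).1).
  have hd := hl (-1) sp sv; rewrite mulN1r addrC in hd; rewrite -hd.
  rewrite (_ : (fun x => _) = (fun x => \prod_j gfactor z j x - \prod_j partial_geom m z j x)); last first.
    by apply/funext => x; rewrite mulN1r addrC.
  have q0 : 0 <= (1 / 2 : R) ^+ m by rewrite exprn_ge0//; lra.
  apply: le_lt_trans (ev_bound _ hS) _; first by rewrite !mulr_ge0// ?exprn_ge0// ?mulr_ge0// ltW.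
  rewrite mulrA; apply: (@lt_le_trans _ _ (K1 * (1 / 2) ^+ m)).
    by rewrite ltr_pM2r ?exprn_gt0 ?divr_gt0// /K1 ltrDl.
  have h1 : K1 / e <= m%:R.
    apply: (@le_trans _ _ n%:R); last by rewrite ler_nat.
    by apply/ltW; have /truncn_itv/andP[] : 0 <= K1 / e by rewrite divr_ge0// ltW.
  have h2 : (m%:R : R) <= 2 ^+ m by rewrite -natrX ler_nat ltnW// ltn_expl.
  rewrite expr_div_n expr1n mulrA mulr1 ler_pdivrMr ?exprn_gt0// [e * _]mulrC -ler_pdivrMr//.
  exact: le_trans h1 h2.
Qed.

Lemma small_norm z : `|z| <= conv_radius%:C -> small z.
Proof.
move=> zd j; rewrite -lecR -normcE0; exact: le_trans (coordC_le_norm z j) zd.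
Qed.

(** The resolvent identity. *)
Lemma gfactor_sub z h j x : small z -> small (z + h) -> W x ->
  gfactor (z + h) j x - gfactor z j x = h 0 j * crd j x * (gfactor z j x * gfactor (z + h) j x).
Proof.
move=> zs zhs Wx; have p := coord_lt1 j zs Wx; have q := coord_lt1 j zhs Wx.
rewrite /gfactor mxE; rewrite mxE in q; move: p q; move: (z 0 j) (h 0 j) (crd j x) => a b t p q.
by field; rewrite p q.
Qed.

Definition step_ok z h (eta : R) := [/\ small z, small (z + h), 0 <= eta &
  forall j, normc (h 0 j) <= eta].

Lemma sub_bound_gfactor_sub z h eta j : step_ok z h eta ->
  SB (fun x => gfactor (z + h) j x - gfactor z j x) (crd_bound * (2 * B * (2 * B)) * eta).
Proof.
move=> [zs zhs e0 he]; have B0 := pb_scale_gt0 (R := R) k; have r0 := crd_bound_gt0.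
have Bp := ltW B0; have rp := ltW r0.
have B20 : 0 <= 2 * B by rewrite mulr_ge0.
have h1 := sub_boundM oW LW (ltW r0) (mulr_ge0 B20 B20) (sub_bound_crd j)
  (sub_boundM oW LW B20 B20 (sub_bound_gfactor j zs) (sub_bound_gfactor j zhs)).
have h2 := sub_boundZ oW LW (h 0 j) h1.
have h3 : SB (fun x => h 0 j * (crd j x * (gfactor z j x * gfactor (z + h) j x)))
    (crd_bound * (2 * B * (2 * B)) * eta).
  apply: sub_bound_le h2; rewrite mulrC; apply: ler_wpM2l; last exact: he.
  exact: (mulr_ge0 rp (mulr_ge0 B20 B20)).
split; first exact: (smooth_onB oW (sub_bound_gfactor j zhs).1 (sub_bound_gfactor j zs).1).
by apply: (pb_eq_on oW LW _ h3.2) => x Wx; rewrite (gfactor_sub _ zs zhs Wx) mulrA.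
Qed.

Lemma sub_bound_prod_sub (s : seq 'I_d) : exists2 D, 0 <= D & forall z h eta, step_ok z h eta ->
  SB (fun x => \prod_(j <- s) gfactor (z + h) j x - \prod_(j <- s) gfactor z j x) (D * eta).
Proof.
have B0 := pb_scale_gt0 (R := R) k; have r0 := crd_bound_gt0.
have Bp := ltW B0; have rp := ltW r0.
have B20 : 0 <= 2 * B by rewrite mulr_ge0.
elim: s => [|j s [D D0 IH]].
  exists 0 => // z h eta _; rewrite mul0r.
  rewrite (_ : (fun _ => _) = fun=> 0); last by apply/funext => x; rewrite !big_nil subrr.
  by have := sub_bound_cst (W := W) L k oW (0 : C); rewrite normc0 mulr0.
exists (2 * B * D + crd_bound * (2 * B * (2 * B)) * (B * (2 * B) ^+ size s)).
  apply: addr_ge0; first exact: (mulr_ge0 B20 D0).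
  exact: (mulr_ge0 (mulr_ge0 rp (mulr_ge0 B20 B20)) (mulr_ge0 Bp (exprn_ge0 _ B20))).
move=> z h eta hz; have [zs zhs e0 he] := hz.
rewrite (_ : (fun _ => _) = fun x =>
   gfactor (z + h) j x * (\prod_(j <- s) gfactor (z + h) j x - \prod_(j <- s) gfactor z j x) +
   (gfactor (z + h) j x - gfactor z j x) * \prod_(j <- s) gfactor z j x); last first.
  by apply/funext => x; rewrite !big_cons; ring.
have hs := @sub_bound_prod _ _ W L k oW LW _ s (fun j => gfactor z j) (fun=> 2 * B) (fun=> B20)
   (fun j => sub_bound_gfactor j zs).
rewrite big_const_seq count_predT iter_mulr_1 in hs.
have p1 : 0 <= D * eta by exact: mulr_ge0.
have p2 : 0 <= crd_bound * (2 * B * (2 * B)) * eta.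
  exact: (mulr_ge0 (mulr_ge0 rp (mulr_ge0 B20 B20)) e0).
have p3 : 0 <= B * (2 * B) ^+ size s by rewrite mulr_ge0 ?exprn_ge0.
have h3 := sub_boundD oW LW (sub_boundM oW LW B20 p1 (sub_bound_gfactor j zhs) (IH _ _ _ hz))
  (sub_boundM oW LW p2 p3 (sub_bound_gfactor_sub j hz) hs).
by apply: sub_bound_le h3; rewrite le_eqVlt; apply/orP; left; apply/eqP; ring.
Qed.

(** In the product over j :: s, the term v_j times the error over s has a quadratic bound by
    induction; the rest is h_j x_j v_j times the first order increment of the whole product. *)
Lemma sub_bound_prod_taylor (s : seq 'I_d) : exists2 D, 0 <= D & forall z h eta, step_ok z h eta ->
  SB (fun x => \prod_(j <- s) gfactor (z + h) j x - \prod_(j <- s) gfactor z j x -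
       \sum_(i <- s) h 0 i * (crd i x * gfactor z i x * \prod_(j <- s) gfactor z j x)) (D * (eta * eta)).
Proof.
have B0 := pb_scale_gt0 (R := R) k; have r0 := crd_bound_gt0.
have Bp := ltW B0; have rp := ltW r0.
have B20 : 0 <= 2 * B by rewrite mulr_ge0.
elim: s => [|j s [D D0 IH]].
  exists 0 => // z h eta _; rewrite mul0r.
  rewrite (_ : (fun _ => _) = fun=> 0); last by apply/funext => x; rewrite !big_nil !subrr.
  by have := sub_bound_cst (W := W) L k oW (0 : C); rewrite normc0 mulr0.
have [D1 D10 H1] := sub_bound_prod_sub (j :: s).
exists (2 * B * D + crd_bound * (2 * B) * D1); first exact:
  (addr_ge0 (mulr_ge0 B20 D0) (mulr_ge0 (mulr_ge0 rp B20) D10)).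
move=> z h eta hz; have [zs zhs e0 he] := hz.
have p1 : 0 <= D * (eta * eta) by rewrite !mulr_ge0.
have p2 : 0 <= D1 * eta by exact: mulr_ge0.
have p3 : 0 <= crd_bound * (2 * B) by exact: (mulr_ge0 rp B20).
have h1 := sub_boundM oW LW B20 p1 (sub_bound_gfactor j zs) (IH _ _ _ hz).
have h2 := sub_boundZ oW LW (h 0 j) (sub_boundM oW LW p3 p2
  (sub_boundM oW LW (ltW r0) B20 (sub_bound_crd j) (sub_bound_gfactor j zs)) (H1 _ _ _ hz)).
have h3 := sub_boundD oW LW h1 h2.
have E x : W x ->
   gfactor z j x * (\prod_(j <- s) gfactor (z + h) j x - \prod_(j <- s) gfactor z j x -
       \sum_(i <- s) h 0 i * (crd i x * gfactor z i x * \prod_(j <- s) gfactor z j x)) +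
   h 0 j * (crd j x * gfactor z j x *
     (\prod_(j <- j :: s) gfactor (z + h) j x - \prod_(j <- j :: s) gfactor z j x)) =
   \prod_(j <- j :: s) gfactor (z + h) j x - \prod_(j <- j :: s) gfactor z j x -
       \sum_(i <- j :: s) h 0 i * (crd i x * gfactor z i x * \prod_(j <- j :: s) gfactor z j x).
  move=> Wx; rewrite !big_cons.
  rewrite [X in _ = _ - (_ + X)](_ : _ = gfactor z j x *
    \sum_(i <- s) h 0 i * (crd i x * gfactor z i x * \prod_(j <- s) gfactor z j x)); last first.
    by rewrite mulr_sumr; apply: eq_bigr => i _; ring.
  have := gfactor_sub j zs zhs Wx.
  move: (gfactor (z + h) j x) (gfactor z j x) (h 0 j) (crd j x) (\prod_(i <- s) gfactor (z + h) i x)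
    (\sum_(i <- s) h 0 i * (crd i x * gfactor z i x * \prod_(j <- s) gfactor z j x))
    => v' v b t P' S.
  move: (\prod_(i <- s) gfactor z i x) => P Ev.
  apply/eqP; rewrite -subr_eq0.
  rewrite (_ : _ - _ = - P' * (v' - v - b * t * (v * v'))); last by ring.
  by rewrite Ev subrr mulr0.
have h4 : SB (fun x => \prod_(j <- j :: s) gfactor (z + h) j x - \prod_(j <- j :: s) gfactor z j x -
     \sum_(i <- j :: s) h 0 i * (crd i x * gfactor z i x * \prod_(j <- j :: s) gfactor z j x))
   (2 * B * (D * (eta * eta)) + normc (h 0 j) * (crd_bound * (2 * B) * (D1 * eta))).
  split; last exact: (pb_eq_on oW LW E h3.2).
  exact (smooth_on_eq oW E h3.1).
apply: sub_bound_le h4; rewrite [leRHS]mulrDl; apply: lerD.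
  by rewrite mulrA.
rewrite (_ : crd_bound * (2 * B) * D1 * (eta * eta) = eta * (crd_bound * (2 * B) * (D1 * eta))); last by ring.
by apply: ler_wpM2r; [exact: mulr_ge0|exact: he].
Qed.

(** The derivative of the transform, a linear form in the increment. *)
Definition dform (a : 'I_d -> C) h : C := \sum_j h 0 j * a j.

Lemma dform_linear a : linear (dform a).
Proof.
move=> l u v; rewrite /dform scaler_sumr -big_split /=; apply: eq_bigr => j _.
by rewrite !mxE mulrDl -mulrA.
Qed.
HB.instance Definition _ a := GRing.isLinear.Build C 'rV[C]_d C _ (dform a) (@dform_linear a).

Lemma dform_continuous a : continuous (dform a).
Proof.
move=> z; apply/(@cvg_normc_leP _ _ _ (nbhs_filter z)) => e e0.
pose S := \sum_j normc (a j) + 1.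
have S0 : 0 < S by rewrite ltr_wpDl// sumr_ge0// => j _; exact: normc_ge0.
have : \forall t \near z, `|z - t| < (e / S)%:C.
  have l0 : 0 < (e / S)%:C by rewrite ltcR divr_gt0.
  exact (@cvgr_dist_lt _ _ _ _ (nbhs_filter z) id z (@cvg_id _ (nbhs z)) _ l0).
apply: filterS => t zt.
have hj j : normc ((z - t) 0 j) <= e / S.
  by rewrite -lecR -normcE0; exact: le_trans (coordC_le_norm _ j) (ltW zt).
rewrite -linearB /= /dform.
apply: le_trans (normc_sum _ _ _) _.
apply: (@le_trans _ _ (\sum_j e / S * normc (a j))).
  by apply: ler_sum => j _; rewrite normcM; apply: ler_wpM2r; [exact: normc_ge0|exact: hj].
rewrite -mulr_sumr mulrAC ler_pdivrMr// ler_pM2l// /S.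
by rewrite lerDl.
Qed.

Lemma smooth_hkernel z : small z -> smooth_on W (hkernel z).
Proof.
move=> zs; have B20 : 0 <= 2 * B by exact: (mulr_ge0 (ler0n _ 2) (ltW (pb_scale_gt0 k))).
exact (@sub_bound_prod _ _ W L k oW LW _ (index_enum 'I_d) (gfactor z) (fun=> 2 * B)
  (fun=> B20) (fun j => sub_bound_gfactor j zs)).1.
Qed.

Definition dcoef z j : C := ev T (fun x => crd j x * gfactor z j x * hkernel z x).

Lemma transform_taylor : exists2 D, 0 <= D & forall z h eta, step_ok z h eta ->
  normc (hadamard_transform T (z + h) - hadamard_transform T z - dform (dcoef z) h)
    <= D * (eta * eta).
Proof.
have [D D0 HD] := sub_bound_prod_taylor (index_enum 'I_d).
exists (c * D); first exact: mulr_ge0.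
move=> z h eta hz; have [zs zhs e0 he] := hz.
have hS := HD _ _ _ hz.
have p0 : 0 <= D * (eta * eta) by rewrite !mulr_ge0.
have sF j : smooth_on W (fun x => crd j x * gfactor z j x * hkernel z x).
  exact (smooth_onM oW (smooth_onM oW (sub_bound_crd j).1 (sub_bound_gfactor j zs).1) (smooth_hkernel zs)).
have [sS eS] := @ev_sum _ (index_enum 'I_d) (fun j => h 0 j) _ sF.
have e1 := hl 1 (smooth_hkernel zs) sS.
have s1 := smooth_onD oW (smooth_onM oW (smooth_on_cst 1 oW) (smooth_hkernel zs)) sS.
have e2 := hl (-1) s1 (smooth_hkernel zhs).
rewrite e1 eS -!hadamard_transformE in e2.
rewrite (_ : hadamard_transform T (z + h) - hadamard_transform T z - dform (dcoef z) h =
  -1 * (1 * hadamard_transform T z + \sum_(i <- index_enum 'I_d) h 0 i *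
    ev T (fun x => crd i x * gfactor z i x * hkernel z x)) + hadamard_transform T (z + h)).
  rewrite -e2 (_ : (fun _ => _) = fun x =>
    \prod_(j < d) gfactor (z + h) j x - \prod_(j < d) gfactor z j x -
     \sum_(i < d) h 0 i * (crd i x * gfactor z i x * \prod_(j < d) gfactor z j x)).
    by rewrite -mulrA; exact: (ev_bound p0 hS).
  apply/funext => x; rewrite -/(hkernel z x) -/(hkernel (z + h) x).
  rewrite -[LHS]/(-1 * (1 * hkernel z x + \sum_i h 0 i * (crd i x * gfactor z i x * hkernel z x)) + hkernel (z + h) x).
  by rewrite mul1r mulN1r opprD [LHS]addrC addrA.
by rewrite mul1r mulN1r opprD [RHS]addrC addrA.
Qed.

Lemma transform_differentiable z : `|z| <= (conv_radius / 2)%:C ->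
  differentiable (hadamard_transform T) z.
Proof.
move=> zd.
have d0 := conv_radius_gt0.
have [D D0 HD] := transform_taylor.
have zs : small z by apply: small_norm; apply: le_trans zd _; rewrite lecR; lra.
apply: (@differentiable_remainder _ _ _ _ (dform (dcoef z)) z (@dform_continuous _)) => e e0.
have eE := ge0_ReE (ltW e0).
have e'0 : 0 < complex.Re e by move: e0; rewrite {1}eE ltcR.
pose eta0 := Num.min (conv_radius / 2) (complex.Re e / (D + 1)).
have cD : 0 < D + 1 by rewrite ltr_wpDl.
have eta00 : 0 < eta0 by rewrite lt_min !divr_gt0.
have : \forall h \near (0 : 'rV[C]_d), `|h| < eta0%:C by apply: nbhs0_lt; rewrite ltcR.
apply: filterS => h hh.
have hE := ge0_ReE (normr_ge0 h).
set eta := complex.Re `|h| in hE.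
have et0 : 0 <= eta by have := normr_ge0 h; rewrite hE lecR.
have hj j : normc (h 0 j) <= eta.
  by rewrite -lecR -normcE0 -hE; exact: coordC_le_norm.
have ete : eta < eta0 by rewrite -ltcR -hE.
have zhs : small (z + h).
  apply: small_norm; apply: le_trans (ler_normD _ _) _.
  rewrite (_ : conv_radius%:C = (conv_radius / 2)%:C + (conv_radius / 2)%:C); last by rewrite -rmorphD -splitr.
  apply: lerD => //; rewrite hE lecR; apply: ltW (lt_le_trans ete _).
  by rewrite ge_min lexx.
have hz : step_ok z h eta by split.
rewrite hE eE normcE0 -rmorphM lecR [h + z]addrC opprD addrA.
apply: le_trans (HD _ _ _ hz) _; rewrite mulrA; apply: ler_wpM2r => //.
have h1 : eta <= complex.Re e / (D + 1).
  by apply: ltW (lt_le_trans ete _); rewrite ge_min lexx orbT.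
rewrite ler_pdivlMr// in h1; apply: le_trans h1.
by rewrite mulrC ler_wpM2l// lerDl.
Qed.

End Transform.

(** * Taylor coefficients of germs *)

Section Germs.
Context {R : realType} {d : nat}.
Local Notation C := R[i].
Implicit Types (F G H : 'rV[C]_d -> C) (a b c : {ffun 'I_d -> nat} -> C).

Definition has_series F a : Prop :=
  \forall z \near (0 : 'rV[C]_d), psums a z @ summability.totally --> F z.

Lemma near0_polydisc (P : set 'rV[C]_d) : (\forall z \near (0 : 'rV[C]_d), P z) ->
  exists2 r : R, 0 < r & forall z : 'rV[C]_d, (forall j, normc (z 0 j) <= r) -> P z.
Proof.
move=> /nbhs_norm0P[e e0 eP]; exists (complex.Re e / 2).
  by rewrite divr_gt0//; move: e0; rewrite /= ltcE => /andP[].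
move=> z hz; apply: eP => /=.
have eE := ge0_ReE (ltW e0).
have e'0 : 0 < complex.Re e by move: e0; rewrite /= {1}eE ltcR.
have [nz|/mx_norm_neq0[i Ei]] := eqVneq (mx_norm z) 0; first by rewrite [`|z|]nz.
rewrite [`|z|]Ei normcE0 eE ltcR (ord1 i.1); apply: le_lt_trans (hz i.2) _.
by rewrite ltr_pdivrMr// ltr_pMr// ltr1n.
Qed.

Lemma has_series_eq F G a : germ_eq F G -> has_series F a -> has_series G a.
Proof. by move=> FG; apply: filterS2 FG => z ->. Qed.

Lemma has_series_lin (l : C) F G a b : has_series F a -> has_series G b ->
  has_series (l *: F + G) (fun al => l * a al + b al).
Proof.
move=> Fa Gb; apply: (filterS2 _ _ Fa Gb) => z Fz Gz.
rewrite /psums (_ : (fun al => _) = fun al => l * (a al * mono al z) + b al * mono al z).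
  exact: (uncond_cvg_lin (a := l) Fz Gz).
by apply/funext => al; rewrite mulrDl mulrA.
Qed.

Lemma has_series_unique F a b : has_series F a -> has_series F b -> a = b.
Proof.
move=> Fa Fb; apply/funext => al; apply/eqP; rewrite -subr_eq0 -mulN1r addrC; apply/eqP.
have H0 := has_series_lin (-1) Fb Fa.
have [r r0 hr] := near0_polydisc H0.
apply: (@null_on_zero _ _ r (fun al => -1 * b al + a al) r0) => z zr.
have := hr z zr; rewrite (_ : (-1 *: F + F) z = 0)//.
by rewrite scaleN1r addNr.
Qed.

Lemma has_series_germ_eq F G a : has_series F a -> has_series G a -> germ_eq F G.
Proof.
move=> Fa Ga; apply: (filterS2 _ _ Fa Ga) => z Fz Gz.
exact: (uncond_cvg_unique Fz Gz).
Qed.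

Lemma taylorE F a : has_series F a -> taylor F = a.
Proof. by move=> Fa; apply: xget_unique => // b Fb; exact: (has_series_unique Fb Fa). Qed.

(** The limit in the Hadamard product exists as soon as some function has the product
    coefficients. *)
Lemma hadamard_mul_germ F G H a b : has_series F a -> has_series G b ->
  has_series H (fun al => a al * b al) -> germ_eq (hadamard_mul F G) H.
Proof.
move=> Fa Gb; apply: filterS => z Hz.
rewrite /hadamard_mul (taylorE Fa) (taylorE Gb).
exact: (cvg_lim (@norm_hausdorff _ _) Hz).
Qed.

End Germs.

(** * The algebra of Hadamard transforms *)

Section TransformAlgebra.
Context {R : realType} {d : nat}.
Local Notation C := R[i].
Local Notation V := 'rV[R]_d.
Local Notation E := (Cinfty [set: V]).
Implicit Types (T S : E -> C).

Lemma transform_near T : linear T -> continuous T -> compact (dsupp T) ->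
  \forall z \near (0 : 'rV[C]_d),
    [/\ hadamardW (dsupp T) z, differentiable (hadamard_transform T) z &
      psums (moment T) z @ summability.totally --> hadamard_transform T z].
Proof.
move=> lT cT kT.
have [r r0 hr] := compact_in_cube kT.
have rho0 : 0 < r + 1 by rewrite ltr_wpDl// ltW.
have TW : dsupp T `<=` open_cube (r + 1).
  move=> x /hr hx j; have := hx j; rewrite mxE subr0 => h; apply: le_lt_trans h _.
  by rewrite ltrDl.
have [L [k [c [cL LW c0 hb hl]]]] := ev_bounded lT cT (@open_open_cube _ _ (r + 1)) TW.
have d0 := conv_radius_gt0 k rho0.
have : \forall z \near (0 : 'rV[C]_d), `|z| < (conv_radius (r + 1) k / 2)%:C.
  by apply: nbhs0_lt; rewrite ltcR divr_gt0.
apply: filterS => z /ltW hz.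
have zs : small (r + 1) k z.
  by apply: small_norm; apply: le_trans hz _; rewrite lecR; lra.
split.
- exact: (small_hadamardW rho0 TW zs).
- exact: (transform_differentiable rho0 cL LW c0 hb hl hz).
- exact: (transform_expansion rho0 cL LW c0 hb hl zs).
Qed.

Variable Omega : set V.
Hypothesis oO : open Omega.
Hypothesis O0 : Omega !=set0.
Implicit Types (F G H : 'rV[C]_d -> C).
Local Notation A := (cdistr (dilations Omega)).
Local Notation germs := (hadamard_germs Omega).

Lemma transform_series T : A T -> has_series (hadamard_transform T) (moment T).
Proof.
move=> [lT cT kT _]; apply: filterS (transform_near lT cT kT) => z [] //.
Qed.

Lemma germ_series F : germs F -> has_series F (taylor F).
Proof.
move=> [T hT FT].
have h : has_series F (moment T).
  by apply: has_series_eq (transform_series hT); apply: filterS FT.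
by rewrite (taylorE h).
Qed.

Lemma germ_intro T F : A T -> has_series F (moment T) -> germs F.
Proof. by move=> hT FT; exists T => //; exact: (has_series_germ_eq FT (transform_series hT)). Qed.

Lemma germ_moment F : germs F -> exists2 T, A T & taylor F = moment T.
Proof.
move=> [T hT FT]; exists T => //; apply: taylorE.
by apply: has_series_eq (transform_series hT); apply: filterS FT.
Qed.

Lemma germ_mul F G : germs F -> germs G -> germs (hadamard_mul F G) /\
  has_series (hadamard_mul F G) (fun al => taylor F al * taylor G al).
Proof.
move=> hF hG; have [T hT ET] := germ_moment hF; have [S hS ES] := germ_moment hG.
have [hTS mTS] := star_cdistr oO O0 hT hS.
have hs : has_series (hadamard_transform (star T S)) (fun al => taylor F al * taylor G al).
  rewrite (_ : (fun al => _) = moment (star T S)); first exact: transform_series.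
  by apply/funext => al; rewrite mTS ET ES.
have e := hadamard_mul_germ (germ_series hF) (germ_series hG) hs.
split; first by exists (star T S).
by apply: has_series_eq hs; apply: filterS e.
Qed.

Lemma germ_lin (a : C) F G : germs F -> germs G -> germs (a *: F + G) /\
  has_series (a *: F + G) (fun al => a * taylor F al + taylor G al).
Proof.
move=> hF hG; have [T hT ET] := germ_moment hF; have [S hS ES] := germ_moment hG.
have [hTS mTS] := cdistr_lin a hT hS.
have hs := has_series_lin a (germ_series hF) (germ_series hG).
split=> //; apply: (germ_intro hTS).
rewrite (_ : moment _ = (fun al => a * taylor F al + taylor G al)); first exact: hs.
by apply/funext => al; rewrite mTS ET ES.
Qed.

(** Germs with the same Taylor coefficients are equal, so each law is checked on coefficients. *)
Lemma germs_algebra : is_algebra germ_eq germs hadamard_mul.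
Proof.
split.
- by move=> a u v hu hv; exact: (germ_lin a hu hv).1.
- by move=> u v hu hv; exact: (germ_mul hu hv).1.
- move=> u u' v v' hu hu' hv hv' eu ev.
  have Eu : taylor u = taylor u' by apply: taylorE; apply: has_series_eq (germ_series hu'); apply: filterS eu.
  have Ev : taylor v = taylor v' by apply: taylorE; apply: has_series_eq (germ_series hv'); apply: filterS ev.
  apply: (has_series_germ_eq (germ_mul hu hv).2); rewrite Eu Ev; exact: (germ_mul hu' hv').2.
- move=> u v w hu hv hw.
  have [h1 s1] := germ_mul hv hw; have [h2 s2] := germ_mul hu hv.
  have [_ s3] := germ_mul hu h1; have [_ s4] := germ_mul h2 hw.
  apply: (has_series_germ_eq s3); rewrite (taylorE s1).
  rewrite (taylorE s2) in s4; rewrite (_ : (fun al => _) = fun al => taylor u al * taylor v al * taylor w al)//.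
  by apply/funext => al; rewrite mulrA.
- move=> a u v w hu hv hw.
  have [h1 s1] := germ_lin a hu hv; have [h2 s2] := germ_mul hu hw; have [h3 s3] := germ_mul hv hw.
  have [_ s4] := germ_mul h1 hw; have s5 := has_series_lin a s2 s3.
  apply: (has_series_germ_eq s4); rewrite (taylorE s1).
  rewrite (_ : (fun al => _) = fun al => a * (taylor u al * taylor w al) + taylor v al * taylor w al)//.
  by apply/funext => al; rewrite mulrDl mulrA.
- move=> a u v w hu hv hw.
  have [h1 s1] := germ_lin a hu hv; have [h2 s2] := germ_mul hw hu; have [h3 s3] := germ_mul hw hv.
  have [_ s4] := germ_mul hw h1; have s5 := has_series_lin a s2 s3.
  apply: (has_series_germ_eq s4); rewrite (taylorE s1).
  rewrite (_ : (fun al => _) = fun al => a * (taylor w al * taylor u al) + taylor w al * taylor v al)//.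
  by apply/funext => al; rewrite mulrDr mulrCA.
- have [e he me] := cdistr_unit oO O0.
  have ge : germs (hadamard_transform e) by apply: (germ_intro he); exact: transform_series.
  have te al : taylor (hadamard_transform e) al = 1 by rewrite (taylorE (transform_series he)) me.
  exists (hadamard_transform e) => // u hu; split.
    apply: (has_series_germ_eq (germ_mul ge hu).2).
    rewrite (_ : (fun al => _) = taylor u); first exact: germ_series.
    by apply/funext => al; rewrite te mul1r.
  apply: (has_series_germ_eq (germ_mul hu ge).2).
  rewrite (_ : (fun al => _) = taylor u); first exact: germ_series.
  by apply/funext => al; rewrite te mulr1.
Qed.

Lemma transform_iso : algebra_iso A star germ_eq germs hadamard_mul hadamard_transform.
Proof.
have hg T : A T -> germs (hadamard_transform T).
  by move=> hT; apply: (germ_intro hT); exact: transform_series.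
split.
- exact: cdistr_algebra.
- exact: germs_algebra.
- exact: hg.
- move=> a u v hu hv; have [h m] := cdistr_lin a hu hv.
  apply: (has_series_germ_eq (transform_series h)).
  have := has_series_lin a (transform_series hu) (transform_series hv).
  by rewrite (_ : moment (a *: u + v) = fun al => a * moment u al + moment v al)//; apply/funext => al; exact: m.
- move=> u v hu hv; have [h m] := star_cdistr oO O0 hu hv.
  apply: (has_series_germ_eq (transform_series h)).
  have := (germ_mul (hg _ hu) (hg _ hv)).2.
  rewrite (taylorE (transform_series hu)) (taylorE (transform_series hv)).
  by rewrite (_ : moment (star u v) = fun al => moment u al * moment v al)//; apply/funext => al; exact: m.
- move=> u v hu hv uv; apply: (cdistr_ext hu hv) => al.
  by rewrite (has_series_unique (has_series_eq uv (transform_series hu)) (transform_series hv)).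
- move=> F [T hT FT]; exists T => //; by apply: filterS FT.
Qed.

(** 1/(1 - x z) is 1/z times 1/(1/z - x). *)
Lemma transform_cauchy T (z : 'rV[C]_d) : A T -> (forall j, z 0 j != 0) ->
  hadamard_transform T z = (\prod_j z 0 j)^-1 * cauchy_transform T (map_mx GRing.inv z).
Proof.
move=> [lT cT _ _] z0.
have p0 : (\prod_j z 0 j)^-1 != 0 by rewrite invr_neq0//; apply/prodf_neq0 => j _; exact: z0.
rewrite /cauchy_transform -(evZ lT cT _ p0); congr (ev T _); apply/funext => x.
rewrite -prodfV -big_split; apply: eq_bigr => j _ /=.
by rewrite mxE -invfM mulrBr mulfV ?z0// [z 0 j * _]mulrC.
Qed.

End TransformAlgebra.

Theorem mainTheorem10 (R : realType) (d : nat) (Omega : set 'rV[R]_d) :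
  open Omega -> Omega !=set0 ->
  [/\ forall T, cdistr (dilations Omega) T ->
        \forall z \near (0 : 'rV[R[i]]_d),
          [/\ hadamardW (dsupp T) z,
              differentiable (hadamard_transform T) z &
              psums (moment T) z @ summability.totally
                --> hadamard_transform T z],
      forall T (f : Cinfty Omega) x, cdistr (dilations Omega) T -> Omega x ->
        Mop Omega T f x = ev T (fun y => f (hmul x y)),
      algebra_iso (cdistr (dilations Omega)) star
        eq (hadamard_ops Omega) (fun M N => M \o N) (Mop Omega),
      algebra_iso (cdistr (dilations Omega)) star
        germ_eq (hadamard_germs Omega) hadamard_mul hadamard_transform &
      forall T (z : 'rV[R[i]]_d), cdistr (dilations Omega) T ->
        (forall j, z 0 j != 0) ->
        cauchyW (dsupp T) (map_mx GRing.inv z) ->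
        hadamard_transform T z =
          (\prod_j z 0 j)^-1 * cauchy_transform T (map_mx GRing.inv z)].
Proof.
move=> oO O0; split.
- by move=> T [lT cT kT _]; exact: transform_near.
- by move=> T f x [lT cT _ TO] Ox; exact: (MopE oO lT cT TO f Ox).
- exact: Mop_iso.
- exact: transform_iso.
- by move=> T z hT z0 _; exact: (transform_cauchy hT z0).
Qed.
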